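(* Let $n\ge1$, $\alpha>0$, $\lambda\in\mathbb C$ with $s=\operatorname{Re}\lambda>0$. There is a constant $c_{n,\alpha,\lambda}>0$ such that for all $f\in L^2(\mathbb R^n)$ and all $a>0$, with $\phi_a=\mathcal P_\lambda f(\cdot,a)$ (holomorphically extended to $\mathcal T_a$), $$\int_{\mathcal T_a}|\phi_a(z)|^2\,{\bf w}^\alpha_{\lambda,a}(z)\,dz=c_{n,\alpha,\lambda}\,a^{-2s+2n}\int_{\mathbb R^n}|\widehat f(\xi)|^2\,w^\alpha_\lambda(a\xi)\,d\xi,$$ where $w^\alpha_\lambda(\xi)=|\xi|^{2s}\,|K_\lambda(|\xi|)|^2\,\dfrac{I_{\alpha+n/2-1}(2|\xi|)}{(2|\xi|)^{\alpha+n/2-1}}$.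
   Context: Real hyperbolic space is modelled as $\mathbb R^n\times\mathbb R_{>0}$ ($N=\mathbb R^n$, $A=\mathbb R_{>0}$). $|\cdot|$ is the Euclidean norm. The normalized Poisson transform is $\mathcal P_\lambda f(x,a)=\int_{\mathbb R^n}f(u)p_\lambda(x-u,a)\,du$ with $p_\lambda(x,a)=\pi^{-n/2}\frac{\Gamma(\lambda+n/2)}{\Gamma(2\lambda)}a^{\lambda+n/2}(a^2+|x|^2)^{-(\lambda+n/2)}$. For $a>0$, $\mathcal T_a=\{x+iy\in\mathbb C^n:|y|<a\}$; $x\mapsto\mathcal P_\lambda f(x,a)$ extends holomorphically to $\mathcal T_a$ by replacing $|x-u|^2$ with $(z-u)^2=\sum_j(z_j-u_j)^2$ (principal branch). $dz$ is Lebesgue measure on $\mathbb C^n$. ${\bf w}^\alpha_{\lambda,a}(x+iy)=(2\pi)^{-n/2}\Gamma(\alpha)^{-1}(1-|y|^2/a^2)^{\alpha-1}$ on $\mathcal T_a$. $\widehat f(\xi)=(2\pi)^{-n/2}\int f(x)e^{-ix\cdot\xi}dx$. $K_\nu$ is the Macdonald (modified Bessel of second kind) function and $I_\beta$ the modified Bessel function of first kind. *)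

(* Defs.v *)
From mathcomp Require Import all_boot all_algebra complex.
From mathcomp Require Import all_classical all_reals all_analysis.
Import GRing.Theory Num.Theory numFieldNormedType.Exports.

Set Implicit Arguments.
Unset Strict Implicit.
Unset Printing Implicit Defensive.

Local Open Scope ring_scope.
Local Open Scope complex_scope.
Local Open Scope classical_set_scope.

Section Hyperbolic.
Variable R : realType.

(* Euclidean space R^(m+1) as the nested product R * (R * ( ... * R)),*)
(* with the product (Borel) sigma-algebra.                            *)
Fixpoint tupS (m : nat) : {d : measure_display & measurableType d} :=
  match m with
  | 0 => existT (fun d => measurableType d) _ (measurableTypeR R : measurableType _)
  | S m => existT (fun d => measurableType d) _
             ((measurableTypeR R * projT2 (tupS m))%type : measurableType _)
  end.

Definition tup (m : nat) : measurableType (projT1 (tupS m)) := projT2 (tupS m).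

(* R^n for n >= 1 *)
Definition Rn (n : nat) := tup n.-1.

Fixpoint dotp (m : nat) : tup m -> tup m -> R :=
  match m return tup m -> tup m -> R with
  | 0 => fun x y => (x : R) * (y : R)
  | S m => fun x y => (x.1 : R) * (y.1 : R) + @dotp m x.2 y.2
  end.

Fixpoint vsub (m : nat) : tup m -> tup m -> tup m :=
  match m return tup m -> tup m -> tup m with
  | 0 => fun x y => ((x : R) - (y : R) : R)
  | S m => fun x y => (((x.1 : R) - (y.1 : R) : R), @vsub m x.2 y.2)
  end.

Fixpoint vscale (m : nat) (c : R) : tup m -> tup m :=
  match m return tup m -> tup m with
  | 0 => fun x => (c * (x : R) : R)
  | S m => fun x => ((c * (x.1 : R) : R), @vscale m c x.2)
  end.

Definition vnorm (m : nat) (x : tup m) : R := Num.sqrt (dotp x x).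

Fixpoint iint (m : nat) : (tup m -> \bar R) -> \bar R :=
  match m return (tup m -> \bar R) -> \bar R with
  | 0 => fun g => (\int[@lebesgue_measure R]_x g x)%E
  | S m => fun g => (\int[@lebesgue_measure R]_x @iint m (fun v => g (x, v)))%E
  end.

Definition cabs (z : R[i]) : R := Num.sqrt (complex.Re z ^+ 2 + complex.Im z ^+ 2).

Definition creal (x : R) : R[i] := x +i* 0.

Definition cexp (z : R[i]) : R[i] :=
  (expR (complex.Re z) * cos (complex.Im z)) +i* (expR (complex.Re z) * sin (complex.Im z)).

(* principal argument, in (-pi, pi] *)
Definition carg (w : R[i]) : R :=
  let x := complex.Re w in let y := complex.Im w in
  if 0 < x then atan (y / x)
  else if x < 0 then (if 0 <= y then atan (y / x) + pi else atan (y / x) - pi)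
  else if 0 < y then pi / 2 else if y < 0 then - (pi / 2) else 0.

Definition clog (w : R[i]) : R[i] := ln (cabs w) +i* carg w.

Definition cpow (w c : R[i]) : R[i] := cexp (c * clog w).

Definition cint1 (D : set R) (g : R -> R[i]) : R[i] :=
  Rintegral (@lebesgue_measure R) D (fun t => complex.Re (g t))
  +i* Rintegral (@lebesgue_measure R) D (fun t => complex.Im (g t)).

Definition cint (m : nat) (g : tup m -> R[i]) : R[i] :=
  fine (iint (fun x => (complex.Re (g x))%:E))
  +i* fine (iint (fun x => (complex.Im (g x))%:E)).

Definition cGamma (z : R[i]) : R[i] :=
  cint1 [set t | 0 < t] (fun t => cpow (creal t) (z - 1) * creal (expR (- t))).

Definition rGamma (x : R) : R :=
  Rintegral (@lebesgue_measure R) [set t | 0 < t] (fun t => powR t (x - 1) * expR (- t)).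

Definition rcosh (t : R) : R := (expR t + expR (- t)) / 2.
Definition ccosh (w : R[i]) : R[i] := (cexp w + cexp (- w)) / 2.
Definition BesselK (nu : R[i]) (x : R) : R[i] :=
  cint1 [set t | 0 < t] (fun t => creal (expR (- (x * rcosh t))) * ccosh (nu * creal t)).

Definition BesselI (beta x : R) : R :=
  limn (series (fun k : nat =>
    powR (x / 2) (2 * k%:R + beta) / ((k`!)%:R * rGamma (k%:R + beta + 1)))).

Definition cmeasurable (n : nat) (f : Rn n -> R[i]) : Prop :=
  measurable_fun setT (fun x => complex.Re (f x)) /\
  measurable_fun setT (fun x => complex.Im (f x)).

Definition L2 (n : nat) (f : Rn n -> R[i]) : Prop :=
  cmeasurable f /\ (iint (fun x => ((cabs (f x)) ^+ 2)%:E) < +oo)%E.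

Definition fourier_trunc (n : nat) (k : R) (f : Rn n -> R[i]) (xi : Rn n) : R[i] :=
  creal (powR (2 * pi) (- (n%:R / 2))) *
  cint (fun x => if vnorm x < k then f x * cexp (0 +i* (- dotp x xi)) else 0).

Definition is_fourierL2 (n : nat) (f g : Rn n -> R[i]) : Prop :=
  cmeasurable g /\
  (fun k : nat => iint (fun xi => ((cabs (g xi - fourier_trunc k%:R f xi)) ^+ 2)%:E))
    @ \oo --> 0%E.

(* (z - u)^2 = sum_j (z_j - u_j)^2  for z = x + i y *)
Definition csq (n : nat) (x y u : Rn n) : R[i] :=
  (dotp (vsub x u) (vsub x u) - dotp y y) +i* (2 * dotp (vsub x u) y).

Definition poissonC (n : nat) (lam : R[i]) (a : R) (x y u : Rn n) : R[i] :=
  creal (powR pi (- (n%:R / 2))) * (cGamma (lam + creal (n%:R / 2)) / cGamma (2 * lam))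
  * cpow (creal a) (lam + creal (n%:R / 2))
  * cpow (creal (a ^+ 2) + csq x y u) (- (lam + creal (n%:R / 2))).

Definition phiC (n : nat) (lam : R[i]) (f : Rn n -> R[i]) (a : R) (x y : Rn n) : R[i] :=
  cint (fun u => f u * poissonC lam a x y u).

Definition bw (n : nat) (alpha a : R) (y : Rn n) : R :=
  powR (2 * pi) (- (n%:R / 2)) / rGamma alpha
  * powR (1 - dotp y y / a ^+ 2) (alpha - 1).

Definition wla (n : nat) (alpha : R) (lam : R[i]) (xi : Rn n) : R :=
  let r := vnorm xi in
  let beta := alpha + n%:R / 2 - 1 in
  powR r (2 * complex.Re lam) * (cabs (BesselK lam r)) ^+ 2
  * (BesselI beta (2 * r) / powR (2 * r) beta).

(* \int_{T_a} |phi_a(z)|^2 bold w(z) dz,  T_a = {x + i y : |y| < a} *)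
Definition lhs_int (n : nat) (alpha : R) (lam : R[i]) (f : Rn n -> R[i]) (a : R) : \bar R :=
  iint (fun y : Rn n => iint (fun x : Rn n =>
    (if vnorm y < a then (cabs (phiC lam f a x y)) ^+ 2 * bw alpha a y else 0)%:E)).

End Hyperbolic.

(* Main.v *)
From HB Require Import structures.
Require Import Defs.
From mathcomp Require Import all_boot all_order all_algebra complex.
From mathcomp Require Import all_classical all_reals all_analysis.
From mathcomp Require Import measurable_realfun ring lra.
Import Order.TTheory GRing.Theory Num.Theory numFieldNormedType.Exports.
Set Implicit Arguments.
Unset Strict Implicit.
Unset Printing Implicit Defensive.
Local Open Scope ring_scope.
Local Open Scope complex_scope.
Local Open Scope classical_set_scope.

(** Up to an explicit constant, [x -> P_lam f(x, a)] continued to [x + i y] is a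
    convolution of [f] with [(a^2 + (v + i y)^2)^(-(lam + n/2))].  Writing this power
    as a Laplace integral over [t = e^u] and computing the Gaussian integrals inside
    exhibits it as the Fourier transform of [e^(-y.xi) Q(|xi|)], where [Q] is a power
    of [|xi|] times [K_lam(a |xi|)].  Plancherel on the slice of fixed [y] gives
    [int |phi_a(x + i y)|^2 dx = C int |f^|^2 e^(-2 y.xi) Q^2 dxi]; the isometry is
    proved directly, by Gaussian regularization for integrable functions and by
    truncation for square-integrable ones.  Integrating against the weight in [y]
    and exchanging the integrals leaves [int_(|v|<1) e^(-2 v.xi) (1-|v|^2)^(alpha-1) dv],
    an even power series in [xi].  Its coefficients follow by comparing power series
    in the identity obtained from multiplying by [e^(-rho) rho^beta] and integrating
    over all radii [sqrt rho], where the ball integral becomes a full Gaussian one. *)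

(** * Complex-valued functions and integrals *)

(** The definitions are iterated integrals over nested products, so the work is carried to the
    product measures [mu] and back. Plancherel asks for continuity along lines only: the Gaussian
    regularization evaluates a function at eta + r v with r tending to 0, and no topology on the
    nested products enters. The transform g of f is known only as a mean-square limit. Along
    truncations of f the convolutions converge pointwise and the spectral sides in mean; Fatou's
    lemma joins the two, so completeness of L^2 is not invoked. Contour arguments are replaced by
    real differentiation: complex Gaussians and complex powers come from computing the derivative of
    one function in two ways, or from showing that it vanishes. Positivity of the constant is a real
    obstacle. It contains 1/|Gamma(2 lam)|, which would be 0 if Gamma vanished there, so complex
    Gamma must be shown to have no zero in the right half-plane. Polar coordinates are avoided in
    the ball integral: integration over all radii produces a Gaussian, for which the coordinates
    separate. *)

Section product_measure.
Context d1 d2 (T1 : measurableType d1) (T2 : measurableType d2) (R : realType)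
  (m1 : {sigma_finite_measure set T1 -> \bar R})
  (m2 : {sigma_finite_measure set T2 -> \bar R}).

(* The library's sigma-finite instance on [m1 \x m2] is masked by a later
   instance for probabilities, so it is declared again on a copy. *)
Definition prod_mu := (m1 \x m2)%E.
HB.instance Definition _ := Measure.on prod_mu.

Lemma prod_mu_sigma_finite : sigma_finite setT prod_mu.
Proof.
have /sigma_finiteP[F [TF ndF Foo]] := sigma_finiteT m1.
have /sigma_finiteP[G [TG ndG Goo]] := sigma_finiteT m2.
exists (fun n => F n `*` G n).
  rewrite -setXTT TF TG predeqE => -[x y]; split.
    move=> [/= [n _ Fnx] [k _ Gky]]; exists (maxn n k) => //; split.
    - by move: x Fnx; exact/subsetPset/ndF/leq_maxl.
    - by move: y Gky; exact/subsetPset/ndG/leq_maxr.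
  by move=> [n _ []/= ? ?]; split; exists n.
move=> k; have [? ?] := Foo k; have [? ?] := Goo k.
split; first exact: measurableX.
by rewrite /prod_mu product_measure1E// lte_mul_pinfty// ge0_fin_numE.
Qed.

HB.instance Definition _ := Measure_isSigmaFinite.Build _ _ _ prod_mu
  prod_mu_sigma_finite.

Definition prodm : {sigma_finite_measure set (T1 * T2)%type -> \bar R} :=
  prod_mu.

End product_measure.

Local Notation Re := (@complex.Re _).
Local Notation Im := (@complex.Im _).

Section complex_basics.
Variable R : realType.
Implicit Types (z w : R[i]) (x y : R).

Lemma complex_ext z w : Re z = Re w -> Im z = Im w -> z = w.
Proof. by case: z => a b; case: w => c d /= -> ->. Qed.

Lemma cReD z w : Re (z + w) = Re z + Re w. Proof. by case: z; case: w. Qed.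
Lemma cImD z w : Im (z + w) = Im z + Im w. Proof. by case: z; case: w. Qed.
Lemma cReN z : Re (- z) = - Re z. Proof. by case: z. Qed.
Lemma cImN z : Im (- z) = - Im z. Proof. by case: z. Qed.
Lemma cReB z w : Re (z - w) = Re z - Re w. Proof. by rewrite cReD cReN. Qed.
Lemma cImB z w : Im (z - w) = Im z - Im w. Proof. by rewrite cImD cImN. Qed.
Lemma cReM z w : Re (z * w) = Re z * Re w - Im z * Im w.
Proof. by case: z; case: w. Qed.
Lemma cImM z w : Im (z * w) = Re z * Im w + Im z * Re w.
Proof. by case: z; case: w. Qed.
Lemma cReJ z : Re (conjc z) = Re z. Proof. by case: z. Qed.
Lemma cImJ z : Im (conjc z) = - Im z. Proof. by case: z. Qed.
Lemma cRe_creal x : Re (creal x) = x. Proof. by []. Qed.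
Lemma cIm_creal x : Im (creal x) = 0. Proof. by []. Qed.
Lemma cRe0 : Re (0 : R[i]) = 0. Proof. by []. Qed.
Lemma cIm0 : Im (0 : R[i]) = 0. Proof. by []. Qed.
Lemma cRe1 : Re (1 : R[i]) = 1. Proof. by []. Qed.
Lemma cIm1 : Im (1 : R[i]) = 0. Proof. by []. Qed.
Lemma cRe_nat (n : nat) : Re (n%:R : R[i]) = n%:R.
Proof. by elim: n => // n IH; rewrite -natr1 cReD IH /= natr1. Qed.
Lemma cIm_nat (n : nat) : Im (n%:R : R[i]) = 0.
Proof. by elim: n => // n IH; rewrite -natr1 cImD IH /= addr0. Qed.

Lemma cRe_cexp z : Re (cexp z) = expR (Re z) * cos (Im z). Proof. by []. Qed.
Lemma cIm_cexp z : Im (cexp z) = expR (Re z) * sin (Im z). Proof. by []. Qed.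
Lemma cexp0 : cexp (0 : R[i]) = 1.
Proof. by rewrite /cexp /= expR0 cos0 sin0 mulr1 mulr0. Qed.
Lemma cexp_creal x : cexp (creal x) = creal (expR x).
Proof. by rewrite /cexp /= cos0 sin0 mulr1 mulr0. Qed.
Lemma cabs_cexp z : cabs (cexp z) = expR (Re z).
Proof.
rewrite /cabs /= !exprMn -mulrDr cos2Dsin2 mulr1 sqrtr_sqr.
by rewrite ger0_norm// expR_ge0.
Qed.
Lemma cabsE z : cabs z = ComplexField.Normc.normc z. Proof. by case: z. Qed.
Lemma cabs0 : cabs (0 : R[i]) = 0.
Proof. by rewrite /cabs /= expr0n /= addr0 sqrtr0. Qed.
Lemma cabs_creal x : cabs (creal x) = `|x|.
Proof. by rewrite /cabs /= expr0n /= addr0 sqrtr_sqr. Qed.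
Lemma creal1 : creal 1 = 1 :> R[i]. Proof. by []. Qed.
Lemma creal0 : creal 0 = 0 :> R[i]. Proof. by []. Qed.
Lemma creal_eq0 x : (creal x == 0) = (x == 0).
Proof. by rewrite eq_complex /= eqxx andbT. Qed.
Lemma crealE x : creal x = x +i* 0. Proof. by []. Qed.
Opaque creal cexp conjc.

(** Rewriting with these rules splits a complex identity into two real ones for [ring]. Opacity of
    [creal], [cexp] and [conjc] keeps simplification from unfolding them before a rule applies. *)
Definition cE := (cRe_cexp, cIm_cexp, cReD, cImD, cReN, cImN, cReM, cImM, cReJ, cImJ, cRe_creal,
  cIm_creal, cRe0, cIm0, cRe1, cIm1, cRe_nat, cIm_nat).

Lemma crealD x y : creal (x + y) = creal x + creal y.
Proof. by apply: complex_ext; rewrite !cE ?addr0. Qed.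
Lemma crealN x : creal (- x) = - creal x.
Proof. by apply: complex_ext; rewrite !cE ?oppr0. Qed.
Lemma crealB x y : creal (x - y) = creal x - creal y.
Proof. by rewrite crealD crealN. Qed.
Lemma crealM x y : creal (x * y) = creal x * creal y.
Proof. by apply: complex_ext; rewrite !cE /=; ring. Qed.
Lemma creal_nat (n : nat) : creal n%:R = n%:R :> R[i].
Proof. by apply: complex_ext; rewrite !cE. Qed.
Lemma crealV x : creal x^-1 = (creal x)^-1.
Proof.
have [->|x0] := eqVneq x 0; first by rewrite creal0 !invr0.
have cx0 : creal x != 0 by rewrite creal_eq0.
by apply: (mulfI cx0); rewrite -crealM !mulfV.
Qed.

Lemma cabs_ge0 z : 0 <= cabs z. Proof. exact: sqrtr_ge0. Qed.
Lemma cabs_sqr z : cabs z ^+ 2 = Re z ^+ 2 + Im z ^+ 2.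
Proof. by rewrite sqr_sqrtr// addr_ge0// sqr_ge0. Qed.
Lemma cabsM z w : cabs (z * w) = cabs z * cabs w.
Proof. by rewrite !cabsE ComplexField.Normc.normcM. Qed.
Lemma cabs_eq0 z : (cabs z == 0) = (z == 0).
Proof.
apply/eqP/eqP => [|->]; last exact: cabs0.
by rewrite cabsE => /ComplexField.Normc.eq0_normc.
Qed.
Lemma cabsN z : cabs (- z) = cabs z.
Proof. by rewrite /cabs !cE !sqrrN. Qed.
Lemma cabsJ z : cabs (conjc z) = cabs z.
Proof. by rewrite /cabs !cE sqrrN. Qed.
Lemma cabs1 : cabs (1 : R[i]) = 1. Proof. by rewrite -creal1 cabs_creal normr1. Qed.
Lemma cabsV z : cabs z^-1 = (cabs z)^-1.
Proof.
have [->|z0] := eqVneq z 0; first by rewrite invr0 cabs0 invr0.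
have cz0 : cabs z != 0 by rewrite cabs_eq0.
by apply: (mulfI cz0); rewrite -cabsM !mulfV// cabs1.
Qed.

Lemma le_Re_cabs z : `|Re z| <= cabs z.
Proof.
by rewrite -(@ler_pXn2r _ 2)// ?nnegrE ?cabs_ge0// cabs_sqr real_normK ?num_real// lerDl sqr_ge0.
Qed.
Lemma le_Im_cabs z : `|Im z| <= cabs z.
Proof.
by rewrite -(@ler_pXn2r _ 2)// ?nnegrE ?cabs_ge0// cabs_sqr real_normK ?num_real// lerDr sqr_ge0.
Qed.
Lemma cabs_le z : cabs z <= `|Re z| + `|Im z|.
Proof.
rewrite -(@ler_pXn2r _ 2)// ?nnegrE ?cabs_ge0 ?addr_ge0//.
rewrite cabs_sqr sqrrD !real_normK ?num_real//.
by rewrite addrAC lerDl mulrn_wge0// mulr_ge0.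
Qed.
Lemma cabs_le_add z w : cabs (z + w) <= cabs z + cabs w.
Proof.
rewrite -(@ler_pXn2r _ 2)// ?nnegrE ?cabs_ge0 ?addr_ge0 ?cabs_ge0//.
(* After squaring, what remains is Re z Re w + Im z Im w <= |z w|, and the left side is the real
   part of z times the conjugate of w. *)
rewrite [leRHS]sqrrD !cabs_sqr !cE -cabsM.
rewrite -subr_ge0; set d := (X in 0 <= X).
have -> : d = 2 * (cabs (z * w) - (Re z * Re w + Im z * Im w)).
  by rewrite /d; ring.
rewrite pmulr_rge0// subr_ge0.
have -> : Re z * Re w + Im z * Im w = Re (z * conjc w) by rewrite !cE; ring.
rewrite (le_trans (ler_norm _))// (le_trans (le_Re_cabs _))//.
by rewrite !cabsM cabsJ.
Qed.

Lemma mulc_conj z : z * conjc z = creal (cabs z ^+ 2).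
Proof. by rewrite cabs_sqr; apply: complex_ext; rewrite !cE; ring. Qed.

Lemma cexpD z w : cexp (z + w) = cexp z * cexp w.
Proof.
apply: complex_ext; rewrite !cE expRD ?cosD ?sinD.
  by ring.
by ring.
Qed.
Lemma cexp_neq0 z : cexp z != 0.
Proof. by rewrite -cabs_eq0 cabs_cexp gt_eqF// expR_gt0. Qed.
Lemma cexpN z : cexp (- z) = (cexp z)^-1.
Proof.
by apply: (mulfI (cexp_neq0 z)); rewrite -cexpD subrr cexp0 mulfV// cexp_neq0.
Qed.
Lemma conjcM z w : conjc (z * w) = conjc z * conjc w.
Proof. by apply: complex_ext; rewrite !cE; ring. Qed.
Lemma conjc_cexp z : conjc (cexp z) = cexp (conjc z).
Proof.
by apply: complex_ext; rewrite !cE ?cosN ?sinN ?mulrN.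
Qed.
Lemma cabs_pos (x y : R) : 0 < x -> cabs (x +i* y) ^+ 2 = x ^+ 2 + y ^+ 2 /\ 0 < cabs (x +i* y).
Proof.
move=> x0; split; first by rewrite cabs_sqr.
by rewrite lt_def cabs_ge0 andbT cabs_eq0 eq_complex /= gt_eqF.
Qed.

(** Every base of a complex power in this development lies in the right half-plane, so this is the
    only branch of [carg] that matters. *)
Lemma clogE (x y : R) : 0 < x ->
  clog (x +i* y) = (ln (x ^+ 2 + y ^+ 2) / 2) +i* atan (y / x).
Proof.
move=> x0; rewrite /clog /carg /= x0; congr (_ +i* _).
have [E cp] := cabs_pos y x0.
by rewrite -E lnXn// -[ln _ *+ 2]mulr_natr mulfK.
Qed.

Lemma cpowE w c : cpow w c = cexp (c * clog w). Proof. by []. Qed.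

End complex_basics.

Opaque creal cexp conjc cpow clog.

Section complex_integral.
Context d (T : measurableType d) (R : realType).
Variable mu : {measure set T -> \bar R}.
Implicit Types (f g : T -> R[i]) (r s : T -> R).

Definition cmeas f := measurable_fun setT (fun x => Re (f x)) /\
  measurable_fun setT (fun x => Im (f x)).
Definition cintegrable f := mu.-integrable setT (fun x => (Re (f x))%:E) /\
  mu.-integrable setT (fun x => (Im (f x))%:E).
Definition CI f : R[i] := (\int[mu]_x Re (f x))%R +i* (\int[mu]_x Im (f x))%R.

Lemma cRe_CI f : Re (CI f) = (\int[mu]_x Re (f x))%R. Proof. by []. Qed.
Lemma cIm_CI f : Im (CI f) = (\int[mu]_x Im (f x))%R. Proof. by []. Qed.
Lemma eq_CI f g : f =1 g -> CI f = CI g.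
Proof. by move=> fg; congr CI; apply/funext. Qed.

Lemma eq_measurable_fun_setT r s : r =1 s -> measurable_fun setT s ->
  measurable_fun setT r.
Proof. by move=> /funext ->. Qed.

Lemma cmeas_cst (c : R[i]) : cmeas (fun=> c). Proof. by split. Qed.
Lemma cmeasD f g : cmeas f -> cmeas g -> cmeas (fun x => f x + g x).
Proof.
move=> [f1 f2] [g1 g2]; split.
  apply: eq_measurable_fun_setT (measurable_funD f1 g1) => x.
  exact: cReD.
apply: eq_measurable_fun_setT (measurable_funD f2 g2) => x.
exact: cImD.
Qed.
Lemma cmeasN f : cmeas f -> cmeas (fun x => - f x).
Proof.
move=> [f1 f2]; split.
  by apply: eq_measurable_fun_setT (measurable_funN f1) => x; exact: cReN.
by apply: eq_measurable_fun_setT (measurable_funN f2) => x; exact: cImN.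
Qed.
Lemma cmeasB f g : cmeas f -> cmeas g -> cmeas (fun x => f x - g x).
Proof. by move=> mf mg; apply: cmeasD => //; exact: cmeasN. Qed.
Lemma cmeasM f g : cmeas f -> cmeas g -> cmeas (fun x => f x * g x).
Proof.
move=> [f1 f2] [g1 g2]; split.
  apply: eq_measurable_fun_setT
    (measurable_funB (measurable_funM f1 g1) (measurable_funM f2 g2)) => x.
  exact: cReM.
apply: eq_measurable_fun_setT
  (measurable_funD (measurable_funM f1 g2) (measurable_funM f2 g1)) => x.
exact: cImM.
Qed.
Lemma cmeasJ f : cmeas f -> cmeas (fun x => conjc (f x)).
Proof.
move=> [f1 f2]; split.
  by apply: eq_measurable_fun_setT f1 => x; exact: cReJ.
by apply: eq_measurable_fun_setT (measurable_funN f2) => x; exact: cImJ.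
Qed.
Lemma cmeas_creal r : measurable_fun setT r -> cmeas (fun x => creal (r x)).
Proof.
by move=> mr; split; [exact: eq_measurable_fun_setT mr|exact: measurable_cst].
Qed.
Lemma measurable_cos_comp r : measurable_fun setT r ->
  measurable_fun setT (fun x => cos (r x)).
Proof.
apply: (measurableT_comp (f := @cos R)).
exact: continuous_measurable_fun (@continuous_cos R).
Qed.
Lemma measurable_sin_comp r : measurable_fun setT r ->
  measurable_fun setT (fun x => sin (r x)).
Proof.
apply: (measurableT_comp (f := @sin R)).
exact: continuous_measurable_fun (@continuous_sin R).
Qed.
Lemma measurable_expR_comp r : measurable_fun setT r ->
  measurable_fun setT (fun x => expR (r x)).
Proof. by apply: (measurableT_comp (f := @expR R)); exact: measurable_expR. Qed.
Lemma cmeas_cexp f : cmeas f -> cmeas (fun x => cexp (f x)).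
Proof.
move=> [f1 f2]; split.
  apply: eq_measurable_fun_setT
    (measurable_funM (measurable_expR_comp f1) (measurable_cos_comp f2)) => x.
  exact: cRe_cexp.
apply: eq_measurable_fun_setT
  (measurable_funM (measurable_expR_comp f1) (measurable_sin_comp f2)) => x.
exact: cIm_cexp.
Qed.
Lemma cmeas_if (b : T -> bool) f g : measurable_fun setT b ->
  cmeas f -> cmeas g -> cmeas (fun x => if b x then f x else g x).
Proof.
move=> mb [f1 f2] [g1 g2]; split.
  rewrite (_ : (fun _ => _) = (fun x => if b x then Re (f x) else Re (g x))).
    exact: measurable_fun_ifT.
  by apply/funext => x; case: ifP.
rewrite (_ : (fun _ => _) = (fun x => if b x then Im (f x) else Im (g x))).
  exact: measurable_fun_ifT.
by apply/funext => x; case: ifP.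
Qed.
Lemma cmeas_pair (a b : T -> R) : measurable_fun setT a -> measurable_fun setT b ->
  cmeas (fun x => a x +i* b x).
Proof. by []. Qed.

Lemma measurable_cabs f : cmeas f -> measurable_fun setT (fun x => cabs (f x)).
Proof.
move=> [f1 f2]; apply: (measurableT_comp (f := @Num.sqrt R)).
  exact: continuous_measurable_fun (@sqrt_continuous R).
by apply: measurable_funD; exact: measurable_funX.
Qed.

Lemma ge0_integrable r : measurable_fun setT r -> (forall x, 0 <= r x) ->
  (\int[mu]_x (r x)%:E < +oo)%E -> mu.-integrable setT (fun x => (r x)%:E).
Proof.
move=> mr r0 roo; apply/integrableP; split; first exact/measurable_EFinP.
by under eq_integral do rewrite gee0_abs ?lee_fin//.
Qed.

Lemma integrable_le (r s : T -> R) : measurable_fun setT r ->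
  (forall x, `|r x| <= s x) -> mu.-integrable setT (fun x => (s x)%:E) ->
  mu.-integrable setT (fun x => (r x)%:E).
Proof.
move=> mr rs; apply: le_integrable => //; first exact/measurable_EFinP.
by move=> x _; rewrite lee_fin (le_trans (rs x))// ler_norm.
Qed.

Lemma rintegrableD r s : mu.-integrable setT (fun x => (r x)%:E) ->
  mu.-integrable setT (fun x => (s x)%:E) ->
  mu.-integrable setT (fun x => (r x + s x)%:E).
Proof. by move=> ri si; exact: (integrableD measurableT ri si). Qed.
Lemma rintegrableB r s : mu.-integrable setT (fun x => (r x)%:E) ->
  mu.-integrable setT (fun x => (s x)%:E) ->
  mu.-integrable setT (fun x => (r x - s x)%:E).
Proof. by move=> ri si; exact: (integrableB measurableT ri si). Qed.
Lemma rintegrableZ c r : mu.-integrable setT (fun x => (r x)%:E) ->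
  mu.-integrable setT (fun x => (c * r x)%:E).
Proof. by move=> ri; exact: (integrableZl measurableT c ri). Qed.
Lemma eq_rintegrable r s : r =1 s -> mu.-integrable setT (fun x => (s x)%:E) ->
  mu.-integrable setT (fun x => (r x)%:E).
Proof. by move=> /funext ->. Qed.

Lemma cintegrable_meas f : cintegrable f -> cmeas f.
Proof. by move=> [/measurable_int/measurable_EFinP ? /measurable_int/measurable_EFinP ?]. Qed.

Lemma cintegrable_le f (s : T -> R) : cmeas f -> (forall x, cabs (f x) <= s x) ->
  mu.-integrable setT (fun x => (s x)%:E) -> cintegrable f.
Proof.
move=> [f1 f2] fs si; split; apply: (integrable_le (s := s)) => // x.
  exact: le_trans (le_Re_cabs _) _.
exact: le_trans (le_Im_cabs _) _.
Qed.

Lemma cintegrable_cabs f : cintegrable f ->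
  mu.-integrable setT (fun x => (cabs (f x))%:E).
Proof.
move=> fi; have mf := cintegrable_meas fi; case: fi => f1 f2.
apply: (integrable_le (s := fun x => `|Re (f x)| + `|Im (f x)|)).
- exact: measurable_cabs.
- by move=> x; rewrite ger0_norm ?cabs_ge0//; exact: cabs_le.
- by apply: rintegrableD; exact: integrable_norm.
Qed.

Lemma cintegrableP f : cmeas f ->
  (\int[mu]_x (cabs (f x))%:E < +oo)%E -> cintegrable f.
Proof.
move=> mf foo; apply: (cintegrable_le (s := fun x => cabs (f x))) => //.
by apply: ge0_integrable => //; [exact: measurable_cabs|move=> x; exact: cabs_ge0].
Qed.

Lemma cintegrableD f g : cintegrable f -> cintegrable g ->
  cintegrable (fun x => f x + g x).
Proof.
move=> [f1 f2] [g1 g2]; split.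
  by apply: eq_rintegrable (rintegrableD f1 g1) => x; exact: cReD.
by apply: eq_rintegrable (rintegrableD f2 g2) => x; exact: cImD.
Qed.
Lemma cintegrableZ c f : cintegrable f -> cintegrable (fun x => c * f x).
Proof.
move=> fi; apply: (cintegrable_le (s := fun x => cabs c * cabs (f x))).
- by apply: cmeasM; [exact: cmeas_cst|exact: cintegrable_meas].
- by move=> x; rewrite cabsM.
- by apply: rintegrableZ => //; exact: cintegrable_cabs.
Qed.
Lemma cintegrableB f g : cintegrable f -> cintegrable g ->
  cintegrable (fun x => f x - g x).
Proof.
move=> fi gi; apply: cintegrableD => //.
rewrite (_ : (fun x => - g x) = (fun x => -1 * g x)); first exact: cintegrableZ.
by apply/funext => x; rewrite mulN1r.
Qed.

Lemma CID f g : cintegrable f -> cintegrable g ->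
  CI (fun x => f x + g x) = CI f + CI g.
Proof.
move=> [f1 f2] [g1 g2]; apply: complex_ext;
  rewrite !(cRe_CI, cIm_CI, cE) -RintegralD//; apply: eq_Rintegral => x _;
  by rewrite !cE.
Qed.
Lemma CIZ c f : cintegrable f -> CI (fun x => c * f x) = c * CI f.
Proof.
move=> [f1 f2]; apply: complex_ext; rewrite !(cRe_CI, cIm_CI, cE).
  rewrite -!RintegralZl// -RintegralB//; [|exact: rintegrableZ|exact: rintegrableZ].
  by apply: eq_Rintegral => x _; rewrite !cE.
rewrite -!RintegralZl// -RintegralD//; [|exact: rintegrableZ|exact: rintegrableZ].
by apply: eq_Rintegral => x _; rewrite !cE.
Qed.
Lemma CIB f g : cintegrable f -> cintegrable g ->
  CI (fun x => f x - g x) = CI f - CI g.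
Proof.
move=> fi gi; rewrite (@eq_CI _ (fun x => f x + -1 * g x)).
  by rewrite CID//; [rewrite CIZ// mulN1r|exact: cintegrableZ].
by move=> x; rewrite mulN1r.
Qed.
Lemma CIJ f : cintegrable f -> CI (fun x => conjc (f x)) = conjc (CI f).
Proof.
move=> [f1 f2]; apply: complex_ext; rewrite !(cRe_CI, cIm_CI, cE).
  by apply: eq_Rintegral => x _; rewrite !cE.
rewrite -mulN1r -RintegralZl//; apply: eq_Rintegral => x _.
by rewrite !cE mulN1r.
Qed.
Lemma CI_creal r : CI (fun x => creal (r x)) = creal (\int[mu]_x r x)%R.
Proof.
apply: complex_ext; rewrite !(cRe_CI, cIm_CI, cE).
  by apply: eq_Rintegral => x _; rewrite !cE.
by rewrite /Rintegral integral0_eq// => x _; rewrite !cE.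
Qed.

(** Multiplying by the conjugate of the integral makes the integral real and nonnegative, so the
    inequality reduces to the real one for the real part. *)
Lemma cabs_CI_le f : cintegrable f -> cabs (CI f) <= (\int[mu]_x cabs (f x))%R.
Proof.
move=> fi; have absi := cintegrable_cabs fi.
have [->|c0] := eqVneq (cabs (CI f)) 0.
  by apply: Rintegral_ge0 => x _; exact: cabs_ge0.
have cp : 0 < cabs (CI f) by rewrite lt_def c0 cabs_ge0.
rewrite -(ler_pM2l cp) -expr2 cabs_sqr.
have -> : Re (CI f) ^+ 2 + Im (CI f) ^+ 2 = Re (conjc (CI f) * CI f).
  by rewrite !cE; ring.
rewrite -CIZ// cRe_CI -RintegralZl//; have [h _] := cintegrableZ (conjc (CI f)) fi.
apply: le_Rintegral => //.
  exact: rintegrableZ.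
move=> x _; rewrite (le_trans (ler_norm _))// (le_trans (le_Re_cabs _))//.
by rewrite cabsM cabsJ.
Qed.

Lemma Rintegral_dominated (F : nat -> T -> R) r s :
  (forall k, measurable_fun setT (F k)) -> measurable_fun setT r ->
  (forall x, (fun k => F k x) @ \oo --> r x) ->
  mu.-integrable setT (fun x => (s x)%:E) ->
  (forall k x, `|F k x| <= s x) ->
  (fun k => \int[mu]_x F k x)%R @ \oo --> (\int[mu]_x r x)%R.
Proof.
move=> mF mr Fr si Fs.
have [|||||ri _ Fi] := @dominated_convergence _ T R mu setT measurableT
  (fun k x => (F k x)%:E) (fun x => (r x)%:E) (fun x => (s x)%:E).
- by move=> k; exact/measurable_EFinP.
- exact/measurable_EFinP.
- by apply: aeW => x _; apply: cvg_EFin; [exact: nearW|exact: Fr].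
- exact: si.
- by apply: aeW => x k _; rewrite lee_fin; exact: Fs.
by apply: fine_cvg; rewrite fineK//; exact: integrable_fin_num.
Qed.

Lemma CI_dominated (F : nat -> T -> R[i]) f (s : T -> R) :
  (forall k, cmeas (F k)) -> cmeas f ->
  (forall x, (fun k => Re (F k x)) @ \oo --> Re (f x)) ->
  (forall x, (fun k => Im (F k x)) @ \oo --> Im (f x)) ->
  mu.-integrable setT (fun x => (s x)%:E) ->
  (forall k x, cabs (F k x) <= s x) ->
  (fun k => Re (CI (F k))) @ \oo --> Re (CI f) /\
  (fun k => Im (CI (F k))) @ \oo --> Im (CI f).
Proof.
move=> mF mf cRe cIm si Fs; split.
  apply: (Rintegral_dominated (fun k => (mF k).1) mf.1 cRe si) => k x.
  exact: le_trans (le_Re_cabs _) (Fs k x).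
apply: (Rintegral_dominated (fun k => (mF k).2) mf.2 cIm si) => k x.
exact: le_trans (le_Im_cabs _) (Fs k x).
Qed.

End complex_integral.

Lemma cmeas_comp d1 d2 (T1 : measurableType d1) (T2 : measurableType d2)
  (R : realType) (f : T2 -> R[i]) (h : T1 -> T2) :
  cmeas f -> measurable_fun setT h -> cmeas (fun x => f (h x)).
Proof.
move=> [f1 f2] mh; split.
  exact: (measurableT_comp f1 mh).
exact: (measurableT_comp f2 mh).
Qed.

Section complex_fubini.
Context d1 d2 (T1 : measurableType d1) (T2 : measurableType d2) (R : realType)
  (m1 : {sigma_finite_measure set T1 -> \bar R})
  (m2 : {sigma_finite_measure set T2 -> \bar R}).
Local Open Scope ereal_scope.

Lemma integral_prodm1 (f : T1 * T2 -> \bar R) : measurable_fun setT f ->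
  (forall x, 0 <= f x) ->
  \int[prodm m1 m2]_z f z = \int[m1]_x \int[m2]_y f (x, y).
Proof. exact: fubini_tonelli1. Qed.

Lemma integral_prodm2 (f : T1 * T2 -> \bar R) : measurable_fun setT f ->
  (forall x, 0 <= f x) ->
  \int[prodm m1 m2]_z f z = \int[m2]_y \int[m1]_x f (x, y).
Proof. exact: fubini_tonelli2. Qed.

(** The inner real integral is [fine] of an extended one, and the two can be identified only where
    the slice is integrable, that is, almost everywhere. *)
Lemma Rintegral_prodm1 (f : T1 * T2 -> R) :
  (prodm m1 m2).-integrable setT (fun x => (f x)%:E) ->
  (\int[prodm m1 m2]_z f z = \int[m1]_x \int[m2]_y f (x, y))%R.
Proof.
move=> fi; rewrite /Rintegral; congr fine.
rewrite -(integral12_prod_meas1 fi).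
have mF := measurable_fubini_F fi.
apply: ae_eq_integral => //.
  by apply/measurable_EFinP; apply: measurableT_comp => //.
apply: filterS (ae_integrable1 fi) => x ix _; rewrite /fubini_F fineK//.
exact: integrable_fin_num.
Qed.

Lemma Rintegral_prodm2 (f : T1 * T2 -> R) :
  (prodm m1 m2).-integrable setT (fun x => (f x)%:E) ->
  (\int[prodm m1 m2]_z f z = \int[m2]_y \int[m1]_x f (x, y))%R.
Proof.
move=> fi; rewrite /Rintegral; congr fine.
rewrite -(integral21_prod_meas1 fi).
have mF := measurable_fubini_G fi.
apply: ae_eq_integral => //.
  by apply/measurable_EFinP; apply: measurableT_comp => //.
apply: filterS (ae_integrable2 fi) => x ix _; rewrite /fubini_G fineK//.
exact: integrable_fin_num.
Qed.

Lemma CI_prodm1 (f : T1 * T2 -> R[i]) : cintegrable (prodm m1 m2) f ->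
  CI (prodm m1 m2) f = CI m1 (fun x => CI m2 (fun y => f (x, y))).
Proof.
move=> [f1 f2]; apply: complex_ext; rewrite !(cRe_CI, cIm_CI).
  by rewrite Rintegral_prodm1.
by rewrite Rintegral_prodm1.
Qed.

Lemma CI_prodm2 (f : T1 * T2 -> R[i]) : cintegrable (prodm m1 m2) f ->
  CI (prodm m1 m2) f = CI m2 (fun y => CI m1 (fun x => f (x, y))).
Proof.
move=> [f1 f2]; apply: complex_ext; rewrite !(cRe_CI, cIm_CI).
  by rewrite Rintegral_prodm2.
by rewrite Rintegral_prodm2.
Qed.

Lemma cintegrable_prodm1 (f : T1 * T2 -> R[i]) : cmeas f ->
  \int[m1]_x \int[m2]_y (cabs (f (x, y)))%:E < +oo ->
  cintegrable (prodm m1 m2) f.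
Proof.
move=> mf foo; apply: cintegrableP => //; rewrite integral_prodm1//.
  by apply/measurable_EFinP; exact: measurable_cabs.
by move=> x; rewrite lee_fin cabs_ge0.
Qed.

Lemma CI_fubini (f : T1 -> T2 -> R[i]) :
  cintegrable (prodm m1 m2) (fun z => f z.1 z.2) ->
  CI m1 (fun x => CI m2 (f x)) = CI m2 (fun y => CI m1 (f ^~ y)).
Proof. by move=> fi; rewrite -(CI_prodm1 fi) (CI_prodm2 fi). Qed.

(* Measurability in a parameter needs no integrability: the real integral of a
   measurable function is the difference of two Tonelli integrals. *)
Lemma cmeas_CI1 (f : T1 -> T2 -> R[i]) : cmeas (fun z => f z.1 z.2) ->
  cmeas (fun x => CI m2 (f x)).
Proof.
have key (g : T1 * T2 -> R) : measurable_fun setT g ->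
    measurable_fun setT (fun x => \int[m2]_y g (x, y))%R.
  move=> mg; apply: measurableT_comp => //.
  pose ge z := (g z)%:E.
  have mge : measurable_fun setT ge by exact/measurable_EFinP.
  rewrite (_ : (fun x => _) = (fun x => \int[m2]_y ge^\+ (x, y)) \-
      (fun x => \int[m2]_y ge^\- (x, y))); last first.
    apply/funext => x; rewrite [LHS]integralE.
    by congr (_ + _); [|congr (- _)]; apply: eq_integral => y _; rewrite !(funeposE, funenegE).
  apply: emeasurable_funB.
    apply: (measurable_fun_fubini_tonelli_F ge^\+) => //.
    exact: measurable_funepos.
  apply: (measurable_fun_fubini_tonelli_F ge^\-) => //.
  exact: measurable_funeneg.
by move=> [f1 f2]; split; [exact: (key (fun z => Re (f z.1 z.2)))|
  exact: (key (fun z => Im (f z.1 z.2)))].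
Qed.

End complex_fubini.

(** * Integration on Euclidean space *)

Section affine_line.
Variable R : realType.
Local Open Scope ereal_scope.

Definition leb : {sigma_finite_measure set (measurableTypeR R) -> \bar R} :=
  @lebesgue_measure R.

Lemma measurable_affine (b r : R) :
  measurable_fun setT ((fun x => b + r * x)%R : measurableTypeR R -> measurableTypeR R).
Proof. by apply: measurable_funD => //; exact: measurable_funM. Qed.

(** Lebesgue measure is determined by its values on half-open intervals, so it suffices to compare
    lengths there. *)
Lemma pushforward_affine (b r : R) (r0 : (0 < r)%R) (A : set (measurableTypeR R)) :
  measurable A ->
  leb A = r%:E * pushforward leb
    ((fun x => b + r * x)%R : measurableTypeR R -> measurableTypeR R) A.
Proof.
pose phi := (fun x => b + r * x)%R : measurableTypeR R -> measurableTypeR R.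
pose nr := NngNum (ltW r0).
have [m' m'E] : exists m' : {measure set (measurableTypeR R) -> \bar R},
    forall A, m' A = r%:E * pushforward leb phi A.
  by unshelve eexists (mscale nr (pushforward leb phi));
    [exact: measurable_affine|].
move=> mA; rewrite -m'E.
apply: (@lebesgue_measure_unique R m') => // _ [[a c]] _ <-.
rewrite m'E /pushforward/=.
have -> : (fun x => b + r * x)%R @^-1` `]a, c] =
    `]((a - b) / r)%R, ((c - b) / r)%R]%classic.
  apply/seteqP; split => x /=; rewrite !in_itv/= ltr_pdivrMr// ler_pdivlMr//
    ltrBlDl lerBrDl mulrC//.
rewrite !lebesgue_measure_itv/= !lte_fin ltr_pM2r ?invr_gt0// ltrD2r.
case: ifPn => _; last by rewrite mule0.
rewrite -!EFinB -EFinM; congr EFin.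
by field; rewrite gt_eqF.
Qed.

Lemma ge0_integral_affine_pos (b r : R) (g : R -> \bar R) : (0 < r)%R ->
  measurable_fun setT g -> (forall x, 0 <= g x) ->
  \int[leb]_x g x = r%:E * \int[leb]_x g (b + r * x)%R.
Proof.
move=> r0 mg g0.
pose phi := (fun x => b + r * x)%R : measurableTypeR R -> measurableTypeR R.
pose nr := NngNum (ltW r0).
have mphi : measurable_fun setT phi by exact: measurable_affine.
have := @ge0_integral_mscale _ _ R (pushforward leb phi) setT measurableT nr g.
move=> /(_ mphi mg (fun x _ => g0 x)).
rewrite ge0_integral_pushforward// preimage_setT => <-.
by apply: eq_measure_integral => A mA _; exact: pushforward_affine.
Qed.

Lemma ge0_integral_opp (g : R -> \bar R) :
  measurable_fun setT g -> (forall x, 0 <= g x) ->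
  \int[leb]_x g x = \int[leb]_x g (- x)%R.
Proof.
move=> mg g0.
have := @ge0_integral_pushforward _ _ _ _ R
  (-%R : measurableTypeR R -> measurableTypeR R) _ leb setT g.
rewrite preimage_setT => <- //.
by apply: eq_measure_integral => A mA _; exact/esym/lebesgue_measureN.
Qed.

Lemma ge0_integral_affine (b r : R) (g : R -> \bar R) : r != 0%R ->
  measurable_fun setT g -> (forall x, 0 <= g x) ->
  \int[leb]_x g x = `|r|%:E * \int[leb]_x g (b + r * x)%R.
Proof.
move=> r0 mg g0; have [rp|rn] : (0 < r)%R \/ (r < 0)%R.
  by move: r0; rewrite neq_lt => /orP[]; [right|left].
  by rewrite (ge0_integral_affine_pos b rp)// gtr0_norm.
rewrite ltr0_norm// (@ge0_integral_affine_pos b (- r)%R g) ?oppr_gt0//.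
congr (_ * _); rewrite ge0_integral_opp//.
  by apply: eq_integral => x _; rewrite mulrNN.
exact: (measurableT_comp mg (measurable_affine b (- r))).
Qed.
End affine_line.

Section euclidean.
Variable R : realType.

(** Built along the same recursion as [tup] and [iint], so that one application of Tonelli or Fubini
    per coordinate identifies the integral against it with [iint]. *)
Fixpoint mu (m : nat) : {sigma_finite_measure set (tup R m) -> \bar R} :=
  match m return {sigma_finite_measure set (tup R m) -> \bar R} with
  | 0 => leb R
  | S m => prodm (leb R) (mu m)
  end.

(** One operation covers differences (r = -1), dilations (b = 0) and displacements along a line, so
    that a single change of variables serves throughout. *)
Fixpoint vaff (m : nat) : tup R m -> R -> tup R m -> tup R m :=
  match m return tup R m -> R -> tup R m -> tup R m with
  | 0 => fun b r v => ((b : R) + r * (v : R) : R)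
  | S m => fun b r v => (((b.1 : R) + r * (v.1 : R) : R), @vaff m b.2 r v.2)
  end.

Fixpoint v0 (m : nat) : tup R m :=
  match m return tup R m with 0 => (0 : R) | S m => ((0 : R), v0 m) end.

Lemma vsub_vaff m (x u : tup R m) : vsub x u = vaff x (-1) u.
Proof. by elim: m x u => [|m IH] x u /=; rewrite mulN1r// IH. Qed.

Lemma vscale_vaff m c (x : tup R m) : vscale c x = vaff (v0 m) c x.
Proof. by elim: m x => [|m IH] x /=; rewrite add0r// IH. Qed.

Lemma dotpC m (x y : tup R m) : dotp x y = dotp y x.
Proof. by elim: m x y => [|m IH] x y /=; rewrite mulrC// IH. Qed.

Lemma dotp_vaff m (b v w : tup R m) r :
  dotp (vaff b r v) w = dotp b w + r * dotp v w.
Proof.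
elim: m b v w => [|m IH] b v w /=; first by rewrite mulrDl mulrA.
by rewrite IH mulrDl mulrDr mulrA addrACA.
Qed.

Lemma dotp0 m (w : tup R m) : dotp (v0 m) w = 0.
Proof. by elim: m w => [|m IH] w /=; rewrite mul0r// IH addr0. Qed.

Lemma dotp_ge0 m (v : tup R m) : 0 <= dotp v v.
Proof.
by elim: m v => [|m IH] v /=; rewrite ?addr_ge0 ?IH// -expr2 sqr_ge0.
Qed.

Lemma vnorm_ge0 m (v : tup R m) : 0 <= vnorm v. Proof. exact: sqrtr_ge0. Qed.

Lemma vnorm_sqr m (v : tup R m) : vnorm v ^+ 2 = dotp v v.
Proof. by rewrite sqr_sqrtr// dotp_ge0. Qed.

Section measurability.
Context d (T : measurableType d).

Lemma measurable_dotp m (a b : T -> tup R m) : measurable_fun setT a ->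
  measurable_fun setT b -> measurable_fun setT (fun t => dotp (a t) (b t)).
Proof.
elim: m a b => [|m IH] a b ma mb /=; first exact: measurable_funM.
apply: measurable_funD.
  by apply: measurable_funM; apply: (measurableT_comp measurable_fst).
by apply: IH; apply: (measurableT_comp measurable_snd).
Qed.

Lemma measurable_vaff m (a b : T -> tup R m) (r : T -> R) :
  measurable_fun setT a -> measurable_fun setT r -> measurable_fun setT b ->
  measurable_fun setT (fun t => vaff (a t) (r t) (b t)).
Proof.
elim: m a b => [|m IH] a b ma mr mb /=.
  by apply: measurable_funD => //; exact: measurable_funM.
apply: measurable_fun_pair.
  apply: measurable_funD; first exact: (measurableT_comp measurable_fst).
  by apply: measurable_funM => //; exact: (measurableT_comp measurable_fst).
by apply: IH => //; exact: (measurableT_comp measurable_snd).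
Qed.

Lemma measurable_vnorm m (a : T -> tup R m) : measurable_fun setT a ->
  measurable_fun setT (fun t => vnorm (a t)).
Proof.
move=> ma; apply: (measurableT_comp (f := @Num.sqrt R)).
  exact: continuous_measurable_fun (@sqrt_continuous R).
exact: measurable_dotp.
Qed.
End measurability.

Local Open Scope ereal_scope.

Lemma ge0_integral_vaff m (b : tup R m) (r : R) (g : tup R m -> \bar R) :
  r != 0%R -> measurable_fun setT g -> (forall x, 0 <= g x) ->
  \int[mu m]_x g x = (`|r| ^+ m.+1)%:E * \int[mu m]_x g (vaff b r x).
Proof.
move=> r0; elim: m b g => [|m IH] b g mg g0.
  by rewrite expr1; exact: ge0_integral_affine.
have mg1 x : measurable_fun setT (fun v => g (x, v)).
  exact: (measurableT_comp mg (measurable_pair1 x)).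
have maff : measurable_fun setT (fun z : tup R m.+1 => vaff b r z).
  by apply: measurable_vaff.
rewrite /= [LHS]integral_prodm1// integral_prodm1//; last first.
  exact: (measurableT_comp mg maff).
rewrite /=.
under eq_integral => x _ do rewrite (IH b.2)//.
rewrite ge0_integralZl_EFin; first last.
- by rewrite exprn_ge0.
- apply: (measurable_fun_fubini_tonelli_F (fun z => g (z.1, vaff b.2 r z.2))) => //.
  apply: (measurableT_comp mg); apply: measurable_fun_pair => //.
  exact: measurable_vaff.
- by move=> x _; exact: integral_ge0.
- exact: measurableT.
rewrite (ge0_integral_affine b.1 r0); first last.
- by move=> x; exact: integral_ge0.
- apply: (measurable_fun_fubini_tonelli_F (fun z => g (z.1, vaff b.2 r z.2))) => //.
  apply: (measurableT_comp mg); apply: measurable_fun_pair => //.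
  exact: measurable_vaff.
by rewrite muleA -EFinM mulrC -exprS.
Qed.

Lemma integral_vaff m (b : tup R m) (r : R) (g : tup R m -> \bar R) :
  r != 0%R -> (mu m).-integrable setT g ->
  \int[mu m]_x g x = (`|r| ^+ m.+1)%:E * \int[mu m]_x g (vaff b r x).
Proof.
move=> r0 /[dup] gi /integrableP[mg _].
pose h x := g (vaff b r x).
have hp : (fun x => g^\+ (vaff b r x)) = h^\+.
  by apply/funext => x; rewrite !funeposE.
have hn : (fun x => g^\- (vaff b r x)) = h^\-.
  by apply/funext => x; rewrite !funenegE.
have := integral_funepos_lt_pinfty measurableT gi.
rewrite (ge0_integral_vaff b r0 (measurable_funepos mg))// hp => hoo.
rewrite integralE [in RHS]integralE.
rewrite (ge0_integral_vaff b r0 (measurable_funepos mg))//.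
rewrite (ge0_integral_vaff b r0 (measurable_funeneg mg))// hp hn.
(* Distributing the factor over the difference requires a finite term. The positive part provides
   one: its integral times a positive factor is finite by [hoo]. *)
rewrite [RHS]muleBr//; apply: fin_num_adde_defr.
rewrite ge0_fin_numE; last by apply: integral_ge0 => x _; exact: funepos_ge0.
rewrite ltey; apply: contraTneq hoo => ->.
by rewrite gt0_muley ?ltxx// lte_fin exprn_gt0// normr_gt0.
Qed.

Lemma integrable_vaff m (b : tup R m) (r : R) (g : tup R m -> \bar R) :
  r != 0%R -> (mu m).-integrable setT g ->
  (mu m).-integrable setT (fun x => g (vaff b r x)).
Proof.
move=> r0 /integrableP[mg goo]; apply/integrableP; split.
  by apply: (measurableT_comp mg); exact: measurable_vaff.
move: goo; rewrite (ge0_integral_vaff b r0); last 2 first.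
- exact: measurableT_comp.
- by [].
rewrite !ltey; apply: contra_neq => ->.
by rewrite gt0_muley// lte_fin exprn_gt0// normr_gt0.
Qed.

Lemma CI_vaff m (b : tup R m) (r : R) (g : tup R m -> R[i]) :
  r != 0%R -> cintegrable (mu m) g ->
  (CI (mu m) g = creal (`|r| ^+ m.+1) * CI (mu m) (fun x => g (vaff b r x)))%R.
Proof.
move=> r0 [g1 g2]; apply: complex_ext; rewrite !(cRe_CI, cIm_CI, cE) /Rintegral.
  rewrite (integral_vaff b r0 g1) fineM//; first by rewrite mul0r subr0.
  exact: (integrable_fin_num measurableT (integrable_vaff b r0 g1)).
rewrite (integral_vaff b r0 g2) fineM//; first by rewrite mul0r addr0.
exact: (integrable_fin_num measurableT (integrable_vaff b r0 g2)).
Qed.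

Lemma cintegrable_vaff m (b : tup R m) (r : R) (g : tup R m -> R[i]) :
  r != 0%R -> cintegrable (mu m) g ->
  cintegrable (mu m) (fun x => g (vaff b r x)).
Proof.
move=> r0 [g1 g2]; split; first exact: (integrable_vaff b r0 g1).
exact: (integrable_vaff b r0 g2).
Qed.

Lemma ge0_iint m (g : tup R m -> \bar R) : measurable_fun setT g ->
  (forall x, 0 <= g x) -> iint g = \int[mu m]_x g x.
Proof.
elim: m g => [//|m IH] g mg g0; rewrite /= [RHS]integral_prodm1//.
by apply: eq_integral => x _; rewrite IH//;
  exact: (measurableT_comp mg (measurable_pair1 x)).
Qed.

(* Needed because the iterated integral of an integrable function is controlled
   by Fubini only almost everywhere. *)
Lemma measurable_iint d (T : measurableType d) m (g : T * tup R m -> \bar R) :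
  measurable_fun setT g -> measurable_fun setT (fun t => iint (fun v => g (t, v))).
Proof.
elim: m d T g => [|m IH] d T g mg.
  rewrite (_ : (fun t => _) = (fun t => \int[leb R]_y g^\+ (t, y)) \-
      (fun t => \int[leb R]_y g^\- (t, y))); last first.
    apply/funext => x; rewrite /= [LHS]integralE.
    by congr (_ + _); [|congr (- _)]; apply: eq_integral => y _;
      rewrite !(funeposE, funenegE).
  apply: emeasurable_funB.
    apply: (measurable_fun_fubini_tonelli_F g^\+) => //.
    exact: measurable_funepos.
  apply: (measurable_fun_fubini_tonelli_F g^\-) => //.
  exact: measurable_funeneg.
pose g' (z : (T * measurableTypeR R) * tup R m) := g (z.1.1, (z.1.2, z.2)).
have mg' : measurable_fun setT g'.
  apply: (measurableT_comp mg); apply: measurable_fun_pair => /=.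
    exact: (measurableT_comp measurable_fst measurable_fst).
  apply: measurable_fun_pair => //.
  exact: (measurableT_comp measurable_snd measurable_fst).
have mh := IH _ _ _ mg'.
pose h (z : T * measurableTypeR R) := iint (fun v => g' (z, v)).
rewrite (_ : (fun t => _) = (fun t => \int[leb R]_y h^\+ (t, y)) \-
    (fun t => \int[leb R]_y h^\- (t, y))); last first.
  apply/funext => x; rewrite -[LHS]/(\int[leb R]_y h (x, y)) [LHS]integralE.
  by congr (_ + _); [|congr (- _)]; apply: eq_integral => y _;
    rewrite !(funeposE, funenegE).
apply: emeasurable_funB.
  apply: (measurable_fun_fubini_tonelli_F h^\+) => //.
  exact: measurable_funepos.
apply: (measurable_fun_fubini_tonelli_F h^\-) => //.
exact: measurable_funeneg.
Qed.

Lemma integrable_iint m (g : tup R m -> \bar R) : (mu m).-integrable setT g ->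
  iint g = \int[mu m]_x g x.
Proof.
elim: m g => [//|m IH] g gi; have mg := measurable_int _ gi.
rewrite /= -[RHS](integral12_prod_meas1 gi); apply: ae_eq_integral => //.
- exact: (@measurable_iint _ (measurableTypeR R) m g mg).
- exact: (measurable_fubini_F gi).
- by apply: filterS (ae_integrable1 gi) => x gx _; rewrite IH.
Qed.

Lemma cint_CI m (g : tup R m -> R[i]) : cintegrable (mu m) g ->
  cint g = CI (mu m) g.
Proof.
by move=> [g1 g2]; rewrite /cint !integrable_iint.
Qed.

End euclidean.

(** * Gaussian integrals *)

Section complex_derivative.
Variable R : realType.
Implicit Types (F : R -> R[i]) (a : R).

Definition cderiv F a (D : R[i]) := is_derive a 1 (fun t => Re (F t)) (Re D) /\
  is_derive a 1 (fun t => Im (F t)) (Im D).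

Lemma cderiv_eq F a D D' : cderiv F a D -> D = D' -> cderiv F a D'.
Proof. by move=> ? <-. Qed.

Lemma is_derive_eqf (f g : R -> R) a dg : f =1 g -> is_derive a 1 g dg ->
  is_derive a 1 f dg.
Proof. by move=> /funext ->. Qed.

Lemma cderivM F G a D E : cderiv F a D -> cderiv G a E ->
  cderiv (fun t => F t * G t) a (D * G a + F a * E).
Proof.
move=> [F1 F2] [G1 G2]; split.
  apply: (is_derive_eqf (g := (fun t => Re (F t)) * (fun t => Re (G t)) -
     (fun t => Im (F t)) * (fun t => Im (G t)))).
    by move=> t; rewrite !cE.
  apply: is_derive_eq; rewrite !cE /GRing.scale/=; ring.
apply: (is_derive_eqf _ (is_derive_eq (is_deriveD (is_deriveM F1 G2) (is_deriveM F2 G1)) _)).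
  by move=> t; rewrite !cE.
by rewrite !cE /GRing.scale/=; ring.
Qed.

Lemma cderiv_cexp F a D : cderiv F a D ->
  cderiv (fun t => cexp (F t)) a (cexp (F a) * D).
Proof.
move=> [F1 F2].
have dexp : is_derive a 1 (fun t => expR (Re (F t))) (expR (Re (F a)) * Re D).
  exact: (@is_derive1_comp R expR (fun t => Re (F t)) a _ _ (is_derive_expR _) F1).
have dcos : is_derive a 1 (fun t => cos (Im (F t))) (- sin (Im (F a)) * Im D).
  exact: (@is_derive1_comp R (@cos R) (fun t => Im (F t)) a _ _ (is_derive_cos _) F2).
have dsin : is_derive a 1 (fun t => sin (Im (F t))) (cos (Im (F a)) * Im D).
  exact: (@is_derive1_comp R (@sin R) (fun t => Im (F t)) a _ _ (is_derive_sin _) F2).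
split.
  apply: (is_derive_eqf (g := (fun t => expR (Re (F t))) * (fun t => cos (Im (F t))))).
    by move=> t; rewrite !cE.
  by apply: is_derive_eq; rewrite !cE /GRing.scale/=; ring.
apply: (is_derive_eqf (g := (fun t => expR (Re (F t))) * (fun t => sin (Im (F t))))).
  by move=> t; rewrite !cE.
by apply: is_derive_eq; rewrite !cE /GRing.scale/=; ring.
Qed.

(** Computing one derivative in two ways and comparing is the source of the identities
    [E_translation] and [Lap_rec]. *)
Lemma cderiv_unique F a D E : cderiv F a D -> cderiv F a E -> D = E.
Proof.
move=> [[_ h1] [_ h2]] [[_ k1] [_ k2]]; apply: complex_ext.
  by rewrite -h1.
by rewrite -h2.
Qed.

Lemma cderiv_eqf F G a D : F =1 G -> cderiv G a D -> cderiv F a D.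
Proof. by move=> /funext ->. Qed.

Lemma cderiv0_cst F : (forall a, cderiv F a 0) -> forall a b, F a = F b.
Proof.
move=> F0 a b; apply: complex_ext.
  by apply: (@is_derive_0_is_cst _ (fun t => Re (F t))) => x; have [] := F0 x.
by apply: (@is_derive_0_is_cst _ (fun t => Im (F t))) => x; have [] := F0 x.
Qed.

End complex_derivative.

Section derivative_under_integral.
Context d (T : measurableType d) (R : realType).
Variable mu : {measure set T -> \bar R}.

Lemma is_derive_Rintegral (f f' : R -> T -> R) (G : T -> R) (a e : R) : 0 < e ->
  (forall t, `|t - a| < e -> mu.-integrable setT (fun y => (f t y)%:E)) ->
  (forall t y, `|t - a| < e -> is_derive t 1 (f ^~ y) (f' t y)) ->
  (forall t y, `|t - a| < e -> `|f' t y| <= G y) ->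
  mu.-integrable setT (fun y => (G y)%:E) ->
  is_derive a 1 (fun t => \int[mu]_y f t y)%R (\int[mu]_y f' a y)%R.
Proof.
move=> e0 fi fd fG Gi.
have inI t : `]a - e, a + e[%classic t -> `|t - a| < e.
  by rewrite /= in_itv/= => /andP[h1 h2]; rewrite ltr_norml; apply/andP; split; lra.
have Ia : `]a - e, a + e[%classic a.
  by rewrite /= in_itv/=; apply/andP; split; lra.
have G0 y : 0 <= G y by rewrite (le_trans _ (fG a y _))// subrr normr0.
have der t y : `|t - a| < e -> partial1of2 f t y = f' t y.
  by move=> ta; rewrite partial1of2E; have [_ ->] := fd t y ta.
have fi' t : `]a - e, a + e[%classic t -> mu.-integrable setT (EFin \o f t).
  by move=> /inI /fi.
have fd' t y : `]a - e, a + e[%classic t -> setT y -> derivable (f ^~ y) t 1.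
  by move=> /inI ta _; have [] := fd t y ta.
have fG' t y : `]a - e, a + e[%classic t -> setT y -> `|partial1of2 f t y| <= G y.
  by move=> /inI ta _; rewrite der//; exact: fG.
split.
  exact: (derivable_under_integral measurableT Ia fi' fd' G0 Gi fG').
rewrite -derive1E (differentiation_under_integral measurableT Ia fi' fd' G0 Gi fG').
by apply: eq_Rintegral => y _; rewrite der// subrr normr0.
Qed.

Lemma cderiv_CI (f f' : R -> T -> R[i]) (G : T -> R) (a e : R) : 0 < e ->
  (forall t, `|t - a| < e -> cintegrable mu (f t)) ->
  (forall t y, `|t - a| < e -> cderiv (f ^~ y) t (f' t y)) ->
  (forall t y, `|t - a| < e -> cabs (f' t y) <= G y) ->
  mu.-integrable setT (fun y => (G y)%:E) ->
  cderiv (fun t => CI mu (f t)) a (CI mu (f' a)).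
Proof.
move=> e0 fi fd fG Gi; split.
  apply: (is_derive_Rintegral e0 (f := fun t y => Re (f t y))
      (f' := fun t y => Re (f' t y)) _ _ _ Gi) => t.
  - by move=> /fi[].
  - by move=> y /(fd t y)[].
  - by move=> y /(fG t y); apply: le_trans; exact: le_Re_cabs.
apply: (is_derive_Rintegral e0 (f := fun t y => Im (f t y))
    (f' := fun t y => Im (f' t y)) _ _ _ Gi) => t.
- by move=> /fi[].
- by move=> y /(fd t y)[].
- by move=> y /(fG t y); apply: le_trans; exact: le_Im_cabs.
Qed.

End derivative_under_integral.

Section gaussian_line.
Variable R : realType.

Lemma integral_gauss_line (t : R) : 0 < t ->
  (\int[leb R]_x (expR (- (t * x ^+ 2)))%:E = (Num.sqrt (pi / t))%:E)%E.
Proof.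
move=> t0; have st0 : 0 < Num.sqrt t by rewrite sqrtr_gt0.
rewrite (@ge0_integral_affine _ 0 (Num.sqrt t)^-1); first last.
- by move=> x; rewrite lee_fin expR_ge0.
- apply/measurable_EFinP; apply: measurable_expR_comp.
  by apply: measurable_funN; apply: measurable_funM => //; exact: exprn_measurable.
- by rewrite invr_eq0 gt_eqF.
under eq_integral => x _.
  rewrite add0r exprMn exprVn sqr_sqrtr ?(ltW t0)// mulrA mulfV ?gt_eqF// mul1r.
  over.
have := @integralT_gauss R; rewrite /gauss_fun => ->.
by rewrite -EFinM gtr0_norm ?invr_gt0// sqrtrM ?pi_ge0// sqrtrV ?(ltW t0)// mulrC.
Qed.

Lemma integrable_gauss_line (t : R) : 0 < t ->
  (leb R).-integrable setT (fun x => (expR (- (t * x ^+ 2)))%:E).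
Proof.
move=> t0; apply: ge0_integrable.
- apply: measurable_expR_comp; apply: measurable_funN.
  by apply: measurable_funM => //; exact: exprn_measurable.
- by move=> x; exact: expR_ge0.
- by rewrite integral_gauss_line// ltry.
Qed.

Local Notation gc q x := (cexp ((- x ^+ 2) +i* (q * x))).
Local Notation E q := (CI (leb R) (fun x => gc q x)).

Lemma cmeas_gauss (h q : R) :
  cmeas (fun x : measurableTypeR R => gc q (x + h)).
Proof.
apply: cmeas_cexp; apply: cmeas_pair.
  by apply: measurable_funN; apply: measurable_funX; exact: measurable_funD.
by apply: measurable_funM => //; exact: measurable_funD.
Qed.

Lemma cintegrable_gauss (h q : R) :
  cintegrable (leb R) (fun x => gc q (x + h)).
Proof.
have i0 : cintegrable (leb R) (fun x => gc q x).
  apply: (@cintegrable_le _ (measurableTypeR R) R (leb R) _ (fun x => expR (- (1 * (x : R) ^+ 2)))).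
  - have := cmeas_gauss 0 q.
    by rewrite (_ : (fun _ => _) = (fun x => gc q x))//;
      apply/funext => x; rewrite addr0.
  - by move=> x; rewrite cabs_cexp /= mul1r.
  - exact: integrable_gauss_line.
have := @cintegrable_vaff R 0%N h 1 _ (oner_neq0 _) i0.
by rewrite (_ : (fun _ => _) = (fun x => gc q (x + h)))//;
  apply/funext => x /=; rewrite mul1r addrC.
Qed.

Lemma cintegrable_gauss0 q :
  cintegrable (leb R) (fun x => gc q x).
Proof.
have := cintegrable_gauss 0 q.
by rewrite (_ : (fun _ => _) = (fun x => gc q x))//;
  apply/funext => x; rewrite addr0.
Qed.

Lemma cabs_gauss_mul_le (q x : R) :
  cabs (gc q x * (0 +i* x)) <= expR (- (2^-1 * x ^+ 2)).
Proof.
rewrite cabsM cabs_cexp /=.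
have -> : cabs (0 +i* x) = `|x| by rewrite /cabs /= expr0n /= add0r sqrtr_sqr.
(* Half of the exponent absorbs the linear factor, because |x| <= 1 + x^2/2 <= e^(x^2/2). *)
have -> : - x ^+ 2 = - (2^-1 * x ^+ 2) - 2^-1 * x ^+ 2 by lra.
rewrite expRD -mulrA -[leRHS]mulr1 ler_pM2l ?expR_gt0// expRN mulrC.
rewrite ler_pdivrMr ?expR_gt0// mul1r (le_trans _ (expR_ge1Dx _))//.
rewrite -real_normK ?num_real//; nra.
Qed.

Lemma cintegrable_gauss_mul q :
  cintegrable (leb R) (fun x => gc q x * (0 +i* x)).
Proof.
apply: (@cintegrable_le _ (measurableTypeR R) R (leb R) _
    (fun x => expR (- (2^-1 * (x : R) ^+ 2)))).
- apply: cmeasM; first exact: cintegrable_meas (cintegrable_gauss0 q).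
  exact: cmeas_pair.
- exact: cabs_gauss_mul_le.
- by apply: integrable_gauss_line; lra.
Qed.

Lemma E_deriv q : cderiv (fun q => E q) q
  (CI (leb R) (fun x => gc q x * (0 +i* x))).
Proof.
apply: (@cderiv_CI _ _ _ (leb R) (fun q x => gc q x)
   (fun q x => gc q x * (0 +i* x))
   (fun x => expR (- (2^-1 * x ^+ 2))) q 1) => //.
- by move=> t _; exact: cintegrable_gauss0.
- move=> t x _; apply: cderiv_cexp; split => /=; first exact: is_derive_cst.
  by apply: is_derive_eq; rewrite /GRing.scale/=; ring.
- by move=> t x _; exact: cabs_gauss_mul_le.
- by apply: integrable_gauss_line; lra.
Qed.

(* Translating the variable does not change [E q]; differentiating in the
   translation parameter gives this identity. *)
Lemma E_translation q :
  CI (leb R) (fun x => gc q x * (0 +i* x)) =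
  creal (- (q / 2)) * E q.
Proof.
pose f h x := gc q (x + h).
pose f' h x := f h x * ((- 2 * (x + h)) +i* q).
have fE h : CI (leb R) (f h) = E q.
  have i0 := cintegrable_gauss 0 q.
  have := @CI_vaff R 0%N h 1 _ (oner_neq0 _) i0.
  rewrite normr1 expr1n creal1 mul1r /= => E1.
  transitivity (CI (leb R) (fun x => gc q (x + 0))).
    rewrite E1; apply: eq_CI => x; rewrite /f mul1r addr0.
    by rewrite (addrC h).
  by apply: eq_CI => x; rewrite addr0.
have d1 : cderiv (fun h => CI (leb R) (f h)) 0 (CI (leb R) (f' 0)).
  (* Origin of the majorant: for |t| < 1 one has -(x + t)^2 <= 1 - x^2/2, and the linear factor
     costs at most (6 + |q|) e^(x^2/4), which leaves e^(-x^2/4). *)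
  apply: (@cderiv_CI _ _ _ (leb R) f f'
    (fun x => ((6 + `|q|) * expR 1) * expR (- (4^-1 * x ^+ 2))) 0 1) => //.
  - by move=> t _; exact: cintegrable_gauss.
  - move=> t x _; apply: cderiv_cexp; split => /=.
      by apply: is_derive_eq; rewrite /GRing.scale/=; ring.
    by apply: is_derive_eq; rewrite /GRing.scale/=; ring.
  - move=> t x; rewrite subr0 => t1; rewrite /f' cabsM cabs_cexp [complex.Re _]/=.
    have h1 : cabs ((- 2 * (x + t)) +i* q) <= (6 + `|q|) * expR (4^-1 * x ^+ 2).
      rewrite (le_trans (cabs_le _))//=.
      apply: (@le_trans _ _ ((6 + `|q|) * (1 + 4^-1 * x ^+ 2))); last first.
        by rewrite ler_pM2l ?expR_ge1Dx// ltr_pwDl.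
      have h0 : `|- 2 * (x + t)| <= 2 * (`|x| + 1).
        rewrite normrM normrN (ger0_norm (ler0n _ 2)) ler_pM2l//.
        by rewrite (le_trans (ler_normD x t))// lerD2l ltW.
      have hx := real_normK (num_real x).
      have := mulr_ge0 (normr_ge0 q) (sqr_ge0 `|x|).
      have := sqr_ge0 (`|x| - 1); rewrite -hx; move: h0; clear.
      set A := `|_|; set B := `|x|; set C := `|q|; nra.
    have h2 : expR (- (x + t) ^+ 2) <= expR 1 * expR (- (2^-1 * x ^+ 2)).
      rewrite -expRD ler_expR.
      have : t ^+ 2 <= 1 by rewrite -real_normK ?num_real// exprn_ile1// ltW.
      have := sqr_ge0 (x + 2 * t); nra.
    rewrite (le_trans (ler_pM _ _ h2 h1)) ?expR_ge0 ?cabs_ge0//.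
    rewrite le_eqVlt; apply/orP; left; apply/eqP.
    have -> : - (4^-1 * x ^+ 2) = - (2^-1 * x ^+ 2) + 4^-1 * x ^+ 2 by lra.
    by rewrite expRD; ring.
  - by apply: rintegrableZ; apply: integrable_gauss_line; lra.
have d0 : cderiv (fun h => CI (leb R) (f h)) 0 0.
  by apply: (cderiv_eqf (G := fun=> E q)) => //; split; exact: is_derive_cst.
have f0E : CI (leb R) (f' 0) =
    CI (leb R) (fun x => (0 +i* 2) * (gc q x * (0 +i* x)) +
      (0 +i* q) * gc q x).
  apply: eq_CI => x; rewrite /f' /f !addr0.
  have -> : ((- 2 * x) +i* q) = (0 +i* 2) * (0 +i* x) + (0 +i* q) :> R[i].
    by apply: complex_ext; rewrite !(cReD, cImD, cReM, cImM)/=; ring.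
  by ring.
have := cderiv_unique d1 d0; rewrite f0E.
rewrite CID; [|apply: cintegrableZ|apply: cintegrableZ]; last 2 first.
- exact: cintegrable_gauss_mul.
- exact: cintegrable_gauss0.
rewrite CIZ; last exact: cintegrable_gauss_mul.
rewrite CIZ; last exact: cintegrable_gauss0.
move: (CI _ _) (CI _ _) => Y X h.
(* The relation 2i X + i q Y = 0 is solved for X by multiplying it by i/2. *)
have : (0 +i* 2^-1) * ((0 +i* 2) * X + (0 +i* q) * Y) = 0 by rewrite h mulr0.
have -> : (0 +i* 2^-1) * ((0 +i* 2) * X + (0 +i* q) * Y) =
    - (X - creal (- (q / 2)) * Y).
  have c1 : (0 +i* 2^-1) * (0 +i* 2) = - 1 :> R[i].
    by apply: complex_ext; rewrite !(cReM, cImM, cReN, cImN)/=; lra.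
  have c2 : (0 +i* 2^-1) * (0 +i* q) = creal (- (q / 2)) :> R[i].
    by apply: complex_ext; [rewrite cReM [in RHS]cRe_creal|rewrite cImM [in RHS]cIm_creal] => /=; lra.
  by rewrite mulrDr !mulrA c1 c2; ring.
by move/eqP; rewrite oppr_eq0 subr_eq0 => /eqP.
Qed.

(** [E_translation] turns the derivative of E into -(q/2) E, so E(q) e^(q^2/4) is constant, and at q
    = 0 it is the real Gaussian integral. *)
Lemma E_value q : E q = creal (Num.sqrt pi * expR (- (q ^+ 2 / 4))).
Proof.
have dE t : cderiv (fun q => E q) t (creal (- (t / 2)) * E t).
  by rewrite -E_translation; exact: E_deriv.
have dP (t : R) : cderiv (fun t => cexp (creal (t ^+ 2 / 4))) t
    (cexp (creal (t ^+ 2 / 4)) * creal (t / 2)).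
  apply: cderiv_cexp; split => /=; last exact: is_derive_cst.
  apply: (is_derive_eqf (g := ((id : R -> R) * id) * cst 4^-1)).
    by move=> u; rewrite cRe_creal expr2.
  by apply: is_derive_eq; rewrite cRe_creal /GRing.scale/=; lra.
have d0 (t : R) : cderiv (fun t => E t * cexp (creal (t ^+ 2 / 4))) t 0.
  by apply: cderiv_eq (cderivM (dE t) (dP t)) _; rewrite crealN; ring.
have := cderiv0_cst d0 q 0.
have -> : E 0 = creal (Num.sqrt pi).
  rewrite (@eq_CI _ (measurableTypeR R) R (leb R) _ (fun x => creal (expR (- (1 * (x : R) ^+ 2))))); last first.
    by move=> x; rewrite mul0r -cexp_creal mul1r.
  rewrite CI_creal /Rintegral integral_gauss_line//.
  by rewrite divr1.
rewrite expr0n/= mul0r creal0 cexp0 mulr1 => h; rewrite [RHS]crealM -h.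
by rewrite -mulrA cexp_creal -crealM -expRD subrr expR0 creal1 mulr1.
Qed.

Lemma gauss_line (t p q : R) : 0 < t ->
  let f x := cexp ((- (t * x ^+ 2) + p * x) +i* (q * x)) in
  cintegrable (leb R) f /\ CI (leb R) f = creal (Num.sqrt (pi / t)) *
     cexp (((p ^+ 2 - q ^+ 2) / (4 * t)) +i* (2 * (p * q) / (4 * t))).
Proof.
move=> t0 f; have st0 : 0 < Num.sqrt t by rewrite sqrtr_gt0.
have st2 : Num.sqrt t ^+ 2 = t by rewrite sqr_sqrtr// ltW.
set s := Num.sqrt t in st0 st2.
have s0 : s != 0 by rewrite gt_eqF.
(* The square is completed for the real linear term only. The substitution b + s x then stays on the
   real line, and the imaginary term is left to [E_value]. *)
pose q' := q / s.
pose e x := cexp ((- x ^+ 2) +i* (q' * x)).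
pose b := - (p / (2 * s)).
pose K := cexp ((p ^+ 2 / (4 * t)) +i* (p * q / (2 * t))).
have fE x : f x = K * e (b + s * x).
  rewrite /f /K /e -cexpD; congr cexp; apply: complex_ext;
    rewrite !(cReD, cImD)/= /b /q' -st2; field; exact: s0.
have ei : cintegrable (leb R) e by exact: cintegrable_gauss0.
split.
  rewrite (funext fE); apply: cintegrableZ.
  exact: (@cintegrable_vaff R 0%N b s e s0 ei).
rewrite (funext fE) CIZ; last exact: (@cintegrable_vaff R 0%N b s e s0 ei).
have := @CI_vaff R 0%N b s e s0 ei; rewrite /= expr1 E_value => E1.
have cs0 : creal `|s| != 0 by rewrite creal_eq0 normr_eq0.
apply: (mulfI cs0); rewrite mulrCA -E1.
have -> : Num.sqrt (pi / t) = Num.sqrt pi / s.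
  by rewrite sqrtrM ?pi_ge0// sqrtrV ?ltW.
set Z := cexp _.
have -> : creal `|s| * (creal (Num.sqrt pi / s) * Z) = creal (Num.sqrt pi) * Z.
  by rewrite mulrA -crealM gtr0_norm// mulrCA mulfV// mulr1.
rewrite crealM mulrCA; congr (_ * _); rewrite /K /Z.
rewrite -cexp_creal -cexpD; congr cexp; apply: complex_ext;
  rewrite !(cReD, cImD)/= ?(cRe_creal, cIm_creal) /q' -st2; field; exact: s0.
Qed.

End gaussian_line.

Section tensor.
Context d1 d2 (T1 : measurableType d1) (T2 : measurableType d2) (R : realType)
  (m1 : {sigma_finite_measure set T1 -> \bar R})
  (m2 : {sigma_finite_measure set T2 -> \bar R}).

Lemma cintegrable_tensor (f : T1 -> R[i]) (g : T2 -> R[i]) :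
  cintegrable m1 f -> cintegrable m2 g ->
  cintegrable (prodm m1 m2) (fun z => f z.1 * g z.2).
Proof.
move=> fi gi; apply: cintegrable_prodm1.
  apply: cmeasM; first exact: (cmeas_comp (cintegrable_meas fi) measurable_fst).
  exact: (cmeas_comp (cintegrable_meas gi) measurable_snd).
have /integrableP[_ foo] := cintegrable_cabs fi.
have /integrableP[_ goo] := cintegrable_cabs gi.
under eq_integral => x _.
  under eq_integral => y _.
    rewrite /= cabsM EFinM.
    over.
  rewrite ge0_integralZl_EFin//; first last.
  - exact: cabs_ge0.
  - by apply/measurable_EFinP/measurable_cabs; exact: cintegrable_meas gi.
  - by move=> y _; rewrite lee_fin cabs_ge0.
  over.
rewrite /= ge0_integralZr//; first last.
- by apply: integral_ge0 => y _; rewrite lee_fin cabs_ge0.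
- by move=> x _; rewrite lee_fin cabs_ge0.
- by apply/measurable_EFinP/measurable_cabs; exact: cintegrable_meas fi.
apply: lte_mul_pinfty.
- by apply: integral_ge0 => y _; rewrite lee_fin cabs_ge0.
- rewrite ge0_fin_numE; last by apply: integral_ge0 => y _; rewrite lee_fin cabs_ge0.
  apply: le_lt_trans foo; rewrite le_eqVlt; apply/orP; left; apply/eqP.
  by apply: eq_integral => x _; rewrite gee0_abs// lee_fin cabs_ge0.
- apply: le_lt_trans goo; rewrite le_eqVlt; apply/orP; left; apply/eqP.
  by apply: eq_integral => x _; rewrite gee0_abs// lee_fin cabs_ge0.
Qed.

Lemma CI_tensor (f : T1 -> R[i]) (g : T2 -> R[i]) :
  cintegrable m1 f -> cintegrable m2 g ->
  CI (prodm m1 m2) (fun z => f z.1 * g z.2) = CI m1 f * CI m2 g.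
Proof.
move=> fi gi; rewrite CI_prodm1; last exact: cintegrable_tensor.
rewrite mulrC -CIZ//; apply: eq_CI => x.
by rewrite /= CIZ// mulrC.
Qed.
End tensor.

Section gaussian_space.
Variable R : realType.

Lemma gauss_space m (t : R) (p q : tup R m) : 0 < t ->
  let f x := cexp ((- (t * dotp x x) + dotp p x) +i* dotp q x) in
  cintegrable (mu R m) f /\ CI (mu R m) f = creal (Num.sqrt (pi / t) ^+ m.+1) *
     cexp (((dotp p p - dotp q q) / (4 * t)) +i* (2 * dotp p q / (4 * t))).
Proof.
move=> t0; elim: m p q => [|m IH] p q f.
  by have := gauss_line p q t0; rewrite /= expr1 -!expr2.
have [i1 E1] := gauss_line p.1 q.1 t0.
have [i2 E2] := IH p.2 q.2.
have fE : f =
 fun z => cexp ((- (t * z.1 ^+ 2) + p.1 * z.1) +i* (q.1 * z.1)) *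
    cexp ((- (t * dotp z.2 z.2) + dotp p.2 z.2) +i* dotp q.2 z.2).
  apply/funext => z; rewrite /f -cexpD; congr cexp; apply: complex_ext;
    rewrite !(cReD, cImD)/=; ring.
rewrite fE; split; first exact: (cintegrable_tensor i1 i2).
rewrite [LHS](CI_tensor i1 i2) E1 E2 mulrACA -crealM -exprS -cexpD.
congr (_ * cexp _); apply: complex_ext; rewrite !(cReD, cImD)/=; ring.
Qed.

Lemma ge0_gauss_space m (t : R) (p : tup R m) : 0 < t ->
  (\int[mu R m]_x (expR (- (t * dotp x x) + dotp p x))%:E =
   (Num.sqrt (pi / t) ^+ m.+1 * expR (dotp p p / (4 * t)))%:E)%E.
Proof.
move=> t0; have [[fi _] fE] := gauss_space p (v0 R m) t0.
move: fE => /(congr1 (fun z => Re z)); rewrite !(cRe_CI, cE)/=.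
rewrite !dotp0 subr0 dotpC dotp0 mulr0 mul0r cos0 mulr1 mul0r subr0 => <-.
rewrite /Rintegral fineK; last exact: integrable_fin_num.
by apply: eq_integral => x _; rewrite !cE/= dotp0 cos0 mulr1.
Qed.

Lemma integrable_gauss_space m (t : R) (p : tup R m) : 0 < t ->
  (mu R m).-integrable setT (fun x => (expR (- (t * dotp x x) + dotp p x))%:E).
Proof.
move=> t0; have [[fi _] _] := gauss_space p (v0 R m) t0.
by apply: eq_rintegrable fi => x; rewrite !cE/= dotp0 cos0 mulr1.
Qed.
End gaussian_space.

(** * Laplace integrals and the Gamma function *)

Section exponential_integrals.
Variable R : realType.

(** The exponential density and its reflection together dominate r e^(-r|u|). *)
Lemma integrable_exp_abs (r : R) : 0 < r ->
  (leb R).-integrable setT (fun u => (expR (- (r * `|u|)))%:E).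
Proof.
move=> r0.
have pdfi := @integrable_exponential_pdf R r r0.
have pNi : (leb R).-integrable setT (fun u : R => (exponential_pdf r (- u))%:E).
  have := @integrable_vaff R 0%N 0 (-1) (fun x => (exponential_pdf r x)%:E).
  rewrite oppr_eq0 oner_neq0 => /(_ isT pdfi).
  by apply: eq_rintegrable => u /=; rewrite add0r mulN1r.
apply: (@integrable_le _ (measurableTypeR R) R (leb R) _
   (fun u => r^-1 * (exponential_pdf r u + exponential_pdf r (- u)))).
- apply: measurable_expR_comp; apply: measurable_funN.
  apply: measurable_funM => //; exact: normr_measurable.
- move=> u; rewrite ger0_norm ?expR_ge0// ler_pdivlMl//.
  have [u0|u0] := leP 0 u.
    rewrite ler_wpDr ?(exponential_pdf_ge0 (ltW r0))// exponential_pdfE//.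
    by rewrite /= mulNr ger0_norm.
  rewrite ler_wpDl ?(exponential_pdf_ge0 (ltW r0))//.
  rewrite exponential_pdfE ?oppr_ge0; last exact: ltW.
  by rewrite /= mulNr mulrN ltr0_norm ?mulrN.
- by apply: rintegrableZ; apply: rintegrableD.
Qed.

(* By convexity, [x * e^u] lies above its tangent line of slope [s + 1]. *)
Lemma exp_exp_le (s x : R) : 0 < s -> 0 < x ->
  exists C, forall u, expR (s * u - x * expR u) <= C * expR (- (Num.min s 1 * `|u|)).
Proof.
move=> s0 x0; have s1 : 0 < s + 1 by lra.
(* The slope of x e^u at [c] is s + 1, one more than the slope of s u; the surplus gives the decay
   e^(-u) for positive u. For negative u the factor e^(s u) decays by itself. *)
pose c := ln ((s + 1) / x).
have cE : x = (s + 1) * expR (- c).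
  by rewrite expRN /c lnK ?posrE ?divr_gt0// invf_div mulrCA mulfV ?gt_eqF// mulr1.
exists (expR `|(s + 1) * (c - 1)|) => u.
rewrite -expRD ler_expR.
have d0 : Num.min s 1 <= s by rewrite ge_min lexx.
have d1 : Num.min s 1 <= 1 by rewrite ge_min lexx orbT.
have dp : 0 < Num.min s 1 by rewrite lt_min s0 ltr01.
have [u0|u0] := leP 0 u.
  have h : (s + 1) * (1 + (u - c)) <= x * expR u.
    rewrite cE -mulrA -expRD ler_pM2l// (addrC (- c)); exact: expR_ge1Dx.
  rewrite (ger0_norm u0); have h1 := ler_norm ((s + 1) * (c - 1)).
  have h2 : Num.min s 1 * u <= u by rewrite -[leRHS]mul1r ler_wpM2r.
  have h3 : s * u - x * expR u <= (s + 1) * (c - 1) - u.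
    rewrite -subr_ge0; move: h; rewrite -subr_ge0.
    by congr (is_true (0 <= _)); ring.
  by rewrite (le_trans h3)// lerB.
have h1 : 0 <= x * expR u by rewrite mulr_ge0 ?expR_ge0 ?ltW.
have h2 : s * u <= Num.min s 1 * u by rewrite ler_wnM2r// ltW.
rewrite (ltr0_norm u0) mulrN opprK (@le_trans _ _ (Num.min s 1 * u))//.
  by rewrite (le_trans _ h2)// gerBl.
by rewrite lerDr.
Qed.

Lemma integrable_exp_exp (s x : R) : 0 < s -> 0 < x ->
  (leb R).-integrable setT (fun u => (expR (s * u - x * expR u))%:E).
Proof.
move=> s0 x0; have [C hC] := exp_exp_le s0 x0.
apply: (@integrable_le _ (measurableTypeR R) R (leb R) _
   (fun u => C * expR (- (Num.min s 1 * `|u|)))).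
- apply: measurable_expR_comp; apply: measurable_funB; apply: measurable_funM => //.
- by move=> u; rewrite ger0_norm ?expR_ge0.
- by apply: rintegrableZ; apply: integrable_exp_abs; rewrite lt_min s0 ltr01.
Qed.
End exponential_integrals.

Section laplace.
Variable R : realType.
Implicit Types (mu w : R[i]) (u t : R).

(* The Laplace integral of [t^(mu-1)] at [w], in the variable [t = e^u]. *)
Definition Lapf mu w u := cexp (mu * creal u - creal (expR u) * w).
Definition Lap mu w : R[i] := CI (leb R) (Lapf mu w).

Lemma cabs_Lapf mu w u : cabs (Lapf mu w u) = expR (Re mu * u - Re w * expR u).
Proof. by rewrite cabs_cexp; congr expR; rewrite !cE; ring. Qed.

Lemma cmeas_Lapf d (T : measurableType d) (f : T -> R[i]) (g : T -> R) mu :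
  cmeas f -> measurable_fun setT g -> cmeas (fun z => Lapf mu (f z) (g z)).
Proof.
move=> mf mg; apply: cmeas_cexp; apply: cmeasB.
  exact: cmeasM (cmeas_cst _ _) (cmeas_creal mg).
exact: cmeasM (cmeas_creal (measurable_expR_comp mg)) mf.
Qed.

Lemma cintegrable_Lapf mu w : 0 < Re mu -> 0 < Re w ->
  cintegrable (leb R) (Lapf mu w).
Proof.
move=> m0 w0; apply: (@cintegrable_le _ (measurableTypeR R) R (leb R) _
   (fun u => expR (Re mu * u - Re w * expR u))).
- by apply: (@cmeas_Lapf _ (measurableTypeR R) (fun=> w) id) => //; exact: cmeas_cst.
- by move=> u; rewrite cabs_Lapf.
- exact: integrable_exp_exp.
Qed.

(** In the logarithmic variable, dilating [w] by e^t amounts to translating [u] by t. *)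
Lemma Lap_scale mu w t : 0 < Re mu -> 0 < Re w ->
  Lap mu (creal (expR t) * w) = cexp (- (mu * creal t)) * Lap mu w.
Proof.
move=> m0 w0.
have w1 : 0 < Re (creal (expR t) * w) by rewrite !cE mul0r subr0 mulr_gt0 ?expR_gt0.
have := @CI_vaff R 0%N (- t) 1 _ (oner_neq0 _) (cintegrable_Lapf m0 w1).
rewrite normr1 expr1n creal1 mul1r /Lap => ->.
rewrite -CIZ; last exact: cintegrable_Lapf.
apply: eq_CI => u /=; rewrite mul1r /Lapf -cexpD; congr cexp.
rewrite crealD crealN expRD expRN crealM crealV.
have : creal (expR t) != 0 by rewrite creal_eq0 gt_eqF ?expR_gt0.
by move=> h; field.
Qed.

(** Stated along a path, since it is applied both to dilations t -> e^t w and to vertical lines.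
    Differentiation brings down a factor e^u, which raises [mu] by one; [x0] and [B] give the
    uniform majorant. *)
Lemma Lap_cderiv mu (w w' : R -> R[i]) (a e x0 B : R) : 0 < Re mu -> 0 < e ->
  0 < x0 -> (forall t, `|t - a| < e -> cderiv w t (w' t)) ->
  (forall t, `|t - a| < e -> x0 <= Re (w t)) ->
  (forall t, `|t - a| < e -> cabs (w' t) <= B) ->
  cderiv (fun t => Lap mu (w t)) a (- (w' a) * Lap (mu + 1) (w a)).
Proof.
move=> m0 e0 x00 dw wx wB.
have aa : `|a - a| < e by rewrite subrr normr0.
have m1 : 0 < Re (mu + 1) by rewrite !cE ltr_wpDr.
have -> : - (w' a) * Lap (mu + 1) (w a) =
    CI (leb R) (fun u => - (w' a) * Lapf (mu + 1) (w a) u).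
  by rewrite CIZ//; apply: cintegrable_Lapf => //; exact: lt_le_trans (wx _ aa).
apply: (@cderiv_CI _ _ _ (leb R) (fun t u => Lapf mu (w t) u)
   (fun t u => - (w' t) * Lapf (mu + 1) (w t) u)
   (fun u => B * expR (Re (mu + 1) * u - x0 * expR u)) a e) => //.
- by move=> t ta; apply: cintegrable_Lapf => //; exact: lt_le_trans (wx _ ta).
- move=> t u ta; apply: cderiv_eq.
    apply: (@cderiv_cexp R _ _ (- (creal (expR u) * w' t))).
    have [w1 w2] := dw t ta; split.
      apply: (is_derive_eqf (g := cst (Re (mu * creal u)) -
         cst (expR u) * (fun t => Re (w t)))).
        by move=> v; rewrite !cE !fctE/=; ring.
      by apply: is_derive_eq; rewrite !cE /GRing.scale/=; ring.
    apply: (is_derive_eqf (g := cst (Im (mu * creal u)) -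
       cst (expR u) * (fun t => Im (w t)))).
      by move=> v; rewrite !cE !fctE/=; ring.
    by apply: is_derive_eq; rewrite !cE /GRing.scale/=; ring.
  rewrite /Lapf mulrDl mul1r addrAC [in RHS]cexpD cexp_creal; ring.
- move=> t u ta; rewrite cabsM cabsN cabs_Lapf ler_pM ?cabs_ge0 ?expR_ge0 ?wB//.
  by rewrite ler_expR lerB// ler_pM2r ?expR_gt0// wx.
- apply: rintegrableZ; exact: integrable_exp_exp.
Qed.

(** The derivative of [Lap mu] along e^t w at t = 0 is found once under the integral sign and once
    from [Lap_scale]; this replaces an integration by parts. At w = 1 it is the functional equation
    of Gamma. *)
Lemma Lap_rec mu w : 0 < Re mu -> 0 < Re w -> w * Lap (mu + 1) w = mu * Lap mu w.
Proof.
move=> m0 w0.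
have dexp t : is_derive t 1 (fun t => expR t) (expR t) by exact: is_derive_expR.
have d1 : cderiv (fun t => Lap mu (creal (expR t) * w)) 0
    (- (creal (expR 0) * w) * Lap (mu + 1) (creal (expR 0) * w)).
  apply: (@Lap_cderiv mu (fun t => creal (expR t) * w)
    (fun t => creal (expR t) * w) 0 1 (expR (-1) * Re w) (expR 1 * cabs w)) => //.
  - by rewrite mulr_gt0 ?expR_gt0.
  - move=> t _; split.
      apply: (is_derive_eqf (g := (@expR R) * cst (Re w))).
        by move=> v; rewrite !cE !fctE/=; ring.
      by apply: is_derive_eq; rewrite !cE /GRing.scale/=; ring.
    apply: (is_derive_eqf (g := (@expR R) * cst (Im w))).
      by move=> v; rewrite !cE !fctE/=; ring.
    by apply: is_derive_eq; rewrite !cE /GRing.scale/=; ring.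
  - move=> t; rewrite subr0 ltr_norml => /andP[h _].
    by rewrite !cE mul0r subr0 ler_pM2r// ler_expR ltW.
  - move=> t; rewrite subr0 ltr_norml => /andP[_ h].
    rewrite cabsM cabs_creal ger0_norm ?expR_ge0// ler_wpM2r ?cabs_ge0//.
    by rewrite ler_expR ltW.
have d2 : cderiv (fun t => Lap mu (creal (expR t) * w)) 0 (- mu * Lap mu w).
  apply: (cderiv_eqf (G := fun t => cexp (- (mu * creal t)) * Lap mu w)).
    by move=> t; rewrite Lap_scale.
  apply: cderiv_eq.
    apply: (@cderivM R _ _ _ _ 0); last by split; exact: is_derive_cst.
    apply: (@cderiv_cexp R _ _ (- mu)); split.
      apply: (is_derive_eqf (g := cst (- Re mu) * id)).
        by move=> v; rewrite !cE !fctE/=; ring.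
      by apply: is_derive_eq; rewrite !cE /GRing.scale/=; ring.
    apply: (is_derive_eqf (g := cst (- Im mu) * id)).
      by move=> v; rewrite !cE !fctE/=; ring.
    by apply: is_derive_eq; rewrite !cE /GRing.scale/=; ring.
  cbv beta; rewrite creal0 mulr0 oppr0 cexp0; ring.
have := cderiv_unique d1 d2; rewrite expR0 creal1 mul1r !mulNr.
exact: oppr_inj.
Qed.

Lemma clog_cderiv (x y : R) : 0 < x ->
  cderiv (fun t => clog (x +i* t)) y ((0 +i* 1) / (x +i* y)).
Proof.
move=> x0; have p0 t : 0 < x ^+ 2 + t ^+ 2 by rewrite ltr_pwDl ?sqr_ge0 ?exprn_gt0.
have -> : (0 +i* 1) / (x +i* y) = (y / (x ^+ 2 + y ^+ 2)) +i* (x / (x ^+ 2 + y ^+ 2)).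
  have w0 : (x +i* y) != 0 by rewrite eq_complex /= gt_eqF.
  apply: (mulIf w0); rewrite mulfVK//; apply: complex_ext => /=;
    by field; rewrite gt_eqF.
apply: (cderiv_eqf (G := fun t => (ln (x ^+ 2 + t ^+ 2) / 2) +i* atan (t / x))).
  by move=> t; rewrite clogE.
split => /=.
  have d1 : is_derive y 1 (fun t : R => x ^+ 2 + t ^+ 2) (2 * y).
    apply: (is_derive_eqf _ (is_derive_eq (is_deriveD (is_derive_cst (x ^+ 2) y 1)
      (is_deriveM (is_derive_id y 1) (is_derive_id y 1))) _)).
      by move=> t; rewrite expr2.
    by rewrite /GRing.scale/=; ring.
  have d2 := @is_derive1_comp R (@ln R) _ y _ _ (is_derive1_ln (p0 y)) d1.
  apply: (is_derive_eqf (g := (@ln R \o (fun t : R => x ^+ 2 + t ^+ 2)) * cst 2^-1)) => //.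
  apply: is_derive_eq; rewrite /GRing.scale/=; field; rewrite gt_eqF//.
have d1 : is_derive y 1 (fun t : R => t / x) x^-1.
  apply: (is_derive_eqf (g := (id : R -> R) * cst x^-1)) => //.
  by apply: is_derive_eq; rewrite /GRing.scale/=; ring.
apply: (is_derive_eqf (g := @atan R \o (fun t : R => t / x))) => //.
have -> : x / (x ^+ 2 + y ^+ 2) = (1 + (y / x) ^+ 2)^-1 * x^-1.
  by rewrite exprMn exprVn; field; rewrite !gt_eqF.
exact: (@is_derive1_comp R (@atan R) _ y _ _ (is_derive1_atan (y / x)) d1).
Qed.

(* [Lap mu w * w^mu] is constant along vertical lines by [Lap_rec]. *)
Lemma Lap_pow mu w : 0 < Re mu -> 0 < Re w ->
  Lap mu w = Lap mu 1 * cpow w (- mu).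
Proof.
case: w => x y m0 /= x0.
have d0 t : cderiv (fun t => Lap mu (x +i* t) * cexp (mu * clog (x +i* t))) t 0.
  have dL : cderiv (fun t => Lap mu (x +i* t)) t
      (- (0 +i* 1) * Lap (mu + 1) (x +i* t)).
    apply: (@Lap_cderiv mu (fun t => x +i* t) (fun=> 0 +i* 1) t 1 x 1) => //.
      move=> v _; split; first exact: (is_derive_cst x v 1).
      exact: (is_derive_id v 1).
    by move=> v _; rewrite /cabs /= expr0n /= add0r expr1n sqrtr1.
  have dP : cderiv (fun t => cexp (mu * clog (x +i* t))) t
      (cexp (mu * clog (x +i* t)) * (mu * ((0 +i* 1) / (x +i* t)))).
    apply: cderiv_cexp; apply: cderiv_eq.
      apply: (@cderivM R (fun=> mu) _ _ 0 _ _ (clog_cderiv t x0)).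
      by split; exact: is_derive_cst.
    by rewrite mul0r add0r.
  apply: cderiv_eq (cderivM dL dP) _.
  have w0 : (x +i* t) != 0 by rewrite eq_complex /= gt_eqF.
  have := @Lap_rec mu (x +i* t) m0 x0.
  move: (Lap _ _) (Lap _ _) (cexp _) w0 => A B C.
  move: (x +i* t) (0 +i* 1) => W J w0 h.
  have -> : J / W = J / W by [].
  apply: (mulfI w0); rewrite mulr0 mulrDr.
  have -> : W * (- J * B * C) = - J * C * (W * B) by ring.
  by rewrite h; field.
have := cderiv0_cst d0 y 0.
(* On the real axis the base point is a dilation of 1, so [Lap_scale] finishes what constancy along
   the vertical line began. *)
have -> : x +i* 0 = creal (expR (ln x)) * 1.
  by rewrite mulr1 lnK// posrE.
rewrite Lap_scale// => E1.
have ce : clog (creal (expR (ln x)) * 1) = creal (ln x).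
  rewrite mulr1 lnK ?posrE//.
  rewrite [in LHS]crealE clogE// expr0n addr0 mul0r atan0 lnXn//.
  by rewrite -[ln _ *+ 2]mulr_natr mulfK.
move: E1; rewrite ce cexpN mulrAC mulVf ?cexp_neq0// mul1r => <-.
by rewrite cpowE mulNr cexpN mulfK// cexp_neq0.
Qed.

End laplace.

(** * The substitution t = e^u on the half-line *)

Section exponential_substitution.
Variable R : realType.

(** The substitution is made on the compact intervals [e^(-N), e^N], which exhaust the half-line;
    both sides then pass to the limit by monotone convergence. *)
Lemma ge0_integral_exp (g : R -> R) : (forall t, 0 < t -> {for t, continuous g}) ->
  (forall t, 0 <= g t) ->
  (\int[@lebesgue_measure R]_(t in [set t | (0 < t)%R]) (g t)%:E =
   \int[@lebesgue_measure R]_u (g (expR u) * expR u)%:E)%E.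
Proof.
move=> cg g0.
pose F (N : nat) := `[expR (- N%:R) : R, expR N%:R]%classic.
pose G (N : nat) := `[(- N%:R : R), N%:R]%classic.
have ndF : nondecreasing_seq F.
  move=> N M NM; apply/subsetPset; apply: subset_itv; rewrite bnd_simp ler_expR.
    by rewrite lerN2 ler_nat.
  by rewrite ler_nat.
have ndG : nondecreasing_seq G.
  move=> N M NM; apply/subsetPset; apply: subset_itv; rewrite bnd_simp.
    by rewrite lerN2 ler_nat.
  by rewrite ler_nat.
have cgF N : {within F N, continuous g}.
  apply: continuous_in_subspaceT => t; rewrite inE /F /= in_itv /= => /andP[t0 _].
  by apply: cg; rewrite (lt_le_trans _ t0)// expR_gt0.
have mgF N : measurable_fun (F N) (fun t => (g t)%:E).
  apply/measurable_EFinP; apply: subspace_continuous_measurable_fun => //.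
  exact: measurable_itv.
have cge : continuous (fun u => g (expR u) * expR u).
  move=> u; apply: continuousM; last exact: continuous_expR.
  apply: (@continuous_comp _ _ _ (@expR R) g); first exact: continuous_expR.
  by apply: cg; exact: expR_gt0.
have mge : measurable_fun setT (fun u => (g (expR u) * expR u)%:E).
  by apply/measurable_EFinP; exact: continuous_measurable_fun.
have UF : \bigcup_N F N = [set t | 0 < t].
  apply/seteqP; split=> [t [N _]|t /= t0].
    by rewrite /F /= in_itv /= => /andP[+ _]; apply: lt_le_trans; exact: expR_gt0.
  have [N hN] : exists N : nat, `|ln t| <= N%:R.
    by exists (Num.truncn `|ln t|).+1; rewrite ltW// truncnS_gt.
  exists N => //; rewrite /F /= in_itv /= -[t]lnK ?posrE// !ler_expR -ler_norml//.
have UG : \bigcup_N G N = setT.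
  apply/seteqP; split=> // u _.
  have [N hN] : exists N : nat, `|u| <= N%:R.
    by exists (Num.truncn `|u|).+1; rewrite ltW// truncnS_gt.
  by exists N => //; rewrite /G /= in_itv /= -ler_norml.
have limF : (\int[@lebesgue_measure R]_(t in F N) (g t)%:E)%E @[N --> \oo] -->
    (\int[@lebesgue_measure R]_(t in [set t | (0 < t)%R]) (g t)%:E)%E.
  rewrite -UF; apply: ge0_nondecreasing_set_cvg_integral => //.
  - by move=> N; exact: measurable_itv.
  - by move=> N t _; rewrite lee_fin.
have limG : (\int[@lebesgue_measure R]_(u in G N) (g (expR u) * expR u)%:E)%E
    @[N --> \oo] --> (\int[@lebesgue_measure R]_u (g (expR u) * expR u)%:E)%E.
  rewrite -UG; apply: ge0_nondecreasing_set_cvg_integral => //.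
  - by move=> N; exact: measurable_itv.
  - by move=> N; exact: measurable_funTS.
  - by move=> N t _; rewrite lee_fin mulr_ge0 ?expR_ge0.
have FG N : (\int[@lebesgue_measure R]_(t in F N) (g t)%:E =
    \int[@lebesgue_measure R]_(u in G N) (g (expR u) * expR u)%:E)%E.
  have dE : (@expR R)^`() = expR by apply/funext => u; rewrite derive1E derive_val.
  rewrite /F (@integration_by_substitution_increasing R (@expR R) g) ?dE//.
  - by rewrite (@le_trans _ _ 0)// oppr_le0.
  - by move=> x y _ _; rewrite ltr_expR.
  - by move=> x _; exact: continuous_expR.
  - by apply: cvgP; apply: cvg_at_right_filter; exact: continuous_expR.
  - by apply: cvgP; apply: cvg_at_left_filter; exact: continuous_expR.
  - split => //.
    + by apply: cvg_at_right_filter; exact: continuous_expR.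
    + by apply: cvg_at_left_filter; exact: continuous_expR.
  - exact: cgF.
move: limF; under eq_cvg do rewrite FG.
move=> limF; exact: (cvg_unique _ limF limG).
Qed.

Lemma continuous_max0 (g : R -> R) t : {for t, continuous g} ->
  {for t, continuous (fun t => Num.max (g t) 0)}.
Proof.
move=> cg; rewrite (_ : (fun _ => _) = (fun t => (g t + `|g t|) * 2^-1)); last first.
  apply/funext => u; have [g0|g0] := leP (g u) 0.
    by rewrite ler0_norm// subrr mul0r.
  by rewrite gtr0_norm// -mulr2n -[_ *+ 2]mulr_natr mulfK.
apply: continuousM; last exact: cst_continuous.
apply: continuousD => //.
by apply: continuous_comp => //; exact: norm_continuous.
Qed.

(** Positive and negative parts inherit continuity, so each falls under [ge0_integral_exp], and both
    sides recombine them in the same way. *)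
Lemma Rintegral_exp (g : R -> R) : (forall t, 0 < t -> {for t, continuous g}) ->
  (\int[@lebesgue_measure R]_(t in [set t | (0 < t)%R]) g t =
   \int[@lebesgue_measure R]_u (g (expR u) * expR u))%R.
Proof.
move=> cg; rewrite /Rintegral integralE [in RHS]integralE; congr (fine (_ - _)%E).
  transitivity (\int[@lebesgue_measure R]_(t in [set t | (0 < t)%R])
     (Num.max (g t) 0)%:E)%E.
    by apply: eq_integral => t _; rewrite funeposE EFin_max.
  rewrite ge0_integral_exp.
  - apply: eq_integral => u _; rewrite funeposE -EFin_max; congr EFin.
    by rewrite maxr_pMl ?mul0r ?expR_ge0.
  - by move=> t t0; apply: continuous_max0; exact: cg.
  - by move=> t; rewrite le_max lexx orbT.
transitivity (\int[@lebesgue_measure R]_(t in [set t | (0 < t)%R])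
   (Num.max (- g t) 0)%:E)%E.
  by apply: eq_integral => t _; rewrite funenegE EFin_max.
rewrite ge0_integral_exp.
- apply: eq_integral => u _; rewrite funenegE -EFinN -EFin_max; congr EFin.
  by rewrite maxr_pMl ?mul0r ?expR_ge0// mulNr.
- by move=> t t0; apply: continuous_max0; apply: continuousN; exact: cg.
- by move=> t; rewrite le_max lexx orbT.
Qed.
End exponential_substitution.

(** * The real and the complex Gamma function *)

Section gamma.
Variable R : realType.
Implicit Types (z : R[i]) (x y u t : R).

Lemma clog_creal t : 0 < t -> clog (creal t) = creal (ln t).
Proof.
move=> t0; rewrite crealE clogE// expr0n addr0 mul0r atan0 lnXn//.
by rewrite -[ln _ *+ 2]mulr_natr mulfK.
Qed.

Lemma cpow_creal t z : 0 < t -> cpow (creal t) z = cexp (z * creal (ln t)).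
Proof. by move=> t0; rewrite cpowE clog_creal. Qed.

Lemma continuous_exp_cos (a b t : R) (c : R -> R) : continuous c -> 0 < t ->
  {for t, continuous (fun t => expR (a * ln t - t) * c (b * ln t))}.
Proof.
move=> cc t0; have cl := continuous_ln t0.
apply: continuousM.
  apply: continuous_comp; last exact: continuous_expR.
  apply: continuousB; last exact: cvg_id.
  by apply: continuousM => //; exact: cst_continuous.
apply: continuous_comp; last exact: cc.
by apply: continuousM => //; exact: cst_continuous.
Qed.

Lemma rGammaE x : rGamma x = (\int[leb R]_u expR (x * u - expR u))%R.
Proof.
rewrite /rGamma.
(* The factor cos 0 = 1 brings the integrand to the form treated by [continuous_exp_cos]. *)
transitivity (\int[@lebesgue_measure R]_(t in [set t | (0 < t)%R])
   (expR ((x - 1) * ln t - t) * cos (0 * ln t)))%R.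
  apply: eq_Rintegral => t; rewrite inE/= => t0.
  by rewrite mul0r cos0 mulr1 expRD /powR gt_eqF.
rewrite Rintegral_exp; last first.
  by move=> t; apply: continuous_exp_cos; exact: continuous_cos.
apply: eq_Rintegral => u _.
by rewrite expRK mul0r cos0 mulr1 -expRD; congr expR; ring.
Qed.

Lemma cGammaE z : cGamma z = Lap z 1.
Proof.
have cGE t : 0 < t -> cpow (creal t) (z - 1) * creal (expR (- t)) =
    (expR ((Re z - 1) * ln t - t) * cos (Im z * ln t)) +i*
    (expR ((Re z - 1) * ln t - t) * sin (Im z * ln t)).
  move=> t0; rewrite cpow_creal// -cexp_creal -cexpD.
  have -> : (z - 1) * creal (ln t) + creal (- t) =
      ((Re z - 1) * ln t - t) +i* (Im z * ln t).
    apply: complex_ext.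
      by rewrite cReD cReM cReB cRe1 !cRe_creal cIm_creal mulr0 subr0.
    by rewrite cImD cImM cReB cImB cRe1 cIm1 cRe_creal !cIm_creal mulr0 add0r addr0 subr0.
  by apply: complex_ext; rewrite ?cRe_cexp ?cIm_cexp.
rewrite /cGamma /cint1.
apply: complex_ext; rewrite /Lap ?cRe_CI ?cIm_CI.
  transitivity (\int[@lebesgue_measure R]_(t in [set t | (0 < t)%R])
     (expR ((Re z - 1) * ln t - t) * cos (Im z * ln t)))%R.
    by rewrite [LHS]/=; apply: eq_Rintegral => t; rewrite inE/= => t0; rewrite cGE.
  rewrite Rintegral_exp; last first.
    by move=> t; apply: continuous_exp_cos; exact: continuous_cos.
  apply: eq_Rintegral => u _; rewrite /Lapf !cE expRK mulrAC -expRD.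
  by congr (expR _ * cos _); ring.
transitivity (\int[@lebesgue_measure R]_(t in [set t | (0 < t)%R])
   (expR ((Re z - 1) * ln t - t) * sin (Im z * ln t)))%R.
  by rewrite [LHS]/=; apply: eq_Rintegral => t; rewrite inE/= => t0; rewrite cGE.
rewrite Rintegral_exp; last first.
  by move=> t; apply: continuous_exp_cos; exact: continuous_sin.
apply: eq_Rintegral => u _; rewrite /Lapf !cE expRK mulrAC -expRD.
by congr (expR _ * sin _); ring.
Qed.

(** A vanishing integral would force f to vanish almost everywhere, and then the whole line would be
    a null set. *)
Lemma Rintegral_gt0 (f : R -> R) : (leb R).-integrable setT (fun u => (f u)%:E) ->
  (forall u, 0 < f u) -> 0 < (\int[leb R]_u f u)%R.
Proof.
move=> fi f0; rewrite lt_def Rintegral_ge0 ?andbT; last by move=> u _; exact: ltW.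
apply/negP => /eqP fz.
have : (\int[leb R]_u `|(f u)%:E| = 0)%E.
  under eq_integral do rewrite gee0_abs ?lee_fin ?ltW//.
  rewrite -[LHS]fineK; last exact: integrable_fin_num.
  by rewrite -/(Rintegral _ _ _) fz.
move/(ae_eq_integral_abs (leb R) measurableT (measurable_int _ fi)) => [N [mN N0]].
move=> NT; have : (leb R setT <= leb R N)%E.
  apply: le_measure; rewrite ?inE// => u _; apply: NT => /= /(_ I) [] h.
  by have := f0 u; rewrite h ltxx.
have := @lebesgue_measure_itv R `]-oo, +oo[%R; rewrite set_itvNyy /= => lebT.
by rewrite [leb R N]N0 [leb R setT]lebT leNgt ltry.
Qed.

Lemma rGamma_gt0 x : 0 < x -> 0 < rGamma x.
Proof.
move=> x0; rewrite rGammaE; apply: Rintegral_gt0 => [|u]; last exact: expR_gt0.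
have := @integrable_exp_exp R x 1 x0 ltr01.
by apply: eq_rintegrable => u; rewrite mul1r.
Qed.

Lemma integrable_rGamma x : 0 < x ->
  (leb R).-integrable setT (fun u => (expR (x * u - expR u))%:E).
Proof.
move=> x0; have := @integrable_exp_exp R x 1 x0 ltr01.
by apply: eq_rintegrable => u; rewrite mul1r.
Qed.

Lemma Lap_creal x : Lap (creal x) 1 = creal (rGamma x).
Proof.
rewrite rGammaE -CI_creal; apply: eq_CI => u.
by rewrite /Lapf mulr1 -crealM -crealB cexp_creal.
Qed.

Lemma rGammaS x : 0 < x -> rGamma (x + 1) = x * rGamma x.
Proof.
move=> x0; have := @Lap_rec R (creal x) 1 x0 ltr01.
rewrite mul1r -creal1 -crealD creal1 !Lap_creal -crealM.
by move/(congr1 (fun z => Re z)); rewrite !cRe_creal.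
Qed.

Lemma norm_sin_le x : `|sin x| <= `|x|.
Proof.
have key y : 0 < y -> `|sin y| <= y.
  move=> y0; have cs : {within `[0, y], continuous (@sin R)}.
    by apply: continuous_subspaceT; exact: continuous_sin.
  have [c _] := MVT y0 (fun x _ => is_derive_sin x) cs.
  rewrite sin0 !subr0 => ->; rewrite normrM (gtr0_norm y0) -[leRHS]mul1r.
  by apply: ler_wpM2r; [exact: ltW|exact: cos_max].
have [x0|x0|->] := ltgtP x 0; last by rewrite sin0 normr0.
  by rewrite -normrN -sinN (ltr0_norm x0) key// oppr_gt0.
by rewrite (gtr0_norm x0) key.
Qed.

Lemma cos_lower x : 1 - x ^+ 2 / 2 <= cos x.
Proof.
have h : sin (x / 2) ^+ 2 <= (x / 2) ^+ 2.
  rewrite -[leLHS]real_normK ?num_real// -[leRHS]real_normK ?num_real//.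
  by rewrite ler_pXn2r ?nnegrE// norm_sin_le.
have := cos_mulr2n (x / 2); rewrite cos2sin2.
have -> : (x / 2) *+ 2 = x by rewrite -[_ *+ 2]mulr_natr mulfVK.
move=> ->; rewrite [(1 - _) *+ 2]mulr2n; move: h.
have -> : (x / 2) ^+ 2 = x ^+ 2 / 4 by field.
by move: (sin _ ^+ 2) (x ^+ 2) => s q; lra.
Qed.

(** Replaces the quadratic error in [cos_lower] by exponentials, whose integrals against a Gamma
    density are again values of Gamma. *)
Lemma sqr_le_expR x : x ^+ 2 <= 4 * (expR x - 2 + expR (- x)).
Proof.
have key y : 0 <= y -> y ^+ 2 <= 4 * (expR y - 2 + expR (- y)).
  move=> y0.
  have -> : expR y - 2 + expR (- y) = (expR (y / 2) - expR (- (y / 2))) ^+ 2.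
    have E1 : expR y = expR (y / 2) ^+ 2 by rewrite expr2 -expRD; congr expR; lra.
    have E2 : expR (- y) = expR (- (y / 2)) ^+ 2.
      by rewrite expr2 -expRD; congr expR; lra.
    have E3 : expR (y / 2) * expR (- (y / 2)) = 1 by rewrite -expRD subrr expR0.
    by rewrite E1 E2 sqrrB E3; ring.
  have h1 := expR_ge1Dx (y / 2).
  have h2 : expR (- (y / 2)) <= 1 by rewrite expR_le1 oppr_le0 divr_ge0.
  nra.
have [x0|x0] := leP 0 x; first exact: key.
by have := key (- x); rewrite oppr_ge0 sqrrN opprK => /(_ (ltW x0)); lra.
Qed.

(* If Gamma vanished at [z] it would vanish at every [z + k], whereas the Gamma
   distribution of parameter [m = Re z + k] concentrates at [m], so that
   [Re (m^(- i y) Gamma (m + i y))] is close to [Gamma m] for large [m]. *)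
Lemma cGamma_neq0 z : 0 < Re z -> cGamma z != 0.
Proof.
move=> z0; rewrite cGammaE; apply/eqP => L0.
have Lk (k : nat) : Lap (z + creal k%:R) 1 = 0.
  elim: k => [|k IH]; first by rewrite creal0 addr0.
  have := @Lap_rec R (z + creal k%:R) 1; rewrite IH mulr0 mul1r.
  rewrite -addrA -creal1 -crealD natr1 => -> //.
  by rewrite !cE ltr_wpDr.
pose y := Im z.
(* Large enough that m - 1 > 2 y^2, which makes the final lower bound G (1 - 2 y^2/(m - 1))
   positive. *)
pose k := (Num.truncn (2 + 2 * y ^+ 2)).+1.
pose m := Re z + k%:R.
have km : 1 + 2 * y ^+ 2 < m - 1.
  have := truncnS_gt (2 + 2 * y ^+ 2); rewrite -/k /m; lra.
have y2 := sqr_ge0 y.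
have m1 : 0 < m - 1 by lra.
have m0 : 0 < m by lra.
pose l := ln m.
pose G := rGamma m.
have G0 : 0 < G by exact: rGamma_gt0.
have zE : z + creal k%:R = m +i* y.
  by apply: complex_ext; rewrite ?cReD ?cImD ?cRe_creal ?cIm_creal ?addr0.
have Re0 : Re (cexp (creal l * (0 +i* (- y))) * Lap (m +i* y) 1) = 0.
  by rewrite -zE Lk mulr0.
have Li : cintegrable (leb R) (Lapf (m +i* y) 1) by apply: cintegrable_Lapf.
have fE u : Re (cexp (creal l * (0 +i* (- y))) * Lapf (m +i* y) 1 u) =
    expR (m * u - expR u) * cos (y * (u - l)).
  rewrite /Lapf -cexpD cRe_cexp; congr (expR _ * cos _).
    rewrite mulr1 cReD cReB !cReM (cRe_creal l) (cRe_creal u)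
      (cRe_creal (expR u)) (cIm_creal l) (cIm_creal u) /=; ring.
  rewrite mulr1 cImD cImB !cImM (cRe_creal l) (cRe_creal u)
    (cIm_creal (expR u)) (cIm_creal l) (cIm_creal u) /=; ring.
have i1 := integrable_rGamma m0.
have i2 : (leb R).-integrable setT
    (fun u => (expR ((m + 1) * u - expR u))%:E) by apply: integrable_rGamma; lra.
have i3 := integrable_rGamma m1.
(* A minorant of the integrand made of the Gamma integrands of parameters m, m + 1 and m - 1 only,
   so that its integral is explicit. *)
pose g u := (1 + 4 * y ^+ 2) * expR (m * u - expR u) -
   (2 * y ^+ 2 * expR (- l) * expR ((m + 1) * u - expR u) +
    2 * y ^+ 2 * expR l * expR ((m - 1) * u - expR u)).
have gi : (leb R).-integrable setT (fun u => (g u)%:E).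
  by apply: rintegrableB; [|apply: rintegrableD]; exact: rintegrableZ.
have fg u : g u <= expR (m * u - expR u) * cos (y * (u - l)).
  have -> : g u = expR (m * u - expR u) *
      (1 - 2 * y ^+ 2 * (expR (u - l) - 2 + expR (- (u - l)))).
    rewrite /g; have -> : expR ((m + 1) * u - expR u) = expR (m * u - expR u) * expR u.
      by rewrite -expRD; congr expR; ring.
    have -> : expR ((m - 1) * u - expR u) = expR (m * u - expR u) * expR (- u).
      by rewrite -expRD; congr expR; ring.
    by rewrite opprB !expRD; ring.
  rewrite ler_pM2l ?expR_gt0// (le_trans _ (cos_lower _))//.
  have := sqr_le_expR (u - l); rewrite exprMn; move: (expR _ - _ + _) => E h.
  by rewrite lerD2l lerN2; nra.
have : (\int[leb R]_u g u)%R <= 0.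
  rewrite -Re0 /Lap -CIZ// cRe_CI; apply: le_Rintegral => //.
    by have [] := cintegrableZ (cexp (creal l * (0 +i* (- y)))) Li.
  by move=> u _; rewrite fE.
have -> : (\int[leb R]_u g u)%R =
    (1 + 4 * y ^+ 2) * G - (2 * y ^+ 2 * expR (- l) * (m * G) +
    2 * y ^+ 2 * expR l * (G / (m - 1))).
  rewrite /g RintegralB//; [|exact: rintegrableZ|
    by apply: rintegrableD; exact: rintegrableZ].
  rewrite RintegralD//; [|exact: rintegrableZ|exact: rintegrableZ].
  rewrite !RintegralZl// -!rGammaE -/G rGammaS// -/G.
  have -> : rGamma (m - 1) = G / (m - 1).
    have := rGammaS m1; rewrite subrK -/G => ->.
    by rewrite mulrAC mulfV ?mul1r// gt_eqF.
  by [].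
rewrite expRN /l lnK ?posrE//.
have -> : (1 + 4 * y ^+ 2) * G - (2 * y ^+ 2 * m^-1 * (m * G) +
    2 * y ^+ 2 * m * (G / (m - 1))) = G * (1 - 2 * y ^+ 2 / (m - 1)).
  by field; rewrite !gt_eqF.
rewrite pmulr_rle0// subr_le0 ler_pdivlMr// mul1r; lra.
Qed.

End gamma.

(** * The Poisson kernel *)

Section fubini_slices.
Context d1 d2 (T1 : measurableType d1) (T2 : measurableType d2) (R : realType)
  (m1 : {sigma_finite_measure set T1 -> \bar R})
  (m2 : {sigma_finite_measure set T2 -> \bar R}).

Lemma integrable_fine d (T : measurableType d) (M : {measure set T -> \bar R})
  (G : T -> \bar R) : M.-integrable setT G -> M.-integrable setT (fun y => (fine (G y))%:E).
Proof.
move=> /integrableP[mG Goo]; apply/integrableP; split.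
  by apply/measurable_EFinP; apply: measurableT_comp.
apply: le_lt_trans Goo; apply: ge0_le_integral => //.
- by apply: measurableT_comp => //; apply/measurable_EFinP; apply: measurableT_comp.
- exact: measurableT_comp.
- by move=> y _; case: (G y) => [r| |] /=; rewrite ?leey.
Qed.

Lemma cintegrable_CI_fst (f : T1 * T2 -> R[i]) : cintegrable (prodm m1 m2) f ->
  cintegrable m2 (fun y => CI m1 (fun x => f (x, y))).
Proof.
have key (g : T1 * T2 -> R) :
    (prodm m1 m2).-integrable setT (fun z => (g z)%:E) ->
    m2.-integrable setT (fun y => (\int[m1]_x g (x, y))%R%:E).
  move=> gi; apply: integrable_fine.
  apply/integrableP; split; first exact: (measurable_fubini_G gi).
  have /integrableP[mg _] := gi.
  apply: le_lt_trans ((integrable21ltyP _ _ mg).1 gi).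
  apply: ge0_le_integral => //.
  - by apply: measurableT_comp => //; exact: (measurable_fubini_G gi).
  - apply: (measurable_fun_fubini_tonelli_G (fun z => `|(g z)%:E|%E)) => //.
    exact: measurableT_comp.
  - move=> y _; apply: le_abse_integral => //.
    exact: (measurableT_comp mg (measurable_pair2 y)).
by move=> [f1 f2]; split; [exact: key f1|exact: key f2].
Qed.

Lemma cintegrable_CI_snd (f : T1 * T2 -> R[i]) : cintegrable (prodm m1 m2) f ->
  cintegrable m1 (fun x => CI m2 (fun y => f (x, y))).
Proof.
move=> [f1 f2]; split.
  exact: integrable_fine (integrable_fubini_F f1).
exact: integrable_fine (integrable_fubini_F f2).
Qed.

End fubini_slices.

Section kernel.
Variables (R : realType) (m : nat).
Implicit Types (lam : R[i]) (a u : R) (x y v xi : tup R m).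

Local Notation half := (m.+1%:R / 2 : R).

(* The Fourier transform of the Poisson kernel up to constants, as an integral
   over [t = e^u]; [r2] stands for [|xi|^2]. *)
Definition Qker lam a (r2 : R) : R[i] := CI (leb R)
  (fun u => cexp (lam * creal u -
    creal (expR u * a ^+ 2 + expR (- u) * r2 / 4))).

(** Continuing a Fourier integral from x to x + i y multiplies the transform by e^(-y.xi); no other
    factor depends on y. *)
Definition hker lam a y xi : R[i] :=
  creal (expR (- dotp y xi)) * Qker lam a (dotp xi xi).

(** Joint integrand in (u, xi). Integrated over u it gives [hker] times a phase; integrated over xi,
    a Gaussian integral, it gives the Laplace integrand at [wker]. Fubini between the two is
    [CI_hker]. *)
Definition Jker lam a y v (z : measurableTypeR R * tup R m) : R[i] :=
  cexp (lam * creal z.1 -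
    creal (expR z.1 * a ^+ 2 + expR (- z.1 : R) * dotp z.2 z.2 / 4) +
    ((- dotp y z.2) +i* dotp v z.2)).

(* [a^2 + (v + i y)^2] *)
Definition wker a y v : R[i] :=
  (a ^+ 2 + dotp v v - dotp y y) +i* (2 * dotp v y).

Definition cphase (t : R) : R[i] := cexp (0 +i* t).

Lemma cphaseD (s t : R) : cphase (s + t) = cphase s * cphase t.
Proof. by rewrite /cphase -cexpD; congr cexp; apply: complex_ext; rewrite ?cReD ?cImD /= ?addr0. Qed.
Lemma cabs_cphase (t : R) : cabs (cphase t) = 1.
Proof. by rewrite cabs_cexp expR0. Qed.
Lemma conjc_cphase (t : R) : conjc (cphase t) = cphase (- t).
Proof.
rewrite /cphase conjc_cexp; congr cexp; apply: complex_ext; rewrite ?cReJ ?cImJ //=.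
Qed.
Lemma cmeas_cphase d (T : measurableType d) (g : T -> R) : measurable_fun setT g ->
  cmeas (fun t => cphase (g t)).
Proof. by move=> mg; apply: cmeas_cexp; apply: cmeas_pair. Qed.

Lemma dotp_vaff2 (b w : tup R m) (r : R) : dotp (vaff b r w) (vaff b r w) =
  dotp b b + 2 * r * dotp b w + r ^+ 2 * dotp w w.
Proof.
rewrite dotp_vaff (dotpC b) (dotpC w (vaff _ _ _)) !dotp_vaff (dotpC w b); ring.
Qed.

(** This is |xi + 2 e^u y|^2 >= 0. The Gaussian in xi absorbs e^(-y.xi) at the price of e^u |y|^2,
    which the decay e^(-a^2 e^u) can pay exactly when |y| < a. *)
Lemma complete_square_le y xi u :
  - (expR (- u) * dotp xi xi / 4) - dotp y xi <= expR u * dotp y y.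
Proof.
have := dotp_ge0 (vaff xi (2 * expR u) y); rewrite dotp_vaff2 (dotpC xi y).
have E : expR (- u) * expR u = 1 by rewrite -expRD addrC subrr expR0.
have p := expR_gt0 (- u).
move=> h; rewrite -subr_ge0.
have -> : expR u * dotp y y - (- (expR (- u) * dotp xi xi / 4) - dotp y xi) =
  expR (- u) / 4 * (dotp xi xi + 2 * (2 * expR u) * dotp y xi +
     (2 * expR u) ^+ 2 * dotp y y).
  transitivity ((expR (- u) * expR u) * (expR u * dotp y y) +
      expR (- u) * dotp xi xi / 4 + (expR (- u) * expR u) * dotp y xi).
    by rewrite E; ring.
  by field.
by rewrite mulr_ge0// divr_ge0// ltW.
Qed.

Lemma cmeas_Jker lam a y v : cmeas (Jker lam a y v).
Proof.
have m1 : measurable_fun setT (fun z : measurableTypeR R * tup R m => z.1 : R).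
  exact: measurable_fst.
have m2 : measurable_fun setT (fun z : measurableTypeR R * tup R m => z.2).
  exact: measurable_snd.
apply: cmeas_cexp; apply: cmeasD; first apply: cmeasB.
- by apply: cmeasM; [exact: cmeas_cst|exact: cmeas_creal].
- apply: cmeas_creal; apply: measurable_funD; first apply: measurable_funM => //.
    exact: measurable_expR_comp.
  do 2 apply: measurable_funM => //.
    by apply: measurable_expR_comp; exact: measurable_funN.
  exact: measurable_dotp.
- apply: cmeas_pair; last exact: measurable_dotp.
  by apply: measurable_funN; exact: measurable_dotp.
Qed.

Lemma cabs_Jker lam a y v u xi : cabs (Jker lam a y v (u, xi)) =
  expR (Re lam * u - expR u * a ^+ 2) *
  expR (- (expR (- u) / 4 * dotp xi xi) + dotp (vscale (-1) y) xi).
Proof.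
rewrite /Jker cabs_cexp -expRD vscale_vaff dotp_vaff dotp0; congr expR.
rewrite cReD cReB cReM /= (cRe_creal u) (cIm_creal u) cRe_creal; ring.
Qed.

Lemma cabs_Jker_le lam a y v u xi : cabs (Jker lam a y v (u, xi)) <=
  expR (Re lam * u - (a ^+ 2 - dotp y y) * expR u).
Proof.
rewrite cabs_Jker -expRD ler_expR vscale_vaff dotp_vaff dotp0.
by have := complete_square_le y xi u; lra.
Qed.

(** The Gaussian integral over R^n contributes e^(n u/2): this is how the exponent lam turns into
    lam + n/2. *)
Lemma sqrt4pi u : Num.sqrt (pi / (expR (- u) / 4)) ^+ m.+1 =
  Num.sqrt (4 * pi) ^+ m.+1 * expR (half * u).
Proof.
have -> : pi / (expR (- u) / 4) = 4 * pi * (expR (u / 2)) ^+ 2.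
  rewrite expRN -expRM_natl mulrC; have -> : 2%:R * (u / 2) = u by field.
  by field; rewrite gt_eqF ?expR_gt0.
rewrite sqrtrM ?mulr_ge0 ?pi_ge0// sqrtr_sqr ger0_norm ?expR_ge0//.
by rewrite exprMn -expRM_natl; congr (_ * expR _); field.
Qed.

Section fixed.
Variables (lam : R[i]) (a : R) (y : tup R m).
Hypothesis lam0 : 0 < Re lam.
Hypothesis ya : dotp y y < a ^+ 2.

Let delta := a ^+ 2 - dotp y y.
Let delta0 : 0 < delta. Proof. by rewrite subr_gt0. Qed.

Lemma cintegrable_Jker v : cintegrable (prodm (leb R) (mu R m)) (Jker lam a y v).
Proof.
apply: cintegrable_prodm1; first exact: cmeas_Jker.
under eq_integral => u _.
  under eq_integral => xi _ do rewrite cabs_Jker EFinM.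
  rewrite ge0_integralZl_EFin//; last first.
    apply/measurable_EFinP; apply: measurable_expR_comp.
    apply: measurable_funD; last exact: measurable_dotp.
    by apply: measurable_funN; apply: measurable_funM => //; exact: measurable_dotp.
  rewrite ge0_gauss_space ?divr_gt0 ?expR_gt0// -EFinM sqrt4pi.
  rewrite (_ : expR (Re lam * u - _) * _ = Num.sqrt (4 * pi) ^+ m.+1 *
     expR ((Re lam + half) * u - delta * expR u)); last first.
    have -> : dotp (vscale (-1) y) (vscale (-1) y) / (4 * (expR (- u) / 4)) =
        expR u * dotp y y.
      rewrite vscale_vaff dotp_vaff2 !dotp0 expRN; field.
      by rewrite gt_eqF ?expR_gt0.
    rewrite mulrCA -!mulrA; congr (_ * _); rewrite -!expRD; congr expR.
    by rewrite /delta; ring.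
  over.
have li : (leb R).-integrable setT (fun u =>
    (Num.sqrt (4 * pi) ^+ m.+1 * expR ((Re lam + half) * u - delta * expR u))%:E).
  apply: rintegrableZ; apply: integrable_exp_exp => //.
  by rewrite ltr_wpDr// divr_ge0.
exact: (integrable_lty measurableT li).
Qed.

Lemma JkerE v u xi : Jker lam a y v (u, xi) =
  cphase (dotp v xi) * (creal (expR (- dotp y xi)) *
   cexp (lam * creal u - creal (expR u * a ^+ 2 + expR (- u) * dotp xi xi / 4))).
Proof.
rewrite /Jker /cphase -cexp_creal -!cexpD; congr cexp.
rewrite addrCA [in RHS]addrA addrC; congr (_ + _).
apply: complex_ext; rewrite ?cReD ?cImD (cRe_creal, cIm_creal)/=; ring.
Qed.

Lemma cintegrable_Jker1 v xi : cintegrable (leb R) (fun u => Jker lam a y v (u, xi)).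
Proof.
apply: (@cintegrable_le _ (measurableTypeR R) R (leb R) _
   (fun u => expR (Re lam * u - delta * expR u))).
- exact: (cmeas_comp (cmeas_Jker lam a y v) (measurable_pair2 xi)).
- by move=> u; exact: cabs_Jker_le.
- exact: integrable_exp_exp.
Qed.

Lemma CI_Jker v xi : CI (leb R) (fun u => Jker lam a y v (u, xi)) =
  cphase (dotp v xi) * hker lam a y xi.
Proof.
rewrite /hker /Qker mulrA -CIZ.
  by apply: eq_CI => u; rewrite JkerE mulrA.
have := cintegrable_Jker1 (v0 R m) xi.
move/(cintegrableZ (creal (expR (dotp y xi)))).
congr cintegrable; apply/funext => u; rewrite JkerE dotp0.
by rewrite /cphase cexp0 mul1r mulrA -crealM -expRD subrr expR0 creal1 mul1r.
Qed.

Lemma hkerE xi : hker lam a y xi = CI (leb R) (fun u => Jker lam a y (v0 R m) (u, xi)).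
Proof. by rewrite CI_Jker dotp0 /cphase cexp0 mul1r. Qed.

Lemma cintegrable_hker v : cintegrable (mu R m) (fun xi => cphase (dotp v xi) * hker lam a y xi).
Proof.
have := cintegrable_CI_fst (cintegrable_Jker v).
by congr cintegrable; apply/funext => xi; rewrite CI_Jker.
Qed.

Definition hbound : R := (\int[leb R]_u expR (Re lam * u - delta * expR u))%R.

Lemma cabs_hker xi : cabs (hker lam a y xi) <= hbound.
Proof.
rewrite hkerE; apply: le_trans (cabs_CI_le (cintegrable_Jker1 _ _)) _.
apply: le_Rintegral => //.
- exact: cintegrable_cabs (cintegrable_Jker1 _ _).
- exact: integrable_exp_exp.
- by move=> u _; exact: cabs_Jker_le.
Qed.

(** Sequential continuity along a line is the regularity that [plancherel] consumes. It follows by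
    dominated convergence in u, with a majorant that does not involve xi. *)
Lemma hker_line xi v (r : nat -> R) : r @ \oo --> 0 ->
  (fun k => Re (hker lam a y (vaff xi (r k) v))) @ \oo --> Re (hker lam a y xi) /\
  (fun k => Im (hker lam a y (vaff xi (r k) v))) @ \oo --> Im (hker lam a y xi).
Proof.
move=> r0.
pose C u := cexp (lam * creal u - creal (expR u * a ^+ 2)).
have JE u eta : Jker lam a y (v0 R m) (u, eta) =
    creal (expR (- (expR (- u) / 4 * dotp eta eta) - dotp y eta)) * C u.
  rewrite /Jker /C -cexp_creal -cexpD dotp0; congr cexp.
  have -> : expR (- u) / 4 * dotp eta eta = expR (- u) * dotp eta eta / 4 by ring.
  by rewrite -crealE [creal (_ + _ / 4)]crealD [creal (- _ - _)]crealB !crealN; ring.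
have cE u : (fun k => expR (- (expR (- u) / 4 * dotp (vaff xi (r k) v) (vaff xi (r k) v))
      - dotp y (vaff xi (r k) v))) @ \oo -->
    expR (- (expR (- u) / 4 * dotp xi xi) - dotp y xi).
  suff h : (fun k => - (expR (- u) / 4 *
      dotp (vaff xi (r k) v) (vaff xi (r k) v)) - dotp y (vaff xi (r k) v)) @ \oo -->
      (- (expR (- u) / 4 * dotp xi xi) - dotp y xi).
    have := @continuous_cvg _ _ _ \oo _ _ (@expR R) _ (@continuous_expR R _) h.
    exact.
  rewrite (_ : (fun k => _) = (fun k => (- (expR (- u) / 4 * dotp xi xi) - dotp y xi) +
     (r k * - (expR (- u) / 4 * (2 * dotp xi v) + dotp v y) +
      r k * r k * - (expR (- u) / 4 * dotp v v)))); last first.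
    by apply/funext => k; rewrite dotp_vaff2 (dotpC y) dotp_vaff (dotpC xi y); ring.
  rewrite -[X in _ --> X]addr0; apply: cvgD; first exact: cvg_cst.
  rewrite -[X in _ --> X]addr0; apply: cvgD.
    by rewrite -[X in _ --> X](mul0r (- (expR (- u) / 4 * (2 * dotp xi v) + dotp v y)));
      apply: cvgM => //; exact: cvg_cst.
  rewrite -[X in _ --> X](mul0r (- (expR (- u) / 4 * dotp v v))); apply: cvgM.
    by rewrite -[X in _ --> X](mul0r 0); apply: cvgM.
  exact: cvg_cst.
rewrite (funext (fun k => congr1 (fun z => Re z) (hkerE (vaff xi (r k) v)))).
rewrite (funext (fun k => congr1 (fun z => Im z) (hkerE (vaff xi (r k) v)))) hkerE.
apply: (@CI_dominated _ (measurableTypeR R) R (leb R) _ _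
   (fun u => expR (Re lam * u - delta * expR u))).
- by move=> k; exact: cintegrable_meas (cintegrable_Jker1 _ _).
- exact: cintegrable_meas (cintegrable_Jker1 _ _).
- move=> u; rewrite JE (funext (fun k => congr1 (fun z => Re z) (JE u (vaff xi (r k) v)))).
  rewrite cReM (cRe_creal (expR _)) (cIm_creal (expR _)) mul0r subr0.
  rewrite (_ : (fun k => _) = (fun k => expR (- (expR (- u) / 4 * dotp (vaff xi (r k) v) (vaff xi (r k) v))
      - dotp y (vaff xi (r k) v)) * Re (C u))); last first.
    by apply/funext => k; rewrite cReM (cRe_creal (expR _)) (cIm_creal (expR _)) mul0r subr0.
  by apply: cvgM; [exact: cE|exact: cvg_cst].
- move=> u; rewrite JE (funext (fun k => congr1 (fun z => Im z) (JE u (vaff xi (r k) v)))).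
  rewrite cImM (cRe_creal (expR _)) (cIm_creal (expR _)) mul0r addr0.
  rewrite (_ : (fun k => _) = (fun k => expR (- (expR (- u) / 4 * dotp (vaff xi (r k) v) (vaff xi (r k) v))
      - dotp y (vaff xi (r k) v)) * Im (C u))); last first.
    by apply/funext => k; rewrite cImM (cRe_creal (expR _)) (cIm_creal (expR _)) mul0r addr0.
  by apply: cvgM; [exact: cE|exact: cvg_cst].
- exact: integrable_exp_exp.
- by move=> k u; exact: cabs_Jker_le.
Qed.

Lemma Re_wker v : Re (wker a y v) = delta + dotp v v.
Proof. by rewrite /wker/= /delta addrAC. Qed.

Lemma CI_hker v : CI (mu R m) (fun xi => cphase (dotp v xi) * hker lam a y xi) =
  creal (Num.sqrt (4 * pi) ^+ m.+1) * Lap (lam + creal half) (wker a y v).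
Proof.
transitivity (CI (leb R) (fun u => CI (mu R m) (fun xi => Jker lam a y v (u, xi)))).
  rewrite -(CI_prodm1 (cintegrable_Jker v)) (CI_prodm2 (cintegrable_Jker v)).
  by apply: eq_CI => xi; rewrite CI_Jker.
have w0 : 0 < Re (wker a y v) by rewrite Re_wker ltr_pwDl ?dotp_ge0.
have l0 : 0 < Re (lam + creal half) by rewrite !cE ltr_wpDr// divr_ge0.
rewrite /Lap -CIZ; last exact: cintegrable_Lapf.
apply: eq_CI => u.
have t0 : 0 < expR (- u) / 4 by rewrite divr_gt0 ?expR_gt0.
have [gi gE] := gauss_space (vscale (-1) y) v t0.
pose c := cexp (lam * creal u - creal (expR u * a ^+ 2)).
transitivity (c * CI (mu R m) (fun xi => cexp ((- (expR (- u) / 4 * dotp xi xi) +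
     dotp (vscale (-1) y) xi) +i* dotp v xi))).
  rewrite -CIZ//; apply: eq_CI => xi; rewrite /Jker /c -cexpD; congr cexp.
  rewrite crealD opprD -!addrA; do 2 congr (_ + _).
  rewrite vscale_vaff dotp_vaff dotp0.
  apply: complex_ext; rewrite ?cReD ?cImD ?cReN ?cImN (cRe_creal, cIm_creal)/=; ring.
(* With t = e^(-u)/4 the Gaussian exponent is e^u (|y|^2 - |v|^2 - 2i v.y); together with -e^u a^2
   it is -e^u times [wker]. *)
rewrite gE sqrt4pi crealM mulrCA -!mulrA; congr (_ * _).
rewrite -cexp_creal /c -!cexpD; congr cexp.
have -> : 4 * (expR (- u) / 4) = expR (- u) by field.
rewrite expRN invrK vscale_vaff dotp_vaff2 dotp_vaff !dotp0 (dotpC y v).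
pose J := (0 +i* (2 * dotp v y)) : R[i].
have -> : wker a y v = creal (a ^+ 2 + dotp v v - dotp y y) + J.
  by apply: complex_ext; rewrite ?cReD ?cImD (cRe_creal (_ - _), cIm_creal (_ - _)) /= ?addr0 ?add0r.
set Z := (X in creal _ + (_ + X) = _).
have -> : Z = creal (expR u * (dotp y y - dotp v v)) - creal (expR u) * J.
  apply: complex_ext; [rewrite cReB cReM (cRe_creal (_ * _))|
    rewrite cImB cImM (cIm_creal (_ * _))];
  rewrite (cRe_creal (expR u)) (cIm_creal (expR u)) /=; ring.
rewrite !(crealM, crealD, crealN); ring.
Qed.

(* By [Lap_pow], this is Gamma(mu) (a^2 + (v + i y)^2)^(-mu) with mu = lam + n/2. *)
Definition qker v : R[i] := Lap (lam + creal half) (wker a y v).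

Lemma Re_shift : Re (lam + creal half) = Re lam + half.
Proof. by rewrite cReD cRe_creal. Qed.

Definition qbound : R := (\int[leb R]_u expR ((Re lam + half) * u - delta * expR u))%R.

Lemma half_ge0 : 0 <= half. Proof. by rewrite divr_ge0. Qed.

Lemma Re_shift_gt0 : 0 < Re (lam + creal half).
Proof. by rewrite Re_shift ltr_wpDr// half_ge0. Qed.

Lemma Re_wker_gt0 v : 0 < Re (wker a y v).
Proof. by rewrite Re_wker ltr_pwDl ?dotp_ge0. Qed.

Lemma cabs_qker v : cabs (qker v) <= qbound.
Proof.
have Li := cintegrable_Lapf Re_shift_gt0 (Re_wker_gt0 v).
apply: le_trans (cabs_CI_le Li) _; apply: le_Rintegral => //.
- exact: cintegrable_cabs Li.
- by rewrite -Re_shift; apply: integrable_exp_exp => //; exact: Re_shift_gt0.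
- move=> u _; rewrite cabs_Lapf Re_shift Re_wker ler_expR lerB//.
  by rewrite ler_pM2r ?expR_gt0// lerDl dotp_ge0.
Qed.

Lemma cmeas_wker d (T : measurableType d) (g : T -> tup R m) : measurable_fun setT g ->
  cmeas (fun t => wker a y (g t)).
Proof.
move=> mg; apply: cmeas_pair.
  apply: measurable_funB => //; apply: measurable_funD => //.
  exact: measurable_dotp.
by apply: measurable_funM => //; exact: measurable_dotp.
Qed.

(** Integrating out v yields e^(-n u/2), which cancels the n/2 in the exponent; the remaining
    integral in u converges because Re lam > 0. *)
Lemma cintegrable_qker : cintegrable (mu R m) qker.
Proof.
pose f (z : measurableTypeR R * tup R m) :=
  Lapf (lam + creal half) (wker a y z.2) z.1.
have mf : cmeas f.
  by apply: cmeas_Lapf; [apply: cmeas_wker; exact: measurable_snd|exact: measurable_fst].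
suff fi : cintegrable (prodm (leb R) (mu R m)) f by exact: (cintegrable_CI_fst fi).
apply: cintegrable_prodm1 => //.
under eq_integral => u _.
  under eq_integral => v _.
    rewrite /f cabs_Lapf Re_shift Re_wker.
    rewrite (_ : _ - _ = ((Re lam + half) * u - delta * expR u) +
      (- (expR u * dotp v v) + dotp (v0 R m) v)); last first.
      by rewrite dotp0 /=; ring.
    rewrite expRD EFinM.
    over.
  rewrite ge0_integralZl_EFin//; last first.
    apply/measurable_EFinP; apply: measurable_expR_comp.
    apply: measurable_funD; last exact: measurable_dotp.
    by apply: measurable_funN; apply: measurable_funM => //; exact: measurable_dotp.
  rewrite ge0_gauss_space ?expR_gt0// -EFinM dotp0 mul0r expR0 mulr1.
  have -> : Num.sqrt (pi / expR u) ^+ m.+1 = Num.sqrt pi ^+ m.+1 * expR (- (half * u)).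
    rewrite -expRN sqrtrM ?pi_ge0// exprMn; congr (_ * _).
    have -> : expR (- u) = expR (- (u / 2)) ^+ 2.
      by rewrite -expRM_natl; congr expR; field.
    by rewrite sqrtr_sqr ger0_norm ?expR_ge0// -expRM_natl; congr expR; field.
  rewrite mulrCA -expRD.
  have -> : (Re lam + half) * u - delta * expR u - half * u = Re lam * u - delta * expR u.
    by ring.
  over.
apply: (integrable_lty measurableT); apply: rintegrableZ.
exact: integrable_exp_exp.
Qed.

Lemma CI_hker_qker v : CI (mu R m) (fun xi => cphase (dotp v xi) * hker lam a y xi) =
  creal (Num.sqrt (4 * pi) ^+ m.+1) * qker v.
Proof. exact: CI_hker. Qed.

End fixed.
End kernel.

(** * Plancherel *)

Section complex_limits.
Variable R : realType.

Definition ccvg (u : nat -> R[i]) (l : R[i]) : Prop :=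
  ((fun k => Re (u k)) @ \oo --> Re l) /\ ((fun k => Im (u k)) @ \oo --> Im l).

Lemma ccvg_cst (l : R[i]) : ccvg (fun=> l) l.
Proof. by split; exact: cvg_cst. Qed.

Lemma ccvgM (u v : nat -> R[i]) (k l : R[i]) : ccvg u k -> ccvg v l ->
  ccvg (fun n => u n * v n) (k * l).
Proof.
move=> [u1 u2] [v1 v2]; split.
  rewrite cReM (_ : (fun n => _) =
    (fun n => Re (u n) * Re (v n) - Im (u n) * Im (v n))).
    by apply: cvgB; apply: cvgM.
  by apply/funext => n; rewrite cReM.
rewrite cImM (_ : (fun n => _) =
  (fun n => Re (u n) * Im (v n) + Im (u n) * Re (v n))).
  by apply: cvgD; apply: cvgM.
by apply/funext => n; rewrite cImM.
Qed.

Lemma ccvg_dominated d (T : measurableType d) (M : {measure set T -> \bar R})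
  (F : nat -> T -> R[i]) f (s : T -> R) :
  (forall k, cmeas (F k)) -> cmeas f ->
  (forall x, ccvg (fun k => F k x) (f x)) ->
  M.-integrable setT (fun x => (s x)%:E) ->
  (forall k x, cabs (F k x) <= s x) ->
  ccvg (fun k => CI M (F k)) (CI M f).
Proof.
move=> mF mf cF si Fs; apply: (CI_dominated mF mf _ _ si Fs) => x.
  by have [] := cF x.
by have [] := cF x.
Qed.
End complex_limits.

Section plancherel.
Variables (R : realType) (m : nat).
Implicit Types (x xi eta v : tup R m) (F : tup R m -> R[i]).
Local Notation mu := (mu R m).

(** No power of 2 pi is included, which is why (2 pi)^n appears in [plancherel]. *)
Definition ifourier F x : R[i] := CI mu (fun xi => cphase (dotp x xi) * F xi).

Lemma cintegrable_phase F x : cintegrable mu F ->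
  cintegrable mu (fun xi => cphase (dotp x xi) * F xi).
Proof.
move=> Fi; apply: (cintegrable_le (s := fun xi => cabs (F xi))).
- apply: cmeasM; last exact: cintegrable_meas Fi.
  by apply: cmeas_cphase; exact: measurable_dotp.
- by move=> xi; rewrite cabsM cabs_cphase mul1r.
- exact: cintegrable_cabs.
Qed.

Lemma cabs_ifourier F x : cintegrable mu F ->
  cabs (ifourier F x) <= (\int[mu]_xi cabs (F xi))%R.
Proof.
move=> Fi; apply: le_trans (cabs_CI_le (cintegrable_phase x Fi)) _.
rewrite le_eqVlt; apply/orP; left; apply/eqP; apply: eq_Rintegral => xi _.
by rewrite cabsM cabs_cphase mul1r.
Qed.

Lemma cmeas_ifourier F : cmeas F -> cmeas (ifourier F).
Proof.
move=> mF; apply: (@cmeas_CI1 _ _ (tup R m) (tup R m) R mu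
  (fun x xi => cphase (dotp x xi) * F xi)).
apply: cmeasM; last exact: (cmeas_comp mF measurable_snd).
by apply: cmeas_cphase; apply: measurable_dotp;
  [exact: measurable_fst|exact: measurable_snd].
Qed.

Definition gaussr (e : R) x : R := expR (- (e * dotp x x)).

Lemma measurable_gaussr e d (T : measurableType d) (g : T -> tup R m) :
  measurable_fun setT g -> measurable_fun setT (fun t => gaussr e (g t)).
Proof.
move=> mg; apply: measurable_expR_comp; apply: measurable_funN.
by apply: measurable_funM => //; exact: measurable_dotp.
Qed.

Lemma integrable_gaussr e : 0 < e -> mu.-integrable setT (fun x => (gaussr e x)%:E).
Proof.
move=> e0; have := integrable_gauss_space (v0 R m) e0.
by apply: eq_rintegrable => x; rewrite dotp0 addr0.
Qed.

Lemma Rintegral_gaussr e : 0 < e ->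
  (\int[mu]_x gaussr e x)%R = Num.sqrt (pi / e) ^+ m.+1.
Proof.
move=> e0; have := ge0_gauss_space (v0 R m) e0.
rewrite dotp0 mul0r expR0 mulr1 /Rintegral => E.
rewrite -[RHS]/(fine (_ %:E)) -E; congr fine.
by apply: eq_integral => x _; rewrite dotp0 addr0.
Qed.

Lemma CI_gauss_phase e zeta : 0 < e ->
  CI mu (fun x => creal (gaussr e x) * cphase (dotp zeta x)) =
  creal (Num.sqrt (pi / e) ^+ m.+1 * expR (- (dotp zeta zeta / (4 * e)))).
Proof.
move=> e0; have [_] := gauss_space (v0 R m) zeta e0.
rewrite !dotp0 sub0r mulr0 mul0r => E.
transitivity (CI mu (fun x => cexp ((- (e * dotp x x) + dotp (v0 R m) x) +i* dotp zeta x))).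
  apply: eq_CI => x; rewrite /cphase /gaussr -cexp_creal -cexpD dotp0 addr0.
  by congr cexp; apply: complex_ext; rewrite ?cReD ?cImD (cRe_creal, cIm_creal) /= ?addr0 ?add0r.
by rewrite E -mulNr -crealE cexp_creal -crealM.
Qed.

Section regularized.
Variables (F : tup R m -> R[i]) (B : R).
Hypothesis Fi : cintegrable mu F.
Hypothesis FB : forall xi, cabs (F xi) <= B.
Hypothesis Fc : forall xi v (r : nat -> R), r @ \oo --> 0 ->
  ccvg (fun k => F (vaff xi (r k) v)) (F xi).

Let mF : cmeas F. Proof. exact: cintegrable_meas Fi. Qed.
Let N := (\int[mu]_xi cabs (F xi))%R.

Lemma regularized_integrable e : 0 < e ->
  mu.-integrable setT (fun x => (cabs (ifourier F x) ^+ 2 * gaussr e x)%:E).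
Proof.
move=> e0; apply: (integrable_le (s := fun x => N ^+ 2 * gaussr e x)).
- apply: measurable_funM; last exact: measurable_gaussr.
  by apply: measurable_funX; apply: measurable_cabs; exact: cmeas_ifourier.
- move=> x; rewrite ger0_norm; last by apply: mulr_ge0; [exact: sqr_ge0|exact: expR_ge0].
  apply: ler_wpM2r; first exact: expR_ge0.
  by rewrite !expr2; apply: ler_pM; rewrite ?cabs_ge0// cabs_ifourier.
- exact: (rintegrableZ (N ^+ 2) (integrable_gaussr e0)).
Qed.

(** Up to a constant, the convolution of F with a Gaussian of width r, written in the rescaled
    variable so that r sits only in the argument of F. *)
Definition Dreg (r : R) eta : R[i] :=
  CI mu (fun v => F (vaff eta r v) * creal (gaussr 1 v)).

Lemma cmeas_Dreg_in r : cmeas (fun z : tup R m * tup R m =>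
  F (vaff z.1 r z.2) * creal (gaussr 1 z.2)).
Proof.
apply: cmeasM.
  apply: (cmeas_comp mF); apply: measurable_vaff => //; exact: measurable_fst.
by apply: cmeas_creal; apply: measurable_gaussr; exact: measurable_snd.
Qed.

Lemma cabs_Dreg_in r eta v :
  cabs (F (vaff eta r v) * creal (gaussr 1 v)) <= B * gaussr 1 v.
Proof.
rewrite cabsM cabs_creal ger0_norm ?expR_ge0//.
by rewrite ler_wpM2r ?expR_ge0.
Qed.

Lemma integrable_Dreg_bound : mu.-integrable setT (fun v => (B * gaussr 1 v)%:E).
Proof. exact: rintegrableZ (integrable_gaussr ltr01). Qed.

Lemma cintegrable_Dreg_in r eta :
  cintegrable mu (fun v => F (vaff eta r v) * creal (gaussr 1 v)).
Proof.
apply: (cintegrable_le _ (cabs_Dreg_in r eta) integrable_Dreg_bound).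
exact: (cmeas_comp (cmeas_Dreg_in r) (measurable_pair1 eta)).
Qed.

Lemma cabs_Dreg r eta : cabs (Dreg r eta) <= B * Num.sqrt pi ^+ m.+1.
Proof.
apply: le_trans (cabs_CI_le (cintegrable_Dreg_in r eta)) _.
have <- : (\int[mu]_v (B * gaussr 1 v))%R = B * Num.sqrt pi ^+ m.+1.
  by rewrite RintegralZl ?Rintegral_gaussr ?divr1//; exact: integrable_gaussr.
apply: le_Rintegral => //.
- exact: cintegrable_cabs (cintegrable_Dreg_in r eta).
- exact: integrable_Dreg_bound.
- by move=> v _; exact: cabs_Dreg_in.
Qed.

Lemma cmeas_Dreg r : cmeas (Dreg r).
Proof.
exact: (@cmeas_CI1 _ _ (tup R m) (tup R m) R mu
  (fun eta v => F (vaff eta r v) * creal (gaussr 1 v)) (cmeas_Dreg_in r)).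
Qed.

Lemma cabs_FDreg r eta : cabs (conjc (F eta) * Dreg r eta) <=
  (B * Num.sqrt pi ^+ m.+1) * cabs (F eta).
Proof. by rewrite cabsM cabsJ mulrC ler_wpM2r ?cabs_ge0// cabs_Dreg. Qed.

Lemma integrable_FDreg_bound :
  mu.-integrable setT (fun eta => (B * Num.sqrt pi ^+ m.+1 * cabs (F eta))%:E).
Proof. exact: rintegrableZ (cintegrable_cabs Fi). Qed.

Lemma cintegrable_FDreg r : cintegrable mu (fun eta => conjc (F eta) * Dreg r eta).
Proof.
apply: (cintegrable_le _ (cabs_FDreg r) integrable_FDreg_bound).
by apply: cmeasM; [exact: cmeasJ|exact: cmeas_Dreg].
Qed.

Lemma cintegrable_gauss_phase e zeta : 0 < e ->
  cintegrable mu (fun x => creal (gaussr e x) * cphase (dotp zeta x)).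
Proof.
move=> e0; apply: (cintegrable_le _ _ (integrable_gaussr e0)).
  apply: cmeasM; first by apply: cmeas_creal; exact: measurable_gaussr.
  by apply: cmeas_cphase; exact: measurable_dotp.
by move=> x; rewrite cabsM cabs_cphase mulr1 cabs_creal ger0_norm ?expR_ge0.
Qed.

(** After expanding the square, the x-integral is a Gaussian transform and pairs F with its Gaussian
    average. The parameter r^2/4 makes that transform e^(-|xi - eta|^2/r^2), which becomes
    [gaussr 1] under xi = eta + r v. *)
Lemma regularizedE (r : R) : 0 < r ->
  creal (\int[mu]_x (cabs (ifourier F x) ^+ 2 * gaussr (r ^+ 2 / 4) x))%R =
  creal ((2 * Num.sqrt pi) ^+ m.+1) * CI mu (fun eta => conjc (F eta) * Dreg r eta).
Proof.
move=> r0; set e := r ^+ 2 / 4.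
have e0 : 0 < e by rewrite divr_gt0 ?exprn_gt0.
have gi := integrable_gaussr e0.
have cgi : cintegrable mu (fun x => creal (gaussr e x)).
  apply: (cintegrable_le (s := gaussr e)) => //.
    by apply: cmeas_creal; exact: measurable_gaussr.
  by move=> x; rewrite cabs_creal ger0_norm ?expR_ge0.
rewrite -CI_creal.
pose g1 x eta := creal (gaussr e x) * ifourier F x * conjc (cphase (dotp x eta) * F eta).
have mdot : measurable_fun setT (fun z : tup R m * tup R m => dotp z.1 z.2).
  by apply: measurable_dotp; [exact: measurable_fst|exact: measurable_snd].
have g1i : cintegrable (prodm mu mu) (fun z => g1 z.1 z.2).
  apply: (cintegrable_le (s := fun z => N * cabs (creal (gaussr e z.1) * F z.2))).
  - apply: cmeasM; first apply: cmeasM.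
    + by apply: cmeas_creal; apply: measurable_gaussr; exact: measurable_fst.
    + exact: (cmeas_comp (cmeas_ifourier mF) measurable_fst).
    + apply: cmeasJ; apply: cmeasM; first exact: cmeas_cphase.
      exact: (cmeas_comp mF measurable_snd).
  - move=> z; rewrite /g1 !cabsM cabsJ cabsM cabs_cphase mul1r mulrAC mulrC.
    by rewrite ler_wpM2r ?mulr_ge0 ?cabs_ge0// cabs_ifourier.
  - exact: rintegrableZ (cintegrable_cabs (cintegrable_tensor cgi Fi)).
transitivity (CI mu (fun x => CI mu (g1 x))).
  apply: eq_CI => x; rewrite /g1 CIZ.
    rewrite CIJ; last exact: cintegrable_phase.
    by rewrite -mulrA mulc_conj -crealM mulrC.
  have := cintegrable_phase x Fi; move=> [h1 h2]; split.
    by apply: eq_rintegrable h1 => xi; rewrite cReJ.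
  apply: eq_rintegrable (rintegrableZ (-1) h2) => xi.
  by rewrite cImJ mulN1r.
rewrite (CI_fubini g1i).
rewrite -CIZ; last exact: cintegrable_FDreg.
apply: eq_CI => eta.
pose g2 x xi := creal (gaussr e x) * (cphase (dotp x xi) * F xi) * conjc (cphase (dotp x eta)).
have g2i : cintegrable (prodm mu mu) (fun z => g2 z.1 z.2).
  apply: (cintegrable_le (s := fun z => cabs (creal (gaussr e z.1) * F z.2))).
  - apply: cmeasM; first apply: cmeasM.
    + by apply: cmeas_creal; apply: measurable_gaussr; exact: measurable_fst.
    + apply: cmeasM; first exact: cmeas_cphase.
      exact: (cmeas_comp mF measurable_snd).
    + by apply: cmeasJ; apply: cmeas_cphase; apply: measurable_dotp;
        [exact: measurable_fst|exact: measurable_cst].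
  - by move=> z; rewrite /g2 !cabsM cabsJ !cabs_cphase mul1r mulr1.
  - exact: cintegrable_cabs (cintegrable_tensor cgi Fi).
have g2i1 x : cintegrable mu (g2 x).
  apply: (cintegrable_le (s := fun xi => cabs (creal (gaussr e x) * F xi))).
  - apply: cmeasM; last exact: cmeas_cst.
    apply: cmeasM; first exact: cmeas_cst.
    by apply: cintegrable_meas; exact: cintegrable_phase.
  - by move=> xi; rewrite /g2 !cabsM cabsJ !cabs_cphase mul1r mulr1.
  - by apply: cintegrable_cabs; exact: cintegrableZ.
transitivity (conjc (F eta) * CI mu (fun x => CI mu (g2 x))).
  rewrite -CIZ; last exact: (cintegrable_CI_snd g2i).
  apply: eq_CI => x; rewrite /g1 conjcM.
  have -> : CI mu (g2 x) =
      creal (gaussr e x) * conjc (cphase (dotp x eta)) * ifourier F x.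
    rewrite /ifourier -CIZ; last exact: cintegrable_phase.
    by apply: eq_CI => xi; rewrite /g2; ring.
  by ring.
rewrite mulrCA; congr (_ * _).
rewrite (CI_fubini g2i).
pose c1 := Num.sqrt (pi / e) ^+ m.+1.
pose g3 xi := F xi * creal (c1 *
   expR (- (dotp (vaff xi (-1) eta) (vaff xi (-1) eta) / (4 * e)))).
transitivity (CI mu g3).
  apply: eq_CI => xi; rewrite /g3 -CI_gauss_phase// -CIZ.
    apply: eq_CI => x; rewrite /g2 conjc_cphase dotp_vaff mulN1r cphaseD.
    by rewrite (dotpC xi) (dotpC eta); ring.
  exact: cintegrable_gauss_phase.
have c10 : 0 <= c1 by rewrite exprn_ge0 ?sqrtr_ge0.
have g3i : cintegrable mu g3.
  apply: (cintegrable_le (s := fun xi => c1 * cabs (F xi))).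
  - apply: cmeasM => //; apply: cmeas_creal; apply: measurable_funM => //.
    apply: measurable_expR_comp; apply: measurable_funN.
    by apply: measurable_funM => //; apply: measurable_dotp; exact: measurable_vaff.
  - move=> xi; rewrite cabsM cabs_creal mulrC ler_wpM2r ?cabs_ge0//.
    rewrite ger0_norm ?mulr_ge0 ?expR_ge0// -[leRHS]mulr1 ler_wpM2l// expR_le1.
    by rewrite oppr_le0 divr_ge0 ?dotp_ge0// mulr_ge0// ltW.
  - exact: rintegrableZ (cintegrable_cabs Fi).
have r_neq0 : r != 0 by rewrite gt_eqF.
rewrite (CI_vaff eta r_neq0 g3i) /Dreg -CIZ; last exact: cintegrable_vaff.
rewrite -CIZ; last exact: cintegrable_Dreg_in.
apply: eq_CI => v; rewrite /g3 mulrCA [RHS]mulrCA; congr (_ * _).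
rewrite -!crealM; congr creal; rewrite mulrA; congr (_ * _).
  (* With e = r^2/4, r sqrt(pi/e) = 2 sqrt pi: the Jacobian r^n cancels the normalization, and the
     prefactor does not depend on r. *)
  rewrite /c1 -exprMn; congr (_ ^+ _); rewrite gtr0_norm// /e.
  have -> : pi / (r ^+ 2 / 4) = (2 / r) ^+ 2 * pi by field.
  rewrite sqrtrM ?sqr_ge0// sqrtr_sqr ger0_norm ?divr_ge0 ?(ltW r0)//.
  by rewrite mulrA [r * _]mulrC mulfVK.
rewrite /gaussr mul1r 2!dotp_vaff2 dotp_vaff (dotpC v eta) /e; congr expR.
congr (- _); field; exact: r_neq0.
Qed.

(** Two dominated limits. Inside the average the bound [B] on F and the Gaussian in v give the
    majorant; in eta it is a multiple of |F|. *)
Lemma Dreg_limit (r : nat -> R) : r @ \oo --> 0 ->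
  ccvg (fun k => CI mu (fun eta => conjc (F eta) * Dreg (r k) eta))
    (creal (Num.sqrt pi ^+ m.+1 * (\int[mu]_eta (cabs (F eta) ^+ 2))%R)).
Proof.
move=> r0.
have Dc eta : ccvg (fun k => Dreg (r k) eta)
    (F eta * creal (Num.sqrt pi ^+ m.+1)).
  have -> : F eta * creal (Num.sqrt pi ^+ m.+1) =
      CI mu (fun v => F eta * creal (gaussr 1 v)).
    rewrite CIZ; first by rewrite CI_creal Rintegral_gaussr// divr1.
    have := cintegrable_gauss_phase (v0 R m) ltr01.
    by congr cintegrable; apply/funext => v; rewrite dotp0 /cphase cexp0 mulr1.
  apply: (ccvg_dominated _ _ _ integrable_Dreg_bound).
  - move=> k; exact: cintegrable_meas (cintegrable_Dreg_in (r k) eta).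
  - by apply: cmeasM => //; apply: cmeas_creal; exact: measurable_gaussr.
  - by move=> v; apply: ccvgM; [exact: Fc|exact: ccvg_cst].
  - by move=> k v; exact: cabs_Dreg_in.
have -> : creal (Num.sqrt pi ^+ m.+1 * (\int[mu]_eta (cabs (F eta) ^+ 2))%R) =
    CI mu (fun eta => conjc (F eta) * (F eta * creal (Num.sqrt pi ^+ m.+1))).
  rewrite crealM -CI_creal -CIZ.
    by apply: eq_CI => eta; rewrite -mulc_conj; ring.
  have B0 : 0 <= B by rewrite (le_trans _ (FB (v0 R m)))// cabs_ge0.
  apply: (cintegrable_le (s := fun eta => B * cabs (F eta))).
  - by apply: cmeas_creal; apply: measurable_funX; exact: measurable_cabs.
  - by move=> eta; rewrite cabs_creal ger0_norm ?sqr_ge0// expr2 ler_wpM2r ?cabs_ge0.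
  - exact: rintegrableZ (cintegrable_cabs Fi).
apply: (ccvg_dominated _ _ _ integrable_FDreg_bound).
- move=> k; exact: cintegrable_meas (cintegrable_FDreg (r k)).
- by apply: cmeasM; [exact: cmeasJ|apply: cmeasM => //; exact: cmeas_cst].
- by move=> eta; apply: ccvgM; [exact: ccvg_cst|exact: Dc].
- by move=> k eta; exact: cabs_FDreg.
Qed.

(** As r decreases to 0 the left side of [regularizedE] grows to the full integral by monotone
    convergence, while [Dreg_limit] handles the right side. The factors (2 sqrt pi)^n and (sqrt
    pi)^n combine to (2 pi)^n. *)
Lemma plancherel :
  (\int[mu]_x (cabs (ifourier F x) ^+ 2)%:E =
   ((2 * pi) ^+ m.+1)%:E * \int[mu]_xi (cabs (F xi) ^+ 2)%:E)%E.
Proof.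
have B0 : 0 <= B by rewrite (le_trans _ (FB (v0 R m)))// cabs_ge0.
have F2i : mu.-integrable setT (fun eta => (cabs (F eta) ^+ 2)%:E).
  apply: (integrable_le (s := fun eta => B * cabs (F eta))).
  - by apply: measurable_funX; exact: measurable_cabs.
  - by move=> eta; rewrite ger0_norm ?sqr_ge0// expr2 ler_wpM2r ?cabs_ge0.
  - exact: rintegrableZ (cintegrable_cabs Fi).
pose r (k : nat) : R := k.+1%:R^-1.
have rp k : 0 < r k by rewrite invr_gt0.
have rlim : r @ \oo --> 0 by exact: cvg_harmonic.
pose e k := r k ^+ 2 / 4.
have e0 k : 0 < e k by rewrite divr_gt0 ?exprn_gt0.
pose A k := (\int[mu]_x (cabs (ifourier F x) ^+ 2 * gaussr (e k) x))%R.
have Alim : A @ \oo --> (2 * pi) ^+ m.+1 * (\int[mu]_eta (cabs (F eta) ^+ 2))%R.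
  have [+ _] := Dreg_limit rlim; rewrite cRe_creal => Dl.
  have -> : A = fun k => (2 * Num.sqrt pi) ^+ m.+1 *
      Re (CI mu (fun eta => conjc (F eta) * Dreg (r k) eta)).
    apply/funext => k; have := congr1 (fun z => Re z) (regularizedE (rp k)).
    rewrite (cRe_creal (Rintegral _ _ _)) cReM.
    by rewrite (cRe_creal (_ ^+ _)) (cIm_creal (_ ^+ _)) mul0r subr0.
  have -> : (2 * pi) ^+ m.+1 * (\int[mu]_eta (cabs (F eta) ^+ 2))%R =
     (2 * Num.sqrt pi) ^+ m.+1 *
     (Num.sqrt pi ^+ m.+1 * (\int[mu]_eta (cabs (F eta) ^+ 2))%R).
    rewrite mulrA -exprMn; congr (_ ^+ _ * _).
    by rewrite -mulrA -expr2 sqr_sqrtr// pi_ge0.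
  by apply: cvgM => //; exact: cvg_cst.
have gcvg x : (fun k => (cabs (ifourier F x) ^+ 2 * gaussr (e k) x)%:E) @ \oo -->
    (cabs (ifourier F x) ^+ 2)%:E.
  apply: cvg_EFin; first exact: nearW.
  rewrite -[X in _ --> X]mulr1; apply: cvgM; first exact: cvg_cst.
  have h : (fun k => - (e k * dotp x x)) @ \oo --> (0 : R).
    rewrite (_ : (fun k => _) = (fun k => r k * r k * - (dotp x x / 4))); last first.
      by apply/funext => k; rewrite /e; field.
    rewrite -[X in _ --> X](mul0r (- (dotp x x / 4))); apply: cvgM; last exact: cvg_cst.
    by rewrite -[X in _ --> X](mul0r 0); apply: cvgM.
  have := @continuous_cvg _ _ _ \oo _ _ (@expR R) _ (@continuous_expR R _) h.
  by rewrite expR0; exact.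
have mono x : nondecreasing_seq (fun k => (cabs (ifourier F x) ^+ 2 * gaussr (e k) x)%:E).
  move=> k l kl; rewrite lee_fin ler_wpM2l ?sqr_ge0// ler_expR lerN2.
  rewrite ler_wpM2r ?dotp_ge0// /e ler_pM2r// !expr2.
  by apply: ler_pM; rewrite ?(ltW (rp _))// lef_pV2 ?posrE// ler_nat.
have lim1 : (fun k => \int[mu]_x (cabs (ifourier F x) ^+ 2 * gaussr (e k) x)%:E)%E
    @ \oo --> (\int[mu]_x (cabs (ifourier F x) ^+ 2)%:E)%E.
  have -> : (\int[mu]_x (cabs (ifourier F x) ^+ 2)%:E)%E =
      (\int[mu]_x limn (fun k => (cabs (ifourier F x) ^+ 2 * gaussr (e k) x)%:E))%E.
    by apply: eq_integral => x _; apply/esym/cvg_lim => //; exact: gcvg.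
  apply: cvg_monotone_convergence => //.
  - move=> k; apply/measurable_EFinP; apply: measurable_funM; last exact: measurable_gaussr.
    by apply: measurable_funX; apply: measurable_cabs; exact: cmeas_ifourier.
  - by move=> k x _; rewrite lee_fin; apply: mulr_ge0; [exact: sqr_ge0|exact: expR_ge0].
have lim2 : (fun k => \int[mu]_x (cabs (ifourier F x) ^+ 2 * gaussr (e k) x)%:E)%E
    @ \oo --> ((2 * pi) ^+ m.+1 * (\int[mu]_eta (cabs (F eta) ^+ 2))%R)%:E.
  rewrite (_ : (fun k => _) = (fun k => (A k)%:E)).
    by apply: cvg_EFin => //; exact: nearW.
  apply/funext => k; rewrite /A /Rintegral fineK//.
  exact: (integrable_fin_num measurableT (regularized_integrable (e0 k))).
have -> : (\int[mu]_x (cabs (ifourier F x) ^+ 2)%:E)%E =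
    ((2 * pi) ^+ m.+1 * (\int[mu]_eta (cabs (F eta) ^+ 2))%R)%:E.
  exact: (cvg_unique _ lim1 lim2).
rewrite EFinM /Rintegral fineK//.
exact: (integrable_fin_num measurableT F2i).
Qed.

End regularized.
End plancherel.

(** * Limits in mean square *)

Section mean_square.
Context d (T : measurableType d) (R : realType).
Variable M : {measure set T -> \bar R}.
Implicit Types (A B : T -> R[i]) (e : R).
Local Open Scope ereal_scope.

Definition sqnorm A : \bar R := \int[M]_x ((cabs (A x)) ^+ 2)%:E.

Lemma sqnorm_ge0 A : 0 <= sqnorm A.
Proof. by apply: integral_ge0 => x _; rewrite lee_fin sqr_ge0. Qed.

Lemma measurable_cabs2 A : cmeas A ->
  measurable_fun setT (fun x => ((cabs (A x)) ^+ 2)%:E).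
Proof.
by move=> mA; apply/measurable_EFinP; apply: measurable_funX; exact: measurable_cabs.
Qed.

Lemma sqnormN A B : sqnorm (fun x => A x - B x)%R = sqnorm (fun x => B x - A x)%R.
Proof. by apply: eq_integral => x _; rewrite -opprB cabsN. Qed.

(** From 2 b c <= e b^2 + c^2/e. The free weight e lets the coefficient of |w|^2 tend to 1, while
    squares integrate directly, infinite values included. *)
Lemma sqr_cabs_le (z w : R[i]) e : (0 < e)%R ->
  (cabs z ^+ 2 <= (1 + e) * cabs w ^+ 2 + (1 + e^-1) * cabs (z - w) ^+ 2)%R.
Proof.
move=> e0; have h : (cabs z <= cabs w + cabs (z - w))%R.
  by rewrite -{1}(subrK w z) addrC cabs_le_add.
have h2 : (cabs z ^+ 2 <= (cabs w + cabs (z - w)) ^+ 2)%R.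
  by rewrite !expr2; apply: ler_pM; rewrite ?cabs_ge0.
apply: le_trans h2 _; rewrite -subr_ge0.
set b := cabs w; set c := cabs (z - w)%R.
have -> : ((1 + e) * b ^+ 2 + (1 + e^-1) * c ^+ 2 - (b + c) ^+ 2 =
   e^-1 * (e * b - c) ^+ 2)%R by field; rewrite gt_eqF.
by rewrite mulr_ge0 ?sqr_ge0// invr_ge0 ltW.
Qed.

Lemma sqnorm_le A B e : (0 < e)%R -> cmeas A -> cmeas B ->
  sqnorm A <= (1 + e)%:E * sqnorm B + (1 + e^-1)%:E * sqnorm (fun x => A x - B x)%R.
Proof.
move=> e0 mA mB; have mAB := cmeasB mA mB.
have c1 : (0 <= 1 + e)%R by rewrite addr_ge0// ltW.
have c2 : (0 <= 1 + e^-1)%R by rewrite addr_ge0// invr_ge0 ltW.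
have nn C : forall x, setT x -> 0 <= ((cabs (C x : R[i])) ^+ 2)%:E.
  by move=> x _; rewrite lee_fin sqr_ge0.
have nn2 (c : R) C : (0 <= c)%R ->
    forall x, setT x -> 0 <= c%:E * ((cabs (C x : R[i])) ^+ 2)%:E.
  by move=> c0 x _; rewrite mule_ge0// lee_fin sqr_ge0.
rewrite /sqnorm -!ge0_integralZl_EFin//; try exact: measurable_cabs2.
rewrite -ge0_integralD//; try exact: nn2;
  try (apply: measurable_funeM; exact: measurable_cabs2).
apply: ge0_le_integral => //.
- exact: nn.
- exact: measurable_cabs2.
- by apply: emeasurable_funD; apply: measurable_funeM; exact: measurable_cabs2.
- by move=> x _; rewrite -!EFinM -EFinD lee_fin sqr_cabs_le.
- by move=> x _; rewrite lee_fin sqr_ge0.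
- by move=> x _; rewrite lee_fin sqr_ge0.
Qed.

Definition mean_close (A_ : nat -> T -> R[i]) A :=
  forall e, (0 < e)%R -> exists k, forall l, (k <= l)%N ->
    sqnorm (fun x => A x - A_ l x)%R <= e%:E.

(** At fixed e the comparison passes from A to a late [A_ N], to [B_ N], to B, with a total factor
    (1 + e)^2 and errors that vanish with N; then e tends to 0. *)
Lemma mean_close_le (A_ B_ : nat -> T -> R[i]) A B :
  (forall k, cmeas (A_ k)) -> (forall k, cmeas (B_ k)) -> cmeas A -> cmeas B ->
  (forall k, sqnorm (A_ k) = sqnorm (B_ k)) ->
  mean_close A_ A -> mean_close B_ B -> sqnorm A <= sqnorm B.
Proof.
move=> mA_ mB_ mA mB AB cA cB.
have key e : (0 < e)%R -> sqnorm A <= ((1 + e) ^+ 2)%:E * sqnorm B.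
  move=> e0; apply/lee_addgt0Pr => eps eps0.
  (* Total coefficient of the two approximation errors, each made at most eps / c. *)
  pose c := ((1 + e) * (1 + e^-1) + (1 + e^-1))%R.
  have ei0 : (0 < e^-1)%R by rewrite invr_gt0.
  have c0 : (0 < c)%R by rewrite /c addr_gt0// ?mulr_gt0// addr_gt0.
  have [k hk] := cA (eps / c)%R (divr_gt0 eps0 c0).
  have [l hl] := cB (eps / c)%R (divr_gt0 eps0 c0).
  pose N := maxn k l.
  have hA := hk N (leq_maxl _ _).
  have hB := hl N (leq_maxr _ _).
  have e1 : (0 <= 1 + e)%R by rewrite addr_ge0// ltW.
  have e2 : (0 <= 1 + e^-1)%R by rewrite addr_ge0// ltW.
  apply: le_trans (sqnorm_le e0 mA (mA_ N)) _.
  rewrite AB.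
  apply: (@le_trans _ _ ((1 + e)%:E * ((1 + e)%:E * sqnorm B + (1 + e^-1)%:E * (eps / c)%:E) +
     (1 + e^-1)%:E * (eps / c)%:E)).
    apply: leeD; apply: lee_wpmul2l; rewrite ?lee_fin//.
    apply: le_trans (sqnorm_le e0 (mB_ N) mB) _.
    by rewrite leeD2l// lee_wpmul2l ?lee_fin// sqnormN.
  rewrite ge0_muleDr; last 2 first.
  - by rewrite mule_ge0 ?lee_fin ?sqnorm_ge0.
  - by rewrite -EFinM lee_fin mulr_ge0// divr_ge0// ltW.
  rewrite muleA -!EFinM -expr2 -addeA -EFinD leeD2l// lee_fin.
  rewrite mulrA -mulrDl -/c.
  by rewrite mulrC mulfVK// gt_eqF.
have [->|] := eqVneq (sqnorm B) +oo; first by rewrite leey.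
rewrite -ltey => Boo.
have Bf : sqnorm B \is a fin_num by rewrite ge0_fin_numE ?sqnorm_ge0.
move: key; rewrite -(fineK Bf); set b := fine _ => key.
have b0 : (0 <= b)%R by rewrite fine_ge0 ?sqnorm_ge0.
apply/lee_addgt0Pr => eps eps0.
(* For e <= 1, (1 + e)^2 b <= b + 3 e b, and this is at most b + eps; the added 1 keeps the
   denominator positive. *)
pose e := Num.min 1%R (eps / (3 * b + 1))%R.
have d0 : (0 < 3 * b + 1)%R by rewrite ltr_wpDl// mulr_ge0.
have e0 : (0 < e)%R by rewrite lt_min ltr01 divr_gt0.
apply: le_trans (key e e0) _; rewrite -EFinM -EFinD lee_fin.
have e1 : (e <= 1)%R by rewrite ge_min lexx.
have e2 : (e * (3 * b + 1) <= eps)%R by rewrite -ler_pdivlMr// ge_min lexx orbT.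
have : (e ^+ 2 <= e)%R by rewrite expr2 -[leRHS]mulr1 ler_wpM2l// ltW.
nra.
Qed.

(** The [A_] converge pointwise and the [B_] in mean. Equality of mutual distances makes the [A_]
    Cauchy in mean, and Fatou's lemma shows that they approach their pointwise limit in mean as
    well. *)
Lemma mean_square_limit (A_ B_ : nat -> T -> R[i]) A B :
  (forall k, cmeas (A_ k)) -> (forall k, cmeas (B_ k)) -> cmeas A -> cmeas B ->
  (forall x, ccvg (fun k => A_ k x) (A x)) ->
  (forall k l, sqnorm (fun x => A_ k x - A_ l x)%R = sqnorm (fun x => B_ k x - B_ l x)%R) ->
  (forall k, sqnorm (A_ k) = sqnorm (B_ k)) ->
  mean_close B_ B -> sqnorm A = sqnorm B.
Proof.
move=> mA_ mB_ mA mB Ac AB2 AB cB.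
suff cA : mean_close A_ A.
  apply/eqP; rewrite eq_le; apply/andP; split.
    exact: (mean_close_le mA_ mB_ mA mB AB cA cB).
  exact: (mean_close_le mB_ mA_ mB mA (fun k => esym (AB k)) cB cA).
(* The squared distance of two late terms is at most twice the sum of their squared distances to B,
   hence the quarter. *)
move=> e e0; have [k hk] := cB (e / 4)%R (divr_gt0 e0 (ltr0n _ 4)).
exists k => l kl.
pose g n x := ((cabs (A_ (n + k)%N x - A_ l x)) ^+ 2)%:E.
have gc x : (fun n => g n x) @ \oo --> ((cabs (A x - A_ l x)) ^+ 2)%:E.
  suff h : (fun n => (cabs (A_ (n + k)%N x - A_ l x)) ^+ 2)%R @ \oo -->
      ((cabs (A x - A_ l x)) ^+ 2)%R by apply: cvg_EFin => //; exact: nearW.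
  rewrite (_ : (fun n => _) = (fun n => (Re (A_ (n + k)%N x) - Re (A_ l x)) *
     (Re (A_ (n + k)%N x) - Re (A_ l x)) + (Im (A_ (n + k)%N x) - Im (A_ l x)) *
     (Im (A_ (n + k)%N x) - Im (A_ l x)))%R); last first.
    by apply/funext => n /=; rewrite cabs_sqr cReB cImB !expr2.
  rewrite cabs_sqr cReB cImB !expr2.
  have [c1 c2] := Ac x.
  have d1 : ((Re (A_ (n + k)%N x) - Re (A_ l x))%R @[n --> \oo] --> (Re (A x) - Re (A_ l x))%R).
    apply: cvgB; last exact: cvg_cst.
    by rewrite (cvg_shiftn k (fun n => Re (A_ n x))).
  have d2 : ((Im (A_ (n + k)%N x) - Im (A_ l x))%R @[n --> \oo] --> (Im (A x) - Im (A_ l x))%R).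
    apply: cvgB; last exact: cvg_cst.
    by rewrite (cvg_shiftn k (fun n => Im (A_ n x))).
  by apply: cvgD; apply: cvgM.
have bound n : \int[M]_x g n x <= e%:E.
  rewrite -[leLHS]/(sqnorm (fun x => A_ (n + k)%N x - A_ l x)%R) AB2.
  have m1 : cmeas (fun x => B_ (n + k)%N x - B x)%R by exact: cmeasB.
  have m2 : cmeas (fun x => B_ l x - B x)%R by exact: cmeasB.
  have m3 : cmeas (fun x => B_ (n + k)%N x - B_ l x)%R by exact: cmeasB.
  apply: le_trans (sqnorm_le ltr01 m3 m1) _.
  rewrite invr1.
  have -> : sqnorm (fun x => B_ (n + k)%N x - B_ l x - (B_ (n + k)%N x - B x))%R =
      sqnorm (fun x => B x - B_ l x)%R.
    by apply: eq_integral => x _; congr (cabs _ ^+ 2)%:E; ring.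
  rewrite sqnormN.
  apply: (@le_trans _ _ ((1 + 1)%:E * (e / 4)%:E + (1 + 1)%:E * (e / 4)%:E)).
    by apply: leeD; apply: lee_wpmul2l; rewrite ?lee_fin//; apply: hk => //; exact: leq_addl.
  by rewrite -!EFinM -EFinD lee_fin; lra.
have -> : sqnorm (fun x => A x - A_ l x)%R = \int[M]_x limn_einf (g^~ x).
  apply: eq_integral => x _.
  by rewrite (cvg_limn_einf_sup (gc x)).1.
apply: le_trans (fatou _ _ _ _) _ => //.
- by move=> n; apply: measurable_cabs2; exact: cmeasB.
- by move=> n x _; rewrite lee_fin sqr_ge0.
rewrite limn_einf_lim; apply: lime_le; first exact: is_cvg_einfs.
apply: nearW => n; apply: le_trans (bound n).
by apply: ereal_inf_lbound; exists n => /=.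
Qed.

End mean_square.

(** * Convolution with the continued Poisson kernel on a slice of fixed y *)

Section convolution.
Variables (R : realType) (m : nat) (lam : R[i]) (a : R) (y : tup R m).
Hypothesis lam0 : 0 < Re lam.
Hypothesis ya : dotp y y < a ^+ 2.
Implicit Types (f : tup R m -> R[i]) (x xi u v : tup R m).
Local Notation mu := (mu R m).
Local Notation hk := (hker lam a y).
Local Notation qk := (qker lam a y).

Definition conv f x : R[i] := CI mu (fun u => f u * qk (vaff x (-1) u)).

Definition fourier0 f xi : R[i] := CI mu (fun u => f u * cphase (- dotp u xi)).

Definition fourier1 f xi : R[i] :=
  creal (powR (2 * pi) (- (m.+1%:R / 2))) * fourier0 f xi.

Lemma cintegrable_hk : cintegrable mu hk.
Proof.
have := cintegrable_hker lam0 ya (v0 R m).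
by congr cintegrable; apply/funext => xi; rewrite dotp0 /cphase cexp0 mul1r.
Qed.

Lemma cintegrable_fourier0 f xi : cintegrable mu f ->
  cintegrable mu (fun u => f u * cphase (- dotp u xi)).
Proof.
move=> fi; apply: (cintegrable_le _ _ (cintegrable_cabs fi)).
  apply: cmeasM; first exact: cintegrable_meas fi.
  apply: cmeas_cphase; apply: measurable_funN; exact: measurable_dotp.
by move=> u; rewrite cabsM cabs_cphase mulr1.
Qed.

Lemma cabs_fourier0 f xi : cintegrable mu f ->
  cabs (fourier0 f xi) <= (\int[mu]_u cabs (f u))%R.
Proof.
move=> fi; apply: le_trans (cabs_CI_le (cintegrable_fourier0 xi fi)) _.
rewrite le_eqVlt; apply/orP; left; apply/eqP; apply: eq_Rintegral => u _.
by rewrite cabsM cabs_cphase mulr1.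
Qed.

Lemma cmeas_fourier0 f : cmeas f -> cmeas (fourier0 f).
Proof.
move=> mf; apply: (@cmeas_CI1 _ _ (tup R m) (tup R m) R mu
  (fun xi u => f u * cphase (- dotp u xi))).
apply: cmeasM; first exact: (cmeas_comp mf measurable_snd).
apply: cmeas_cphase; apply: measurable_funN; apply: measurable_dotp.
  exact: measurable_snd.
exact: measurable_fst.
Qed.

Lemma fourier0_line f xi v (r : nat -> R) : cintegrable mu f -> r @ \oo --> 0 ->
  ccvg (fun k => fourier0 f (vaff xi (r k) v)) (fourier0 f xi).
Proof.
move=> fi r0.
apply: (ccvg_dominated _ _ _ (cintegrable_cabs fi)).
- by move=> k; exact: cintegrable_meas (cintegrable_fourier0 _ fi).
- exact: cintegrable_meas (cintegrable_fourier0 _ fi).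
- move=> u; apply: ccvgM; first exact: ccvg_cst.
  have h : (fun k => - dotp u (vaff xi (r k) v)) @ \oo --> - dotp u xi.
    apply: cvgN; rewrite (_ : (fun k => _) = (fun k => dotp u xi + r k * dotp u v)).
      rewrite -[X in _ --> X]addr0; apply: cvgD; first exact: cvg_cst.
      by rewrite -[X in _ --> X](mul0r (dotp u v)); apply: cvgM => //; exact: cvg_cst.
    by apply/funext => k; rewrite dotpC dotp_vaff (dotpC xi) (dotpC v).
  split.
    rewrite (_ : (fun k => _) = (fun k => cos (- dotp u (vaff xi (r k) v)))).
      rewrite [X in _ --> X](_ : _ = cos (- dotp u xi)).
        have := @continuous_cvg _ _ _ \oo _ _ (@cos R) _ (@continuous_cos R _) h.
        exact.
      by rewrite /cphase cRe_cexp /= expR0 mul1r.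
    by apply/funext => k; rewrite /cphase cRe_cexp /= expR0 mul1r.
  rewrite (_ : (fun k => _) = (fun k => sin (- dotp u (vaff xi (r k) v)))).
    rewrite [X in _ --> X](_ : _ = sin (- dotp u xi)).
      have := @continuous_cvg _ _ _ \oo _ _ (@sin R) _ (@continuous_sin R _) h.
      exact.
    by rewrite /cphase cIm_cexp /= expR0 mul1r.
  by apply/funext => k; rewrite /cphase cIm_cexp /= expR0 mul1r.
- by move=> k u; rewrite cabsM cabs_cphase mulr1.
Qed.

Let C1 := Num.sqrt (4 * pi : R) ^+ m.+1.
Let C10 : 0 < C1. Proof. by rewrite exprn_gt0// sqrtr_gt0 mulr_gt0// pi_gt0. Qed.

Lemma qkE v : qk v = creal C1^-1 * CI mu (fun xi => cphase (dotp v xi) * hk xi).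
Proof.
rewrite (CI_hker_qker lam0 ya) mulrA -crealM mulVf ?creal1 ?mul1r//.
by rewrite gt_eqF.
Qed.

Lemma conv_ifourier f x : cintegrable mu f ->
  conv f x = creal C1^-1 * ifourier (fun xi => fourier0 f xi * hk xi) x.
Proof.
move=> fi.
pose g u xi := f u * (cphase (dotp (vaff x (-1) u) xi) * hk xi).
have gi : cintegrable (prodm mu mu) (fun z => g z.1 z.2).
  apply: (cintegrable_le _ _ (cintegrable_cabs (cintegrable_tensor fi cintegrable_hk))).
    apply: cmeasM; first exact: (cmeas_comp (cintegrable_meas fi) measurable_fst).
    apply: cmeasM; last exact: (cmeas_comp (cintegrable_meas cintegrable_hk) measurable_snd).
    apply: cmeas_cphase; apply: measurable_dotp; last exact: measurable_snd.
    by apply: measurable_vaff => //; exact: measurable_fst.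
  by move=> z; rewrite /g !cabsM cabs_cphase mul1r.
transitivity (creal C1^-1 * CI mu (fun u => CI mu (g u))).
  rewrite -CIZ; last exact: (cintegrable_CI_snd gi).
  apply: eq_CI => u; rewrite qkE /g CIZ; first by ring.
  exact: (cintegrable_hker lam0 ya).
congr (_ * _); rewrite (CI_fubini gi) /ifourier; apply: eq_CI => xi.
rewrite mulrCA mulrC -CIZ; last exact: cintegrable_fourier0.
by apply: eq_CI => u; rewrite /g dotp_vaff mulN1r cphaseD; ring.
Qed.

Let kappa : R := Num.sqrt pi ^+ m.+1.

Lemma kappa_sqr : kappa ^+ 2 = pi ^+ m.+1.
Proof. by rewrite -exprM mulnC exprM sqr_sqrtr// pi_ge0. Qed.

Lemma powR_2pi_sqr : powR (2 * pi) (- (m.+1%:R / 2)) ^+ 2 = ((2 * pi) ^+ m.+1)^-1 :> R.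
Proof.
have p0 : 0 < 2 * pi :> R by rewrite mulr_gt0// pi_gt0.
rewrite expr2 -powRD; last by apply/implyP => _; rewrite gt_eqF.
have -> : - (m.+1%:R / 2) + - (m.+1%:R / 2) = - m.+1%:R :> R by field.
by rewrite powRN powR_mulrn// ltW.
Qed.

(** [plancherel] applies because the transform of an integrable f is bounded and continuous along
    lines. The constant is (4 pi)^(-n) (2 pi)^n (2 pi)^n = pi^n = kappa^2: the normalization of
    [qker], Plancherel, and the normalization of [fourier1]. *)
Lemma conv_L1 f : cintegrable mu f -> sqnorm mu (conv f) =
  sqnorm mu (fun xi => creal kappa * (fourier1 f xi * hk xi)).
Proof.
move=> fi.
pose N := (\int[mu]_u cabs (f u))%R.
have N0 : 0 <= N by apply: Rintegral_ge0 => u _; exact: cabs_ge0.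
pose F xi := fourier0 f xi * hk xi.
have mF : cmeas F.
  apply: cmeasM; last exact: cintegrable_meas cintegrable_hk.
  exact: cmeas_fourier0 (cintegrable_meas fi).
have Fi : cintegrable mu F.
  apply: (cintegrable_le (s := fun xi => N * cabs (hk xi))) => //.
    by move=> xi; rewrite cabsM ler_wpM2r ?cabs_ge0// cabs_fourier0.
  exact: rintegrableZ (cintegrable_cabs cintegrable_hk).
have FB xi : cabs (F xi) <= N * hbound lam a y.
  by rewrite cabsM ler_pM ?cabs_ge0 ?cabs_fourier0// cabs_hker.
have Fc xi v (r : nat -> R) : r @ \oo --> 0 ->
    ccvg (fun k => F (vaff xi (r k) v)) (F xi).
  move=> r0; apply: ccvgM; first exact: fourier0_line.
  exact: hker_line.
have P := plancherel Fi FB Fc.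
have E x : conv f x = creal C1^-1 * ifourier F x by exact: conv_ifourier.
have mi : cmeas (ifourier F) by exact: cmeas_ifourier.
transitivity ((C1 ^- 2)%:E * (((2 * pi) ^+ m.+1)%:E * sqnorm mu F))%E.
  rewrite -P -ge0_integralZl_EFin//.
  - apply: eq_integral => x _; rewrite E cabsM cabs_creal exprMn real_normK ?num_real//.
    by rewrite exprVn EFinM.
  - by move=> x _; rewrite lee_fin sqr_ge0.
  - exact: measurable_cabs2.
  - by rewrite invr_ge0 sqr_ge0.
rewrite muleA -EFinM -ge0_integralZl_EFin//.
- apply: eq_integral => xi _; rewrite -EFinM; congr EFin.
  rewrite /F /fourier1 !cabsM !cabs_creal !exprMn !real_normK ?num_real//.
  rewrite kappa_sqr powR_2pi_sqr /C1 -exprM mulnC exprM sqr_sqrtr ?mulr_ge0 ?pi_ge0//.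
  rewrite !exprMn (_ : 4 = 2 * 2 :> R); last by ring.
  by rewrite exprMn; field; rewrite ?expf_neq0 ?gt_eqF ?pi_gt0.
- by move=> x _; rewrite lee_fin sqr_ge0.
- exact: measurable_cabs2.
- by rewrite mulr_ge0 ?invr_ge0 ?sqr_ge0// exprn_ge0// mulr_ge0// pi_ge0.
Qed.

Section square_integrable.
Variables (f g : tup R m -> R[i]).
Hypothesis mf : cmeas f.
Hypothesis f2 : (sqnorm mu f < +oo)%E.
Hypothesis mg : cmeas g.

Definition trunc (k : nat) u : R[i] := if vnorm u < k%:R then f u else 0.

Hypothesis fg : (fun k => sqnorm mu (fun xi => g xi - fourier1 (trunc k) xi)) @ \oo --> 0%E.

Lemma integrable_f2 : mu.-integrable setT (fun u => (cabs (f u) ^+ 2)%:E).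
Proof.
apply: ge0_integrable => //.
  by apply: measurable_funX; exact: measurable_cabs.
by move=> u; exact: sqr_ge0.
Qed.

Lemma cmeas_trunc k : cmeas (trunc k).
Proof.
apply: cmeas_if => //.
apply: measurable_fun_ltr => //.
exact: measurable_vnorm.
Qed.

Lemma cabs_trunc k u : cabs (trunc k u) <= cabs (f u).
Proof. by rewrite /trunc; case: ifP => // _; rewrite cabs0 cabs_ge0. Qed.

(** On the ball of radius k, |f| <= |f|^2 + 1 and 1 <= e^(k^2 - |u|^2): a Gaussian replaces the
    indicator of the ball, whose volume is then never computed. *)
Lemma cintegrable_trunc k : cintegrable mu (trunc k).
Proof.
apply: (cintegrable_le (s := fun u =>
    cabs (f u) ^+ 2 + expR (k%:R ^+ 2) * gaussr 1 u)).
- exact: cmeas_trunc.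
- move=> u; rewrite /trunc; case: ifPn => [uk|_]; last first.
    by rewrite cabs0 addr_ge0 ?sqr_ge0// mulr_ge0 ?expR_ge0.
  have h : 1 <= expR (k%:R ^+ 2) * gaussr 1 u.
    rewrite /gaussr -expRD -[X in X <= _]expR0 ler_expR mul1r subr_ge0 -vnorm_sqr.
    by rewrite !expr2; apply: ler_pM; rewrite ?vnorm_ge0// ltW.
  apply: le_trans (_ : cabs (f u) ^+ 2 + 1 <= _); last by rewrite lerD2l.
  have := sqr_ge0 (cabs (f u) - 2^-1); have := cabs_ge0 (f u); nra.
- by apply: rintegrableD; [exact: integrable_f2|apply: rintegrableZ; exact: integrable_gaussr].
Qed.

(** The kernel is bounded as well as integrable, hence square integrable, and the product is
    dominated by the sum of the two squares. *)
Lemma cintegrable_conv x : cintegrable mu (fun u => f u * qk (vaff x (-1) u)).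
Proof.
have qi : cintegrable mu (fun u => qk (vaff x (-1) u)).
  apply: cintegrable_vaff; first by rewrite oppr_eq0 oner_neq0.
  exact: cintegrable_qker.
apply: (cintegrable_le (s := fun u =>
    cabs (f u) ^+ 2 + qbound lam a y * cabs (qk (vaff x (-1) u)))).
- by apply: cmeasM => //; exact: cintegrable_meas qi.
- move=> u; rewrite cabsM.
  have := cabs_qker lam0 ya (vaff x (-1) u).
  have := cabs_ge0 (f u); have := cabs_ge0 (qk (vaff x (-1) u)).
  move: (cabs (f u)) (cabs _) (qbound _ _ _) => s q B q0 s0 qB.
  apply: le_trans (_ : s ^+ 2 + q * q <= _); last first.
    by rewrite lerD2l ler_wpM2r.
  have := sqr_ge0 (s - q); nra.
- by apply: rintegrableD; [exact: integrable_f2|apply: rintegrableZ; exact: cintegrable_cabs].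
Qed.

Lemma cmeas_conv_integrand h x : cmeas h ->
  cmeas (fun u => h u * qk (vaff x (-1) u)).
Proof.
move=> mh; apply: cmeasM => //.
apply: (cmeas_comp (cintegrable_meas (cintegrable_qker lam0 ya))).
exact: measurable_vaff.
Qed.

Lemma cmeas_conv h : cmeas h -> cmeas (conv h).
Proof.
move=> mh; apply: (@cmeas_CI1 _ _ (tup R m) (tup R m) R mu
  (fun x u => h u * qk (vaff x (-1) u))).
apply: cmeasM; first exact: (cmeas_comp mh measurable_snd).
apply: (cmeas_comp (cintegrable_meas (cintegrable_qker lam0 ya))).
exact: measurable_vaff.
Qed.

Lemma cabs_conv_trunc_le k x u :
  cabs (trunc k u * qk (vaff x (-1) u)) <= cabs (f u * qk (vaff x (-1) u)).
Proof. by rewrite !cabsM ler_wpM2r ?cabs_ge0// cabs_trunc. Qed.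

Lemma cintegrable_conv_trunc k x : cintegrable mu (fun u => trunc k u * qk (vaff x (-1) u)).
Proof.
apply: (cintegrable_le _ (cabs_conv_trunc_le k x) (cintegrable_cabs (cintegrable_conv x))).
by apply: cmeas_conv_integrand; exact: cmeas_trunc.
Qed.

Lemma conv_trunc_limit x : ccvg (fun k => conv (trunc k) x) (conv f x).
Proof.
apply: (ccvg_dominated _ _ _ (cintegrable_cabs (cintegrable_conv x))).
- by move=> k; exact: cintegrable_meas (cintegrable_conv_trunc k x).
- exact: cmeas_conv_integrand.
- move=> u; apply: ccvgM; last exact: ccvg_cst.
  have ev : \forall k \near \oo, f u = trunc k u.
    near=> k; rewrite /trunc ifT//; near: k.
    exists (Num.truncn (vnorm u)).+1 => // k /= uk.
    by rewrite (lt_le_trans (truncnS_gt _))// ler_nat.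
  split; apply: cvg_near_cst; apply: filterS ev => k <- //.
- by move=> k u; exact: cabs_conv_trunc_le.
Unshelve. all: by end_near. Qed.

(** Passage to the limit in [conv_L1] along truncations of f, by [mean_square_limit]: the
    convolutions converge pointwise, and the spectral sides in mean since [hker] is bounded. *)
Lemma slice_identity : sqnorm mu (conv f) =
  sqnorm mu (fun xi => creal kappa * (g xi * hk xi)).
Proof.
have mh := cintegrable_meas cintegrable_hk.
have mF1 h : cmeas h -> cmeas (fun xi => creal kappa * (fourier1 h xi * hk xi)).
  move=> mh'; apply: cmeasM; first exact: cmeas_cst.
  apply: cmeasM => //; apply: cmeasM; first exact: cmeas_cst.
  exact: cmeas_fourier0.
apply: (@mean_square_limit _ _ _ mu (fun k => conv (trunc k))
  (fun k xi => creal kappa * (fourier1 (trunc k) xi * hk xi))).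
- by move=> k; apply: cmeas_conv; exact: cmeas_trunc.
- by move=> k; apply: mF1; exact: cmeas_trunc.
- exact: cmeas_conv.
- by apply: cmeasM; [exact: cmeas_cst|exact: cmeasM].
- exact: conv_trunc_limit.
- move=> k l; have ti := cintegrableB (cintegrable_trunc k) (cintegrable_trunc l).
  have := conv_L1 ti.
  rewrite (_ : conv _ = (fun x => conv (trunc k) x - conv (trunc l) x)); last first.
    apply/funext => x; rewrite /conv -CIB; try exact: cintegrable_conv_trunc.
    by apply: eq_CI => u; rewrite mulrBl.
  move=> ->; apply: eq_integral => xi _; congr (cabs _ ^+ 2)%:E.
  rewrite /fourier1 /fourier0.
  rewrite (@eq_CI _ _ _ _ _ (fun u => trunc k u * cphase (- dotp u xi) -
     trunc l u * cphase (- dotp u xi))); last by move=> u; rewrite mulrBl.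
  rewrite CIB; last 2 first.
  + exact: (cintegrable_fourier0 xi (cintegrable_trunc k)).
  + exact: (cintegrable_fourier0 xi (cintegrable_trunc l)).
  by ring.
- by move=> k; apply: conv_L1; exact: cintegrable_trunc.
(* Multiplication by kappa times [hker] increases squared norms by at most the factor [c]; dividing
   by c + 1 stays legitimate when c = 0. *)
- pose c := (kappa * hbound lam a y) ^+ 2.
  have c0 : 0 <= c by exact: sqr_ge0.
  move=> e e0.
  have e1 : 0 < e / (c + 1) by rewrite divr_gt0// ltr_wpDl.
  have [k _ hk_] : \forall k \near \oo,
      (sqnorm mu (fun xi => g xi - fourier1 (trunc k) xi)%R <= (e / (c + 1))%:E)%E.
    have := (fine_cvgP _ _).1 fg; move=> [ff fl].
    have fe : \forall k \near \oo, `|0 - fine (sqnorm mu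
        (fun xi => g xi - fourier1 (trunc k) xi)%R)| <= e / (c + 1).
      by have /cvgrPdist_le := fl; exact.
    apply: filterS (filterI ff fe) => k [fk]; rewrite sub0r normrN /= => h.
    by rewrite -(fineK fk) lee_fin (le_trans _ h)// ler_norm.
  exists k => l kl.
  apply: (@le_trans _ _ (c%:E * sqnorm mu (fun xi => g xi - fourier1 (trunc l) xi)%R)%E).
    rewrite -ge0_integralZl_EFin//.
    + apply: ge0_le_integral => //.
      * by move=> xi _; rewrite lee_fin sqr_ge0.
      * apply: measurable_cabs2; apply: cmeasB.
          by apply: cmeasM; [exact: cmeas_cst|exact: cmeasM].
        by apply: mF1; exact: cmeas_trunc.
      * apply: measurable_funeM; apply: measurable_cabs2; apply: cmeasB => //.
        apply: cmeasM; first exact: cmeas_cst.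
        by apply: cmeas_fourier0; exact: cmeas_trunc.
      * move=> xi _; rewrite -mulrBr -mulrBl cabsM cabs_creal cabsM -EFinM lee_fin.
        rewrite -exprMn -[X in X <= _]real_normK ?num_real//.
        rewrite -[X in _ <= X]real_normK ?num_real// !normrM normr_id !(ger0_norm (cabs_ge0 _)).
        rewrite lerXn2r ?nnegrE ?mulr_ge0 ?cabs_ge0//.
        rewrite -mulrA ler_wpM2l// mulrC ler_wpM2r ?cabs_ge0//.
        by rewrite (le_trans (cabs_hker lam0 ya _))// ler_norm.
    + by move=> xi _; rewrite lee_fin sqr_ge0.
    + apply: measurable_cabs2; apply: cmeasB => //.
      apply: cmeasM; first exact: cmeas_cst.
      by apply: cmeas_fourier0; exact: cmeas_trunc.
  apply: (@le_trans _ _ (c%:E * (e / (c + 1))%:E)%E).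
    by apply: lee_wpmul2l; [rewrite lee_fin|exact: hk_].
  rewrite -EFinM lee_fin mulrA ler_pdivrMr ?ltr_wpDl//; nra.
Qed.

End square_integrable.
End convolution.

(** * The exponential integral over the ball *)

Section nonnegative_series.
Variable R : realType.
Implicit Types (a b : nat -> R) (s : R).
Local Open Scope ereal_scope.

Lemma nneseries_shift a s : (forall k, (0 <= a k)%R) -> (0 <= s)%R ->
  \sum_(0 <= k <oo) (a k * s ^+ k)%:E =
  (a 0%N)%:E + s%:E * \sum_(0 <= k <oo) (a k.+1 * s ^+ k)%:E.
Proof.
move=> a0 s0.
rewrite nneseries_recl//; last by move=> k _; rewrite lee_fin mulr_ge0// exprn_ge0.
rewrite mulr1; congr (_ + _).
rewrite -nneseriesZl; last by move=> k _; rewrite lee_fin mulr_ge0// exprn_ge0.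
rewrite -nneseries_addn; last by move=> k; rewrite lee_fin mulr_ge0// exprn_ge0.
by apply: eq_eseriesr => k _; rewrite addn1 -EFinM exprS mulrCA.
Qed.

(** As s tends to 0 only the constant terms survive: for s <= 1 the rest of the b-series is at most
    s times its tail sum [T] at 1. *)
Lemma nneseries_head_le a b : (forall k, (0 <= a k)%R) -> (forall k, (0 <= b k)%R) ->
  \sum_(0 <= k <oo) (b k)%:E < +oo ->
  (forall s, (0 < s <= 1)%R -> \sum_(0 <= k <oo) (a k * s ^+ k)%:E =
     \sum_(0 <= k <oo) (b k * s ^+ k)%:E) -> (a 0%N <= b 0%N)%R.
Proof.
move=> a0 b0 bf ab; apply/ler_addgt0Pr => e e0.
set T := \sum_(0 <= k <oo) (b k.+1)%:E.
have T0 : 0 <= T by apply: nneseries_ge0 => k _ _; rewrite lee_fin.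
have Tf : T \is a fin_num.
  rewrite ge0_fin_numE//; apply: le_lt_trans bf.
  rewrite [leRHS]nneseries_recl//; last by move=> k _; rewrite lee_fin.
  rewrite /T (eq_eseriesr (g := fun k => (b (k + 1)%N)%:E)).
    rewrite (nneseries_addn (f := fun k => (b k)%:E))//.
    by rewrite leeDr// lee_fin.
  by move=> k _; rewrite addn1.
pose s := Num.min 1%R (e / (fine T + 1))%R.
have T1 : (0 < fine T + 1)%R by rewrite ltr_wpDl// fine_ge0.
have s01 : (0 < s <= 1)%R.
  by rewrite /s lt_min ltr01 divr_gt0//= ge_min lexx.
have [s0 s1] := andP s01.
rewrite -lee_fin; apply: (@le_trans _ _ (\sum_(0 <= k <oo) (a k * s ^+ k)%:E)).
  rewrite nneseries_shift ?(ltW s0)// leeDl// mule_ge0 ?lee_fin ?(ltW s0)//.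
  by apply: nneseries_ge0 => k _ _; rewrite lee_fin mulr_ge0// exprn_ge0// ltW.
rewrite ab// nneseries_shift ?(ltW s0)// EFinD leeD2l//.
apply: (@le_trans _ _ (s%:E * T)).
  apply: lee_wpmul2l; first by rewrite lee_fin ltW.
  apply: lee_nneseries => k _ /=; rewrite lee_fin.
    by rewrite mulr_ge0// exprn_ge0// ltW.
  by rewrite ler_piMr// exprn_ile1// ltW.
rewrite -(fineK Tf) -EFinM lee_fin.
apply: (@le_trans _ _ (e / (fine T + 1) * fine T)%R).
  by rewrite ler_wpM2r ?fine_ge0// /s ge_min lexx orbT.
rewrite mulrAC ler_pdivrMr// ler_wpM2l ?(ltW e0)// lerDl//.
Qed.

(** Once the heads agree, subtracting them and dividing by s reproduces the hypotheses for the
    shifted sequences. *)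
Lemma nneseries_unique a b : (forall k, (0 <= a k)%R) -> (forall k, (0 <= b k)%R) ->
  \sum_(0 <= k <oo) (a k)%:E < +oo -> \sum_(0 <= k <oo) (b k)%:E < +oo ->
  (forall s, (0 < s <= 1)%R -> \sum_(0 <= k <oo) (a k * s ^+ k)%:E =
     \sum_(0 <= k <oo) (b k * s ^+ k)%:E) -> forall k, a k = b k.
Proof.
move=> a0 b0 af bf ab k; elim: k a b a0 b0 af bf ab => [|k IH] a b a0 b0 af bf ab.
  apply/eqP; rewrite eq_le; apply/andP; split; apply: nneseries_head_le => // s s01.
  by rewrite ab.
have ab0 : a 0%N = b 0%N.
  apply/eqP; rewrite eq_le; apply/andP; split; apply: nneseries_head_le => // s s01.
  by rewrite ab.
have fin (c : nat -> R) : (forall k, (0 <= c k)%R) -> \sum_(0 <= k <oo) (c k)%:E < +oo ->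
    \sum_(0 <= k <oo) (c k.+1)%:E < +oo.
  move=> c0; apply: le_lt_trans.
  have := @nneseries_shift c 1 c0 ler01.
  rewrite (eq_eseriesr (g := fun k => (c k)%:E)); last by move=> j _; rewrite expr1n mulr1.
  rewrite (eq_eseriesr (f := fun k => (c k.+1 * 1 ^+ k)%:E) (g := fun k => (c k.+1)%:E));
    last by move=> j _; rewrite expr1n mulr1.
  by rewrite mul1e => ->; rewrite leeDr// lee_fin.
apply: (IH (fun k => a k.+1) (fun k => b k.+1)) => //; [exact: fin|exact: fin|].
move=> s s01; have [s0 s1] := andP s01.
have := ab s s01.
  rewrite (nneseries_shift a0 (ltW s0)) (nneseries_shift b0 (ltW s0)) ab0.
move=> /(congr1 (fun x => (x - (b 0%N)%:E))).
rewrite ![(b 0%N)%:E + _]addeC !addeK// => /(congr1 (fun x => (s^-1)%:E * x)).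
by rewrite !muleA -EFinM mulVf ?gt_eqF// !mul1e.
Qed.

Lemma nneseries_cvg a (l : R) : (forall k, (0 <= a k)%R) ->
  series a @ \oo --> l -> \sum_(0 <= k <oo) (a k)%:E = l%:E.
Proof.
move=> a0 al; apply: cvg_lim => //.
rewrite (_ : (fun n => _) = EFin \o series a); last first.
  by apply/funext => n; rewrite /= /series /= sumEFin.
by apply: cvg_EFin; [exact: nearW|exact: al].
Qed.

Lemma series_nneseries a (l : R) : (forall k, (0 <= a k)%R) ->
  \sum_(0 <= k <oo) (a k)%:E = l%:E -> limn (series a) = l.
Proof.
move=> a0 al; apply: cvg_lim => //.
have : (fun n => \sum_(0 <= k < n) (a k)%:E) @ \oo --> l%:E.
  have := @is_cvg_nneseries R (fun k => (a k)%:E) xpredT 0%N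
    (fun k _ _ => (a0 k : 0 <= (a k)%:E)).
  by rewrite al.
move=> /fine_cvgP[_]; rewrite (_ : fine \o _ = series a)//.
by apply/funext => n; rewrite /= sumEFin.
Qed.

Lemma nneseries_cosh (x : R) :
  \sum_(0 <= k <oo) (x ^+ k.*2 / (k.*2)`!%:R)%:E =
  ((expR x + expR (- x)) / 2)%:E.
Proof.
apply: nneseries_cvg.
  by move=> k; rewrite divr_ge0// -mul2n mulnC exprM sqr_ge0.
pose u (k : nat) : R := ((exp_coeff x k + exp_coeff (- x) k) / 2)%R.
have hs : series u @ \oo --> ((expR x + expR (- x)) / 2)%R.
  rewrite (_ : series u = fun n => ((series (exp_coeff x) n +
      series (exp_coeff (- x)) n) / 2)%R); last first.
    apply/funext => n; rewrite /series /= -big_split/= mulr_suml.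
    by apply: eq_bigr.
  by apply: cvgM; [apply: cvgD; exact: is_cvg_series_exp_coeff|exact: cvg_cst].
(* In [u], the average of the series of e^x and e^(-x), odd terms cancel; the partial sums wanted
   are its partial sums of even length. *)
rewrite (_ : series _ = series u \o double).
  by apply: cvg_comp hs; apply/cvgnyPge => N; near=> n;
    rewrite -addnn (leq_trans _ (leq_addr _ _))//; near: n; exact: nbhs_infty_ge.
apply/funext => n /=; rewrite /series /=; elim: n => [|n IH].
  by rewrite !big_geq.
rewrite big_nat_recr//= IH doubleS !big_nat_recr//= -addrA; congr (_ + _)%R.
have e1 : ((- x) ^+ n.*2 = x ^+ n.*2)%R by rewrite -mul2n !exprM sqrrN.
have e2 : ((- x) ^+ n.*2.+1 = - x ^+ n.*2.+1)%R by rewrite !exprS e1 mulNr.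
rewrite /u /exp_coeff /= e1 e2.
have h (p q : R) : ((p + p) / 2 + (q - q) / 2 = p)%R by field.
by rewrite mulNr h.
Unshelve. all: by end_near. Qed.

Lemma nneseries_exp (x : R) : (0 <= x)%R ->
  \sum_(0 <= k <oo) (x ^+ k / k`!%:R)%:E = (expR x)%:E.
Proof.
move=> x0; apply: nneseries_cvg => [k|]; first by rewrite divr_ge0// exprn_ge0.
exact: is_cvg_series_exp_coeff.
Qed.

End nonnegative_series.

Section ball_transform.
Variables (R : realType) (m : nat) (alpha : R).
Hypothesis alpha0 : 0 < alpha.
Implicit Types (v xi x : tup R m) (t rho : R) (k : nat).
Local Notation mu := (mu R m).
Local Notation beta := (alpha + m.+1%:R / 2 - 1).

Lemma ge0_integral_rGamma (z : R) : 0 < z ->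
  (\int[leb R]_rho (if 0 < rho then powR rho (z - 1) * expR (- rho) else 0)%:E =
   (rGamma z)%:E)%E.
Proof.
move=> z0.
transitivity (\int[@lebesgue_measure R]_(t in [set t | (0 < t)%R])
   (expR ((z - 1) * ln t - t) * cos (0 * ln t))%:E)%E.
  rewrite [RHS]integral_mkcond; apply: eq_integral => t _; rewrite patchE.
  have -> : (t \in [set t | 0 < t]) = (0 < t) by apply/idP/idP; rewrite inE.
  by case: ifPn => // t0; rewrite mul0r cos0 mulr1 expRD /powR gt_eqF.
rewrite ge0_integral_exp; last 2 first.
- by move=> t t0; apply: continuous_exp_cos => //; exact: continuous_cos.
- by move=> t; rewrite mul0r cos0 mulr1 expR_ge0.
transitivity (\int[leb R]_u (expR (z * u - expR u))%:E)%E.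
  apply: eq_integral => u _; rewrite mul0r cos0 mulr1 expRK -expRD.
  by congr (expR _)%:E; ring.
by rewrite rGammaE fineK//; exact: integrable_fin_num (integrable_rGamma z0).
Qed.

Lemma dotp_scale t v x : dotp (vaff (v0 R m) t v) x = t * dotp v x.
Proof. by rewrite dotp_vaff dotp0 add0r. Qed.

Definition ballw v : R := if dotp v v < 1 then powR (1 - dotp v v) (alpha - 1) else 0.

Lemma ballw_ge0 v : 0 <= ballw v.
Proof. by rewrite /ballw; case: ifP => // _; exact: powR_ge0. Qed.

Lemma measurable_powR_comp d (T : measurableType d) (f : T -> R) (p : R) :
  measurable_fun setT f -> measurable_fun setT (fun w : T => powR (f w) p).
Proof. exact: (measurableT_comp (measurable_powR p)). Qed.

Lemma measurable_ballw : measurable_fun setT ballw.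
Proof.
apply: measurable_fun_ifT => //.
  by apply: measurable_fun_ltr => //; exact: measurable_dotp.
apply: measurable_powR_comp; apply: measurable_funB => //.
exact: measurable_dotp.
Qed.

Definition ballI xi : \bar R :=
  (\int[mu]_v (ballw v * expR (- (2 * dotp v xi)))%:E)%E.

(** The homogeneous part of degree 2k in the Taylor expansion of [ballI]. *)
Definition ballm k xi : \bar R :=
  (\int[mu]_v (ballw v * ((2 * dotp v xi) ^+ k.*2 / (k.*2)`!%:R))%:E)%E.

Lemma pow_even_ge0 (r : R) k : 0 <= r ^+ k.*2 / (k.*2)`!%:R.
Proof. by rewrite divr_ge0// -mul2n mulnC exprM sqr_ge0. Qed.

Lemma measurable_dotp1 xi : measurable_fun setT (fun v => 2 * dotp v xi).
Proof. by apply: measurable_funM => //; exact: measurable_dotp. Qed.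

Lemma measurable_ballI_integrand xi :
  measurable_fun setT (fun v => (ballw v * expR (- (2 * dotp v xi)))%:E).
Proof.
apply/measurable_EFinP; apply: measurable_funM; first exact: measurable_ballw.
apply: measurable_expR_comp; apply: measurable_funN; exact: measurable_dotp1.
Qed.

Lemma measurable_ballm_integrand k xi : measurable_fun setT
  (fun v => (ballw v * ((2 * dotp v xi) ^+ k.*2 / (k.*2)`!%:R))%:E).
Proof.
apply/measurable_EFinP; apply: measurable_funM; first exact: measurable_ballw.
apply: measurable_funM => //; apply: measurable_funX; exact: measurable_dotp1.
Qed.

Lemma ballm_ge0 k xi : (0 <= ballm k xi)%E.
Proof.
apply: integral_ge0 => v _; rewrite lee_fin mulr_ge0 ?ballw_ge0//.
exact: pow_even_ge0.
Qed.

Lemma ballI_ge0 xi : (0 <= ballI xi)%E.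
Proof. by apply: integral_ge0 => v _; rewrite lee_fin mulr_ge0 ?ballw_ge0// expR_ge0. Qed.

(* The odd part of the exponential integrates to zero by the symmetry of the ball. *)
Lemma ballI_series xi : ballI xi = (\sum_(0 <= k <oo) ballm k xi)%E.
Proof.
have opp : (\int[mu]_v (ballw v * expR (2 * dotp v xi))%:E)%E = ballI xi.
  rewrite [RHS](@ge0_integral_vaff _ _ (v0 R m) (-1)) ?oppr_eq0 ?oner_eq0//.
  - rewrite normrN1 expr1n mul1e; apply: eq_integral => v _.
    by rewrite /ballw !dotp_scale (dotpC v (vaff _ _ _)) !dotp_scale !mulN1r mulrN !opprK.
  - exact: measurable_ballI_integrand.
  - by move=> v; rewrite lee_fin mulr_ge0 ?ballw_ge0// expR_ge0.
have half : ballI xi = (\int[mu]_v (ballw v *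
    ((expR (2 * dotp v xi) + expR (- (2 * dotp v xi))) / 2))%:E)%E.
  transitivity ((2^-1)%:E * \int[mu]_v (ballw v * expR (2 * dotp v xi))%:E +
     (2^-1)%:E * ballI xi)%E.
    rewrite opp -ge0_muleDl ?lee_fin ?invr_ge0// -EFinD.
    by rewrite (_ : 2^-1 + 2^-1 = 1 :> R) ?mul1e//; field.
  rewrite /ballI -!ge0_integralZl_EFin ?invr_ge0//; last 4 first.
  - by move=> v _; rewrite lee_fin mulr_ge0 ?ballw_ge0// expR_ge0.
  - exact: measurable_ballI_integrand.
  - by move=> v _; rewrite lee_fin mulr_ge0 ?ballw_ge0// expR_ge0.
  - apply/measurable_EFinP; apply: measurable_funM; first exact: measurable_ballw.
    by apply: measurable_expR_comp; exact: measurable_dotp1.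
  rewrite -ge0_integralD//; last 4 first.
  - by move=> v _; rewrite lee_fin !mulr_ge0 ?invr_ge0 ?ballw_ge0// expR_ge0.
  - apply: measurable_funeM.
    apply/measurable_EFinP; apply: measurable_funM; first exact: measurable_ballw.
    by apply: measurable_expR_comp; exact: measurable_dotp1.
  - by move=> v _; rewrite lee_fin !mulr_ge0 ?invr_ge0 ?ballw_ge0// expR_ge0.
  - apply: measurable_funeM; exact: measurable_ballI_integrand.
  by apply: eq_integral => v _; rewrite -!EFinM -EFinD; congr EFin; field.
rewrite half -integral_nneseries//; last 2 first.
- by move=> k; exact: measurable_ballm_integrand.
- by move=> k v _; rewrite lee_fin mulr_ge0 ?ballw_ge0// pow_even_ge0.
apply: eq_integral => v _.
rewrite EFinM -nneseries_cosh -nneseriesZl//.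
by move=> k _; rewrite lee_fin pow_even_ge0.
Qed.

Lemma ballmZ k t xi : ballm k (vaff (v0 R m) t xi) = ((t ^+ k.*2)%:E * ballm k xi)%E.
Proof.
rewrite /ballm -ge0_integralZl_EFin//.
- apply: eq_integral => v _; rewrite -EFinM; congr EFin.
  rewrite (dotpC v (vaff _ _ _)) dotp_scale (dotpC xi v) [2 * (t * _)]mulrCA.
  by rewrite exprMn; ring.
- by move=> v _; rewrite lee_fin mulr_ge0 ?ballw_ge0// pow_even_ge0.
- exact: measurable_ballm_integrand.
- by rewrite -mul2n mulnC exprM sqr_ge0.
Qed.

Let ball_const : R := rGamma alpha * Num.sqrt pi ^+ m.+1.

(** The Jacobian rho^(n/2) of the dilation by sqrt rho meets rho^(alpha - 1) from the weight: this
    is the origin of the Bessel order [beta]. *)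
Lemma powR_sqrt_expn rho : 0 < rho ->
  Num.sqrt rho ^+ m.+1 * powR rho (alpha - 1) = powR rho beta.
Proof.
move=> r0; rewrite -powR12_sqrt ?(ltW r0)// -powR_mulrn ?powR_ge0// -powRrM.
rewrite -powRD; last by apply/implyP => _; rewrite gt_eqF.
by congr powR; field.
Qed.

(** At fixed rho the x-integral is a ball integral of radius sqrt rho. At fixed x, shifting rho by
    |x|^2 splits off Gamma(alpha) and leaves the Gaussian e^(-|x|^2 - 2 x.xi) with no cut-off.
    Tonelli equates the two. *)
Definition gint rho xi x : R := if dotp x x < rho then
  expR (- rho) * powR (rho - dotp x x) (alpha - 1) * expR (- (2 * dotp x xi)) else 0.

Lemma gint_ge0 rho xi x : 0 <= gint rho xi x.
Proof. by rewrite /gint; case: ifP => // _; rewrite !mulr_ge0 ?expR_ge0 ?powR_ge0. Qed.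

Lemma measurable_gint xi : measurable_fun setT
  (fun z : measurableTypeR R * tup R m => (gint z.1 xi z.2)%:E).
Proof.
have md : measurable_fun setT (fun z : measurableTypeR R * tup R m => dotp z.2 z.2).
  by apply: measurable_dotp; exact: measurable_snd.
have m1 : measurable_fun setT (fun z : measurableTypeR R * tup R m => z.1 : R).
  exact: measurable_fst.
apply/measurable_EFinP; apply: measurable_fun_ifT => //.
  exact: measurable_fun_ltr.
apply: measurable_funM; first apply: measurable_funM.
- by apply: measurable_expR_comp; exact: measurable_funN.
- by apply: measurable_powR_comp; exact: measurable_funB.
- apply: measurable_expR_comp; apply: measurable_funN; apply: measurable_funM => //.
  by apply: measurable_dotp => //; exact: measurable_snd.
Qed.

Lemma integral_gint_ball rho xi : 0 < rho ->
  (\int[mu]_x (gint rho xi x)%:E =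
   (expR (- rho) * powR rho beta)%:E * ballI (vaff (v0 R m) (Num.sqrt rho) xi))%E.
Proof.
move=> r0; have s0 : 0 < Num.sqrt rho by rewrite sqrtr_gt0.
rewrite (@ge0_integral_vaff _ _ (v0 R m) (Num.sqrt rho)) ?gt_eqF//; last 2 first.
- exact: (measurableT_comp (measurable_gint xi) (measurable_pair1 rho)).
- by move=> x; rewrite lee_fin gint_ge0.
rewrite (gtr0_norm s0) -powR_sqrt_expn// mulrCA EFinM -muleA; congr (_ * _)%E.
rewrite -ge0_integralZl_EFin//; last 3 first.
- by move=> v _; rewrite lee_fin mulr_ge0 ?ballw_ge0// expR_ge0.
- exact: measurable_ballI_integrand.
- by rewrite mulr_ge0 ?expR_ge0 ?powR_ge0.
apply: eq_integral => v _; rewrite -EFinM; congr EFin.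
have E : dotp (vaff (v0 R m) (Num.sqrt rho) v) (vaff (v0 R m) (Num.sqrt rho) v) =
    rho * dotp v v.
  rewrite dotp_scale dotpC dotp_scale mulrA -expr2.
  by rewrite sqr_sqrtr// ltW.
have E2 : dotp (vaff (v0 R m) (Num.sqrt rho) v) xi =
    dotp v (vaff (v0 R m) (Num.sqrt rho) xi).
  by rewrite dotp_scale (dotpC v (vaff _ _ _)) dotp_scale (dotpC xi).
rewrite /gint /ballw E E2.
rewrite -[X in _ < X]mulr1 ltr_pM2l//.
case: ifPn => v1; last by rewrite mul0r mulr0.
rewrite -[X in X - rho * _]mulr1 -mulrBr powRM ?(ltW r0) ?subr_ge0 ?(ltW v1)//.
ring.
Qed.

Lemma integral_gint_gamma xi x : (\int[leb R]_rho (gint rho xi x)%:E =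
  (rGamma alpha)%:E * (expR (- (1 * dotp x x) + dotp (vaff (v0 R m) (-2) xi) x))%:E)%E.
Proof.
rewrite (@ge0_integral_affine _ (dotp x x) 1) ?oner_eq0//; last 2 first.
- exact: (measurableT_comp (measurable_gint xi) (measurable_pair2 x)).
- by move=> rho; rewrite lee_fin gint_ge0.
rewrite normr1 mul1e -ge0_integral_rGamma// muleC -ge0_integralZl_EFin ?expR_ge0//.
- apply: eq_integral => rho _; rewrite -EFinM; congr EFin.
  rewrite /gint mul1r -[X in X < _]addr0 ltrD2l; case: ifPn => r0; last by rewrite mulr0.
  rewrite dotp_scale (dotpC xi) mul1r [_ + rho]addrC addrK.
  rewrite opprD !expRD mulNr; ring.
- move=> rho _; rewrite lee_fin; case: ifP => // _.
  by rewrite mulr_ge0 ?powR_ge0 ?expR_ge0.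
- apply/measurable_EFinP; apply: measurable_fun_ifT => //.
    exact: measurable_fun_ltr.
  apply: measurable_funM; first exact: measurable_powR.
  by apply: measurable_expR_comp; exact: measurable_funN.
Qed.

Lemma integral_ballI xi :
  (\int[leb R]_rho (if (0 < rho)%R then (expR (- rho) * powR rho beta)%:E *
     ballI (vaff (v0 R m) (Num.sqrt rho) xi) else 0) =
   (ball_const * expR (dotp xi xi))%:E)%E.
Proof.
transitivity (\int[leb R]_rho \int[mu]_x (gint rho xi x)%:E)%E.
  apply: eq_integral => rho _; case: ifPn => r0; first by rewrite integral_gint_ball.
  rewrite integral0_eq// => x _; rewrite /gint ltNge (le_trans _ (dotp_ge0 x))//.
  by rewrite leNgt.
rewrite -(@integral_prodm1 _ _ _ _ _ (leb R) mu (fun z => (gint z.1 xi z.2)%:E)); last 2 first.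
- exact: measurable_gint.
- by move=> z; rewrite lee_fin gint_ge0.
rewrite integral_prodm2; last 2 first.
- exact: measurable_gint.
- by move=> z; rewrite lee_fin gint_ge0.
under eq_integral do rewrite integral_gint_gamma.
rewrite ge0_integralZl_EFin//; last 2 first.
- apply/measurable_EFinP; apply: measurable_expR_comp; apply: measurable_funD.
    by apply: measurable_funN; apply: measurable_funM => //; exact: measurable_dotp.
  exact: measurable_dotp.
- by rewrite ltW// rGamma_gt0.
rewrite ge0_gauss_space// divr1 -EFinM /ball_const mulrA; congr (_ * expR _)%:E.
by rewrite dotp_scale dotpC dotp_scale; field.
Qed.

(** The radial integral of [integral_ballI] again, now expanded: by homogeneity the term of degree
    2k carries rho^k, so each radial integral is a value of Gamma. *)
Lemma integral_ballm xi :
  (\int[leb R]_rho (if (0 < rho)%R then (expR (- rho) * powR rho beta)%:E *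
     ballI (vaff (v0 R m) (Num.sqrt rho) xi) else 0) =
   \sum_(0 <= k <oo) (rGamma (k%:R + beta + 1))%:E * ballm k xi)%E.
Proof.
have b1 k : 0 < k%:R + beta + 1.
  have -> : k%:R + beta + 1 = alpha + (k%:R + m.+1%:R / 2) by ring.
  by rewrite ltr_wpDr// addr_ge0// divr_ge0.
have me k : measurable_fun setT (fun rho : measurableTypeR R =>
    (if 0 < rho then powR rho ((k%:R + beta + 1) - 1) * expR (- rho) else 0)%:E).
  apply/measurable_EFinP; apply: measurable_fun_ifT => //.
    exact: measurable_fun_ltr.
  apply: measurable_funM; first exact: measurable_powR.
  by apply: measurable_expR_comp; exact: measurable_funN.
have pos k (rho : R) :
    0 <= if 0 < rho then powR rho ((k%:R + beta + 1) - 1) * expR (- rho) else 0.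
  by case: ifP => // _; rewrite mulr_ge0 ?powR_ge0 ?expR_ge0.
transitivity (\int[leb R]_rho \sum_(0 <= k <oo)
  ((if 0 < rho then powR rho ((k%:R + beta + 1) - 1) * expR (- rho) else 0)%R%:E *
     ballm k xi))%E.
  apply: eq_integral => rho _; case: ifPn => r0; last first.
    by rewrite eseries0// => k _ _; rewrite mul0e.
  rewrite ballI_series -nneseriesZl; last by move=> k _; exact: ballm_ge0.
  apply: eq_eseriesr => k _; rewrite ballmZ muleA -EFinM; congr (_%:E * _)%E.
  rewrite -mulrA mulrC; congr (_ * _).
  rewrite -mul2n exprM sqr_sqrtr ?(ltW r0)//.
  rewrite -powR_mulrn ?(ltW r0)// -powRD; last by apply/implyP => _; rewrite gt_eqF.
  by congr powR; ring.
rewrite integral_nneseries//; last 2 first.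
- by move=> k; apply: emeasurable_funM.
- by move=> k rho _; rewrite mule_ge0 ?lee_fin ?ballm_ge0.
apply: eq_eseriesr => k _.
rewrite ge0_integralZr ?ballm_ge0//; last by move=> rho _; rewrite lee_fin.
by rewrite ge0_integral_rGamma.
Qed.

Lemma order_gt0 k : 0 < k%:R + beta + 1.
Proof.
have -> : k%:R + beta + 1 = alpha + (k%:R + m.+1%:R / 2) by ring.
by rewrite ltr_wpDr// addr_ge0// divr_ge0.
Qed.

Lemma rGamma_order_gt0 k : 0 < rGamma (k%:R + beta + 1).
Proof. by rewrite rGamma_gt0// order_gt0. Qed.

Lemma rGamma_order_ge0 k : 0 <= rGamma (k%:R + beta + 1).
Proof. exact: ltW (rGamma_order_gt0 k). Qed.

Lemma ball_const_ge0 : 0 <= ball_const.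
Proof. by rewrite mulr_ge0// ?exprn_ge0 ?sqrtr_ge0// ltW// rGamma_gt0. Qed.

Lemma ballm_total xi :
  (\sum_(0 <= k <oo) (rGamma (k%:R + beta + 1))%:E * ballm k xi =
   (ball_const * expR (dotp xi xi))%:E)%E.
Proof. by rewrite -integral_ballm integral_ballI. Qed.

(** A single term with positive coefficient is bounded by the finite total of [ballm_total]. *)
Lemma ballm_fin_num k xi : ballm k xi \is a fin_num.
Proof.
have h : ((rGamma (k%:R + beta + 1))%:E * ballm k xi <=
    (ball_const * expR (dotp xi xi))%:E)%E.
  rewrite -ballm_total.
  rewrite (nneseriesD1 (n := k))//; last first.
    by move=> j _; rewrite mule_ge0 ?lee_fin ?ballm_ge0 ?rGamma_order_ge0.
  rewrite leeDl// nneseries_ge0// => j _ _.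
  by rewrite mule_ge0 ?lee_fin ?ballm_ge0 ?rGamma_order_ge0.
rewrite ge0_fin_numE ?ballm_ge0// ltey; apply/eqP => E; move: h.
by rewrite E gt0_muley ?lte_fin ?rGamma_order_gt0// leye_eq.
Qed.

(* Both sides of [ballm_total] are power series in t^2 after xi is replaced by t xi. *)
Lemma ballmE k xi : ballm k xi =
  (ball_const * (dotp xi xi ^+ k / (k`!%:R * rGamma (k%:R + beta + 1))))%:E.
Proof.
pose p j := rGamma (j%:R + beta + 1) * fine (ballm j xi).
pose q j := ball_const * (dotp xi xi ^+ j / j`!%:R).
have p0 j : 0 <= p j.
  by apply: mulr_ge0; [exact: rGamma_order_ge0|exact: fine_ge0 (ballm_ge0 _ _)].
have q0 j : 0 <= q j.
  apply: mulr_ge0; first exact: ball_const_ge0.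
  by rewrite divr_ge0// exprn_ge0// dotp_ge0.
have ps s : 0 <= s -> (\sum_(0 <= j <oo) (p j * s ^+ j)%:E =
    (ball_const * expR (s * dotp xi xi))%:E)%E.
  move=> s0; have := ballm_total (vaff (v0 R m) (Num.sqrt s) xi).
  rewrite dotp_scale (dotpC xi) dotp_scale mulrA -expr2 sqr_sqrtr// => <-.
  apply: eq_eseriesr => j _; rewrite ballmZ -(fineK (ballm_fin_num j xi)) -!EFinM.
  have -> : Num.sqrt s ^+ j.*2 = s ^+ j by rewrite -mul2n exprM sqr_sqrtr.
  by congr EFin; rewrite /p; ring.
have qs s : 0 <= s -> (\sum_(0 <= j <oo) (q j * s ^+ j)%:E =
    (ball_const * expR (s * dotp xi xi))%:E)%E.
  move=> s0; rewrite EFinM -nneseries_exp ?mulr_ge0 ?dotp_ge0//.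
  rewrite -nneseriesZl; last first.
    by move=> j _; rewrite lee_fin divr_ge0// exprn_ge0// mulr_ge0// dotp_ge0.
  by apply: eq_eseriesr => j _; rewrite /q -EFinM exprMn; congr EFin; ring.
have pq : p k = q k.
  apply: nneseries_unique => //.
  - have := ps 1 ler01; rewrite (eq_eseriesr (g := fun j => (p j)%:E)) => [->|j _].
      by rewrite ltry.
    by rewrite expr1n mulr1.
  - have := qs 1 ler01; rewrite (eq_eseriesr (g := fun j => (q j)%:E)) => [->|j _].
      by rewrite ltry.
    by rewrite expr1n mulr1.
  - by move=> s /andP[/ltW s0 _]; rewrite ps// qs.
rewrite -(fineK (ballm_fin_num k xi)); congr EFin.
apply: (mulfI (lt0r_neq0 (rGamma_order_gt0 k))); rewrite -/(p k) pq /q.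
have := rGamma_order_gt0 k; have : 0 < k`!%:R :> R by rewrite ltr0n fact_gt0.
move: (rGamma _) (k`!%:R) => A B B0 A0.
by field; rewrite !gt_eqF.
Qed.

(** On the unit ball -2 v.xi <= |v|^2 + |xi|^2 <= 1 + |xi|^2, so a multiple of the finite [ballm 0]
    is an upper bound. *)
Lemma ballI_fin_num xi : ballI xi \is a fin_num.
Proof.
rewrite ge0_fin_numE ?ballI_ge0//.
apply: (@le_lt_trans _ _ ((expR (1 + dotp xi xi))%:E * ballm 0 xi)%E); last first.
  by rewrite -(fineK (ballm_fin_num 0 xi)) -EFinM ltry.
rewrite /ballm -ge0_integralZl_EFin ?expR_ge0//; last 2 first.
- by move=> v _; rewrite lee_fin mulr_ge0 ?ballw_ge0// pow_even_ge0.
- exact: measurable_ballm_integrand.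
apply: ge0_le_integral => //.
- by move=> v _; rewrite lee_fin mulr_ge0 ?ballw_ge0// expR_ge0.
- exact: measurable_ballI_integrand.
- by apply: measurable_funeM; exact: measurable_ballm_integrand.
- move=> v _; rewrite -EFinM lee_fin double0 expr0 fact0 divr1 mulr1 mulrC.
  rewrite /ballw; case: ifPn => [v1|_]; last by rewrite mulr0 mulr0.
  rewrite ler_wpM2r ?powR_ge0// ler_expR.
  have := dotp_ge0 (vaff v 1 xi); rewrite dotp_vaff2; lra.
Qed.

(** By [ballmE] the series is that of I_beta(2|xi|) without its factor |xi|^beta. The factor 2^beta
    compensates for dividing by (2|xi|)^beta instead. *)
Lemma ballI_BesselI xi : 0 < vnorm xi -> ballI xi =
  (ball_const * powR 2 beta * (BesselI beta (2 * vnorm xi) / powR (2 * vnorm xi) beta))%:E.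
Proof.
move=> r0; set r := vnorm xi in r0 *.
pose u (k : nat) := r ^+ k.*2 / (k`!%:R * rGamma (k%:R + beta + 1)).
have u0 k : 0 <= u k.
  apply: divr_ge0; first by rewrite exprn_ge0// ltW.
  by apply: mulr_ge0 => //; exact: rGamma_order_ge0.
have c0 : 0 < ball_const.
  by rewrite mulr_gt0 ?rGamma_gt0// exprn_gt0// sqrtr_gt0 pi_gt0.
have E1 : (\sum_(0 <= k <oo) (u k)%:E = (fine (ballI xi) / ball_const)%:E)%E.
  rewrite mulrC EFinM fineK ?ballI_fin_num// ballI_series -nneseriesZl; last first.
    by move=> k _; exact: ballm_ge0.
  apply: eq_eseriesr => k _; rewrite ballmE -EFinM; congr EFin.
  by rewrite mulKf ?gt_eqF// /u -mul2n exprM vnorm_sqr.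
rewrite /BesselI.
have E2 : (\sum_(0 <= k <oo) (powR (2 * r / 2) (2 * k%:R + beta) /
    (k`!%:R * rGamma (k%:R + beta + 1)))%:E =
    (powR r beta * (fine (ballI xi) / ball_const))%:E)%E.
  rewrite [RHS]EFinM -E1 -nneseriesZl; last by move=> k _; rewrite lee_fin.
  apply: eq_eseriesr => k _.
  rewrite -EFinM /u; congr EFin; rewrite mulrA; congr (_ / _).
  rewrite [2 * r]mulrC mulfK// [LHS]powRD; last by apply/implyP => _; rewrite gt_eqF.
  have -> : 2 * k%:R = (k.*2)%:R :> R by rewrite -mul2n natrM.
  by rewrite mulrC powR_mulrn// ltW.
rewrite (series_nneseries _ E2); last first.
  move=> k; apply: divr_ge0; first exact: powR_ge0.
  by apply: mulr_ge0 => //; exact: rGamma_order_ge0.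
rewrite powRM ?(ltW r0)//.
rewrite -[LHS](fineK (ballI_fin_num xi)); congr EFin.
have := powR_gt0 beta r0; have := @powR_gt0 R 2 beta (ltr0Sn _ _).
move: (powR r _) (powR 2 _) c0 => A B c0 B0 A0.
by field; rewrite !gt_eqF.
Qed.

End ball_transform.

(** * The Macdonald function *)

Section macdonald.
Variable R : realType.
Implicit Types (h : R -> R) (lam : R[i]) (x t u : R).

(** Moves the half-line integral defining [BesselK] to the whole line, where translation is
    available. The two open half-lines miss the origin, which is a null set. *)
Lemma Rintegral_fold h : (leb R).-integrable setT (fun t => (h t)%:E) ->
  (\int[@lebesgue_measure R]_(t in [set t | (0 < t)%R]) (h t + h (- t)) =
   \int[leb R]_t h t)%R.
Proof.
move=> hi; have mh : measurable_fun setT h 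
  by apply/measurable_EFinP; exact: measurable_int hi.
have mb (b : R -> bool) : measurable_fun setT (b : measurableTypeR R -> bool) ->
    (leb R).-integrable setT (fun t => (if b t then h t else 0)%:E).
  move=> bm; apply: (@integrable_le _ (measurableTypeR R) R (leb R) _ (fun t => `|h t|)).
  - exact: measurable_fun_ifT.
  - by move=> t; case: ifP; rewrite ?normr0.
  - exact: integrable_abse hi.
have mp : measurable_fun setT (fun t : measurableTypeR R => (0 : R) < t).
  exact: measurable_fun_ltr.
have mn : measurable_fun setT (fun t : measurableTypeR R => t < (0 : R)).
  exact: measurable_fun_ltr.
have opp (f : R -> R) : (leb R).-integrable setT (fun t => (f t)%:E) ->
    (leb R).-integrable setT (fun t => (f (- t))%:E) /\
    (\int[leb R]_t f t = \int[leb R]_t f (- t))%R.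
  move=> fi; have n1 : (-1 : R) != 0 by rewrite oppr_eq0 oner_eq0.
  have E (t : R) : vaff (v0 R 0) (-1) (t : tup R 0) = - t by rewrite /= add0r mulN1r.
  split.
    have := @integrable_vaff R 0%N (v0 R 0) (-1) _ n1 fi.
    by congr (_.-integrable _ _); apply/funext => t; rewrite E.
  rewrite /Rintegral; congr fine.
  rewrite (@integral_vaff R 0%N (v0 R 0) (-1) (fun t => (f t)%:E) n1 fi).
  by rewrite normrN1 expr1n mul1e; apply: eq_integral => t _; rewrite E.
rewrite Rintegral_mkcond.
have [ni nE] := opp _ (mb _ mn).
transitivity (\int[leb R]_t ((if 0 < t then h t else 0) +
    (if - t < 0 then h (- t) else 0)))%R.
  apply: eq_Rintegral => t _; rewrite patchE oppr_lt0.
  have -> : (t \in [set t | 0 < t]) = (0 < t) by apply/idP/idP; rewrite inE.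
  by case: ifP => // _; rewrite addr0.
rewrite RintegralD//; last exact: mb.
rewrite -nE -RintegralD//; [|exact: mb|exact: mb].
have z0 : (\int[leb R]_t (if t == 0 then h t else 0) = 0)%R.
  rewrite -[RHS](@Rintegral_set1 R h 0) [RHS]Rintegral_mkcond.
  apply: eq_Rintegral => t _; rewrite patchE.
  by have -> : (t \in [set 0 : R]) = (t == 0) by apply/idP/idP; rewrite inE => /eqP.
have me : measurable_fun setT (fun t : measurableTypeR R => t == (0 : R)).
  exact: measurable_fun_eqr.
rewrite -[LHS]addr0 -[X in _ + X = _]z0 -RintegralD//.
- apply: eq_Rintegral => t _; case: (ltgtP 0 t) => t0.
  + by rewrite !addr0.
  + by rewrite add0r addr0.
  + by rewrite !add0r.
- by apply: rintegrableD; exact: mb.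
- exact: mb.
Qed.

Lemma cosh_ge_exp x t : 0 < x -> x / 2 * expR t <= x * rcosh t.
Proof.
move=> x0; rewrite (_ : x / 2 * expR t = x * (expR t / 2)); last by ring.
by rewrite /rcosh ler_wpM2l ?(ltW x0)// ler_wpM2r ?invr_ge0// lerDl expR_ge0.
Qed.

Definition Kint lam x t : R[i] := cexp (lam * creal t - creal (x * rcosh t)).

Lemma cintegrable_Kint lam x : 0 < Re lam -> 0 < x -> cintegrable (leb R) (Kint lam x).
Proof.
move=> l0 x0.
apply: (@cintegrable_le _ (measurableTypeR R) R (leb R) _
   (fun u => expR (Re lam * u - x / 2 * expR u))).
- apply: cmeas_cexp; apply: cmeasB.
    by apply: cmeasM; [exact: cmeas_cst|exact: cmeas_creal].
  apply: cmeas_creal; apply: measurable_funM => //; apply: measurable_funM => //.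
  apply: measurable_funD; first exact: measurable_expR_comp.
  by apply: measurable_expR_comp; exact: measurable_funN.
- move=> u; rewrite cabs_cexp cReB cReM (cRe_creal u) (cIm_creal u) cRe_creal.
  by rewrite mulr0 subr0 ler_expR lerD2l lerN2 cosh_ge_exp.
- by apply: integrable_exp_exp => //; rewrite divr_gt0.
Qed.

(** The two exponentials in cosh(lam t) are exchanged by t -> -t while the other factor is even, so
    the halves unfold into one exponential on the line. *)
Lemma BesselKE lam x : 0 < Re lam -> 0 < x ->
  CI (leb R) (Kint lam x) = 2 * BesselK lam x.
Proof.
move=> l0 x0; have Ki := cintegrable_Kint l0 x0.
have [K1 K2] : cintegrable (leb R) (fun t => creal 2^-1 * Kint lam x t).
  exact: cintegrableZ.
have E t : creal (expR (- (x * rcosh t))) * ccosh (lam * creal t) =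
    creal 2^-1 * Kint lam x t + creal 2^-1 * Kint lam x (- t).
  rewrite /Kint /ccosh /rcosh opprK (addrC (expR (- t))) crealN mulrN !cexpD.
  by rewrite -!crealN !cexp_creal crealV creal_nat; field.
have -> : BesselK lam x = CI (leb R) (fun t => creal 2^-1 * Kint lam x t).
  rewrite /BesselK /cint1 /CI; congr (_ +i* _).
    rewrite -Rintegral_fold//; apply: eq_Rintegral => t _.
    by rewrite E cReD.
  rewrite -Rintegral_fold//; apply: eq_Rintegral => t _.
  by rewrite E cImD.
by rewrite CIZ// mulrA crealV creal_nat divff ?mul1r// pnatr_eq0.
Qed.

(** Translating u by ln(r/(2a)) balances the two exponentials: e^u a^2 and e^(-u) r^2/4 become (a
    r/2) e^u and (a r/2) e^(-u), whose sum is a r cosh u. *)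
Lemma Qker_BesselK lam a r : 0 < Re lam -> 0 < a -> 0 < r ->
  Qker lam a (r ^+ 2) =
  2 * cexp (lam * creal (ln (r / (2 * a)))) * BesselK lam (a * r).
Proof.
move=> l0 a0 r0; set b := ln (r / (2 * a)).
have eb : expR b = r / (2 * a) by rewrite lnK// posrE divr_gt0// mulr_gt0.
have ebN : expR (- b) = 2 * a / r by rewrite expRN eb invf_div.
have x0 : 0 < a * r by rewrite mulr_gt0.
have Ki := cintegrable_Kint l0 x0.
have E u : cexp (lam * creal b) * Kint lam (a * r) (- b + 1 * u) =
    cexp (lam * creal u - creal (expR u * a ^+ 2 + expR (- u) * r ^+ 2 / 4)).
  rewrite /Kint -cexpD; congr cexp.
  rewrite addrA -mulrDr -crealD addrA mul1r addrN add0r; congr (_ - creal _).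
  rewrite /rcosh opprD opprK !expRD eb ebN.
  by field; rewrite !gt_eqF.
have Ki1 : cintegrable (leb R) (fun u => Kint lam (a * r) (- b + 1 * u)).
  exact: (@cintegrable_vaff R 0%N (- b) 1 _ (oner_neq0 _) Ki).
have tr : CI (leb R) (fun u => Kint lam (a * r) (- b + 1 * u)) =
    CI (leb R) (Kint lam (a * r)).
  have := @CI_vaff R 0%N (- b) 1 _ (oner_neq0 _) Ki.
  by rewrite normr1 expr1n creal1 mul1r => ->.
rewrite /Qker.
transitivity (CI (leb R) (fun u => cexp (lam * creal b) * Kint lam (a * r) (- b + 1 * u))).
  by apply: eq_CI => u; rewrite E.
have -> := @CIZ _ (measurableTypeR R) R (leb R) (cexp (lam * creal b)) _ Ki1.
by rewrite tr (BesselKE l0 x0) mulrCA mulrA.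
Qed.

Lemma cabs_Qker lam a r : 0 < Re lam -> 0 < a -> 0 < r ->
  cabs (Qker lam a (r ^+ 2)) ^+ 2 =
  4 * powR (r / (2 * a)) (2 * Re lam) * cabs (BesselK lam (a * r)) ^+ 2.
Proof.
move=> l0 a0 r0; rewrite Qker_BesselK// !cabsM cabs_cexp -creal_nat cabs_creal.
rewrite cReM cRe_creal cIm_creal mulr0 subr0 !exprMn normr_nat.
have b0 : 0 < r / (2 * a) by rewrite divr_gt0// mulr_gt0.
rewrite /powR gt_eqF//; congr (_ * _ * _); first by rewrite expr2 -natrM.
by rewrite [LHS]expr2 -expRD; congr expR; ring.
Qed.

End macdonald.

(** * Assembly of both sides *)

Section null_origin.
Variables (R : realType) (m : nat).
Local Notation mu := (mu R m).

Lemma measurable_origin : measurable [set x : tup R m | dotp x x = 0].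
Proof.
have -> : [set x : tup R m | dotp x x = 0] = (fun x => dotp x x) @^-1` [set 0] by [].
rewrite -[X in measurable X]setTI.
by have /(_ measurableT _ (measurable_set1 (0 : R))) :=
  @measurable_dotp R _ (tup R m) m id id (@measurable_id _ _ _) (@measurable_id _ _ _).
Qed.

(* The origin is invariant under dilations, which multiply the measure by 2^(m+1). *)
Lemma null_origin : mu [set x | dotp x x = 0] = 0%E.
Proof.
set A := [set x | _].
have mA : measurable A := measurable_origin.
pose I := (\int[mu]_x (\1_A x)%:E)%E.
have IE : I = mu A by rewrite /I integral_indic// setIT.
have sA (x : tup R m) : \1_A (vaff (v0 R m) 2 x) = \1_A x :> R.
  rewrite !indicE; have -> // : (vaff (v0 R m) 2 x \in A) = (x \in A).
  apply/idP/idP; rewrite !inE /A /= dotp_scale dotpC dotp_scale.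
    by move=> /eqP; rewrite !mulf_eq0 pnatr_eq0 /= => /eqP.
  by move=> ->; rewrite !mulr0.
have mI : measurable_fun setT (fun x : tup R m => (\1_A x : R)%:E).
  by apply/measurable_EFinP; exact: measurable_indic.
have I2 : I = ((2 ^+ m.+1)%:E * I)%E.
  rewrite {1}/I (@ge0_integral_vaff _ _ (v0 R m) 2)//.
    by rewrite normr_nat; congr (_ * _)%E; apply: eq_integral => x _; rewrite sA.
(* Finiteness is needed to deduce I = 0 from I = 2^(m+1) I. The Gaussian equals 1 at the origin, so
   its integral is an upper bound. *)
have Ioo : (I < +oo)%E.
  have gi := integrable_gaussr m (ltr01 : 0 < 1 :> R).
  have /integrableP[mg goo] := gi.
  apply: le_lt_trans goo; apply: ge0_le_integral => //.
  - exact: measurableT_comp.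
  - move=> x _; rewrite lee_fin indicE; case: (boolP (x \in A)) => xA; last first.
      by rewrite normr_ge0.
    move: xA; rewrite inE /A /= => xA.
    by rewrite /gaussr xA mulr0 oppr0 expR0 normr1.
have I0 : (0 <= I)%E by apply: integral_ge0 => x _; rewrite lee_fin indicE.
rewrite -IE; move: (I) I2 Ioo I0; case=> // r.
rewrite -EFinM => -[/eqP]; rewrite -subr_eq0 -{1}[r]mul1r -mulrBl mulf_eq0.
rewrite subr_eq0 => /orP[|/eqP -> //].
by rewrite eq_sym gt_eqF// exprn_egt1// ltr1n.
Qed.

End null_origin.

Section poisson.
Variables (R : realType) (m : nat) (lam : R[i]) (a : R).
Hypothesis lam0 : 0 < Re lam.
Hypothesis a0 : 0 < a.
Local Notation mu := (mu R m).
Local Notation half := (m.+1%:R / 2 : R).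

(** Gamma(lam + n/2) is absent because [Lap_pow] already places it inside [qker]. *)
Definition pconst : R[i] := creal (powR pi (- half)) / cGamma (2 * lam) *
  cpow (creal a) (lam + creal half).

Lemma lt_vnorm (y : tup R m) : (vnorm y < a) = (dotp y y < a ^+ 2).
Proof. by rewrite -vnorm_sqr ltr_pXn2r// nnegrE ?vnorm_ge0// ltW. Qed.

Lemma poissonCE (x y u : tup R m) : dotp y y < a ^+ 2 ->
  @poissonC R m.+1 lam a x y u = pconst * qker lam a y (vaff x (-1) u).
Proof.
move=> ya.
have w0 := Re_wker_gt0 ya (vaff x (-1) u).
rewrite /qker Lap_pow//; last exact: Re_shift_gt0.
rewrite /poissonC /pconst -cGammaE.
have -> : creal (a ^+ 2) + @csq R m.+1 x y u = wker a y (vaff x (-1) u).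
  rewrite /csq /wker -vsub_vaff; apply: complex_ext.
    by rewrite cReD cRe_creal /= addrA.
  by rewrite cImD cIm_creal /= add0r.
ring.
Qed.

Lemma phiC_conv (f : tup R m -> R[i]) (x y : tup R m) : dotp y y < a ^+ 2 ->
  cmeas f -> (sqnorm mu f < +oo)%E ->
  @phiC R m.+1 lam f a x y = pconst * conv lam a y f x.
Proof.
move=> ya mf f2; have ci := cintegrable_conv lam0 ya mf f2 x.
rewrite /phiC /conv -CIZ// -(cint_CI (cintegrableZ pconst ci)).
congr cint; apply/funext => u.
by rewrite poissonCE//; ring.
Qed.

Lemma cabs_pconst : cabs pconst ^+ 2 =
  (powR pi (- half) / cabs (cGamma (2 * lam))) ^+ 2 * powR a (2 * Re lam + m.+1%:R).
Proof.
rewrite /pconst !cabsM cabsV cabs_creal ger0_norm ?powR_ge0// exprMn; congr (_ * _).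
rewrite cpow_creal// cabs_cexp cReM cRe_creal cIm_creal mulr0 subr0 cReD cRe_creal.
by rewrite /powR gt_eqF// [LHS]expr2 -expRD; congr expR; field.
Qed.

Variables (f g : tup R m -> R[i]) (alpha : R).
Hypothesis alpha0 : 0 < alpha.
Hypothesis mf : cmeas f.
Hypothesis f2 : (sqnorm mu f < +oo)%E.
Hypothesis mg : cmeas g.
Hypothesis fg :
  (fun k => sqnorm mu (fun xi => g xi - fourier1 (trunc f k) xi)) @ \oo --> 0%E.

(** The part of the spectral density that is the same on all slices; the slice at height y
    multiplies it by e^(-2 y.xi). *)
Definition spec (xi : tup R m) : R :=
  cabs pconst ^+ 2 * pi ^+ m.+1 * cabs (g xi) ^+ 2 * cabs (Qker lam a (dotp xi xi)) ^+ 2.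

Lemma spec_ge0 xi : 0 <= spec xi.
Proof. rewrite /spec; apply: mulr_ge0; last exact: sqr_ge0.
apply: mulr_ge0; last exact: sqr_ge0.
by apply: mulr_ge0; [exact: sqr_ge0|rewrite exprn_ge0// pi_ge0]. Qed.

Lemma cmeas_Qker : cmeas (fun xi : tup R m => Qker lam a (dotp xi xi)).
Proof.
have ya : dotp (v0 R m) (v0 R m) < a ^+ 2 by rewrite dotp0 exprn_gt0.
have := cintegrable_meas (cintegrable_hk lam0 ya).
congr cmeas; apply/funext => xi.
by rewrite /hker dotp0 oppr0 expR0 creal1 mul1r.
Qed.

Lemma measurable_cabs_sqr (h : tup R m -> R[i]) : cmeas h ->
  measurable_fun setT (fun x => cabs (h x) ^+ 2).
Proof. by move=> mh; apply: measurable_funX; exact: measurable_cabs. Qed.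

Lemma measurable_spec : measurable_fun setT spec.
Proof.
apply: measurable_funM; first apply: measurable_funM => //.
  exact: measurable_cabs_sqr.
exact: (measurable_cabs_sqr cmeas_Qker).
Qed.

Definition slab (y xi : tup R m) : R := if dotp y y < a ^+ 2 then
  @bw R m.+1 alpha a y * (spec xi * expR (- (2 * dotp y xi))) else 0.

Lemma bw_ge0 (y : tup R m) : 0 <= @bw R m.+1 alpha a y.
Proof. by rewrite /bw !mulr_ge0 ?powR_ge0// invr_ge0 ltW// rGamma_gt0. Qed.

Lemma measurable_bw : measurable_fun setT (@bw R m.+1 alpha a).
Proof.
apply: measurable_funM => //; apply: measurable_powR_comp.
apply: measurable_funB => //; apply: measurable_funM => //.
exact: (@measurable_dotp R _ (tup R m) m id id).
Qed.

Lemma slab_ge0 y xi : 0 <= slab y xi.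
Proof.
rewrite /slab; case: ifP => // _; apply: mulr_ge0; first exact: bw_ge0.
by apply: mulr_ge0; [exact: spec_ge0|exact: expR_ge0].
Qed.

Lemma measurable_slab : measurable_fun setT
  (fun z : tup R m * tup R m => (slab z.1 z.2)%:E).
Proof.
have m1 : measurable_fun setT (fun z : tup R m * tup R m => z.1) by exact: measurable_fst.
have m2 : measurable_fun setT (fun z : tup R m * tup R m => z.2) by exact: measurable_snd.
apply/measurable_EFinP; apply: measurable_fun_ifT => //.
  by apply: measurable_fun_ltr => //; exact: measurable_dotp.
apply: measurable_funM; first exact: (measurableT_comp measurable_bw m1).
apply: measurable_funM; first exact: (measurableT_comp measurable_spec m2).
apply: measurable_expR_comp; apply: measurable_funN; apply: measurable_funM => //.
exact: measurable_dotp.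
Qed.

Lemma lhs_slice (y : tup R m) :
  @iint R m (fun x => (if @vnorm R m y < a then
     cabs (@phiC R m.+1 lam f a x y) ^+ 2 * @bw R m.+1 alpha a y else 0)%:E) =
  (\int[mu]_xi (slab y xi)%:E)%E.
Proof.
rewrite lt_vnorm; case: (boolP (dotp y y < a ^+ 2)) => ya; last first.
  rewrite ge0_iint// !integral0_eq// => xi _.
  by rewrite /slab (negbTE ya).
have mc := cmeas_conv lam0 ya mf.
have E x : cabs (@phiC R m.+1 lam f a x y) ^+ 2 * @bw R m.+1 alpha a y =
    (cabs pconst ^+ 2 * @bw R m.+1 alpha a y) * cabs (conv lam a y f x) ^+ 2.
  by rewrite phiC_conv// cabsM; ring.
under [X in iint X]eq_fun do rewrite E.
have cb0 : 0 <= cabs pconst ^+ 2 * @bw R m.+1 alpha a y.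
  by rewrite mulr_ge0 ?sqr_ge0 ?bw_ge0.
rewrite ge0_iint; last 2 first.
- apply/measurable_EFinP; apply: measurable_funM => //.
  exact: measurable_cabs_sqr.
- by move=> x; rewrite lee_fin mulr_ge0// sqr_ge0.
under eq_integral do rewrite EFinM.
rewrite ge0_integralZl_EFin//; last 2 first.
- by move=> x _; rewrite lee_fin sqr_ge0.
- by apply/measurable_EFinP; exact: measurable_cabs_sqr.
rewrite -/(sqnorm mu (conv lam a y f)) (slice_identity lam0 ya mf f2 mg fg).
rewrite /sqnorm -ge0_integralZl_EFin//; last 2 first.
- by move=> x _; rewrite lee_fin sqr_ge0.
- apply: measurable_cabs2; apply: cmeasM; first exact: cmeas_cst.
  by apply: cmeasM => //; exact: cintegrable_meas (cintegrable_hk lam0 ya).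
apply: eq_integral => xi _; rewrite -EFinM; congr EFin.
rewrite /slab ya /spec /hker !cabsM !cabs_creal !exprMn !real_normK ?num_real//.
rewrite kappa_sqr.
have -> : expR (- dotp y xi) ^+ 2 = expR (- (2 * dotp y xi)).
  by rewrite expr2 -expRD; congr expR; ring.
ring.
Qed.

Lemma lhs_intE : @lhs_int R m.+1 alpha lam f a =
  (\int[mu]_xi \int[mu]_y (slab y xi)%:E)%E.
Proof.
rewrite /lhs_int.
transitivity (iint (fun y => \int[mu]_xi (slab y xi)%:E)%E).
  by congr iint; apply/funext => y; exact: lhs_slice.
rewrite ge0_iint; last 2 first.
- apply: (measurable_fun_fubini_tonelli_F (m2 := mu)
    (fun z : tup R m * tup R m => (slab z.1 z.2)%:E)).
    exact: measurable_slab.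
  by move=> z; rewrite lee_fin slab_ge0.
- by move=> y; apply: integral_ge0 => xi _; rewrite lee_fin slab_ge0.
rewrite -(@integral_prodm1 _ _ _ _ _ mu mu (fun z => (slab z.1 z.2)%:E)); last 2 first.
- exact: measurable_slab.
- by move=> z; rewrite lee_fin slab_ge0.
rewrite integral_prodm2//; first exact: measurable_slab.
by move=> z; rewrite lee_fin slab_ge0.
Qed.

(** The dilation y = a v carries the tube weight to [ballw] on the unit ball and contributes a^n. *)
Lemma integral_slab xi : (\int[mu]_y (slab y xi)%:E =
  (spec xi * (powR (2 * pi) (- half) / rGamma alpha) * a ^+ m.+1)%:E *
  ballI alpha (vaff (v0 R m) a xi))%E.
Proof.
rewrite (@ge0_integral_vaff _ _ (v0 R m) a) ?gt_eqF//; last 2 first.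
- exact: (measurableT_comp measurable_slab (measurable_pair2 xi)).
- by move=> y; rewrite lee_fin slab_ge0.
rewrite gtr0_norm// [(spec xi * _ * _)%R]mulrC EFinM -muleA; congr (_ * _)%E.
rewrite /ballI -ge0_integralZl_EFin//; last 3 first.
- by move=> v _; rewrite lee_fin mulr_ge0 ?ballw_ge0// expR_ge0.
- exact: measurable_ballI_integrand.
- apply: mulr_ge0; first exact: spec_ge0.
  by rewrite divr_ge0 ?powR_ge0// ltW// rGamma_gt0.
apply: eq_integral => v _; rewrite -EFinM; congr EFin.
have E : dotp (vaff (v0 R m) a v) (vaff (v0 R m) a v) = a ^+ 2 * dotp v v.
  by rewrite dotp_scale dotpC dotp_scale mulrA -expr2.
have E2 : dotp (vaff (v0 R m) a v) xi = dotp v (vaff (v0 R m) a xi).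
  by rewrite dotp_scale (dotpC v (vaff _ _ _)) dotp_scale (dotpC xi).
have a20 : 0 < a ^+ 2 by rewrite exprn_gt0.
rewrite /slab /bw /ballw E E2 -[X in _ < X]mulr1 ltr_pM2l//.
case: ifPn => _; last by rewrite mul0r mulr0.
rewrite [a ^+ 2 * dotp v v]mulrC mulfK ?gt_eqF//; ring.
Qed.

End poisson.

Section weight.
Variables (R : realType) (m : nat) (lam : R[i]) (alpha : R).
Hypothesis lam0 : 0 < Re lam.
Hypothesis alpha0 : 0 < alpha.
Local Notation mu := (mu R m).
Local Notation half := (m.+1%:R / 2 : R).
Local Notation beta := (alpha + half - 1).

(** In order: the Poisson normalization, kappa^2, the factors from [cabs_Qker], the normalization of
    the weight, and the constant of [ballI_BesselI]. *)
Definition wconst : R := (powR pi (- half) / cabs (cGamma (2 * lam))) ^+ 2 * pi ^+ m.+1 *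
  (4 * powR 2 (- (2 * Re lam))) * (powR (2 * pi) (- half) / rGamma alpha) *
  (rGamma alpha * Num.sqrt pi ^+ m.+1 * powR 2 beta).

(** The inverse of 0 being 0, positivity depends on Gamma(2 lam) being nonzero, which is
    [cGamma_neq0]. *)
Lemma wconst_gt0 : 0 < wconst.
Proof.
have p0 : 0 < pi :> R := pi_gt0 R.
have l2 : 0 < Re (2 * lam) by rewrite -creal_nat cReM cRe_creal cIm_creal mul0r subr0 mulr_gt0.
have G0 : 0 < cabs (cGamma (2 * lam)).
  by rewrite lt_def cabs_ge0 andbT cabs_eq0; exact: cGamma_neq0.
have r0 := rGamma_gt0 alpha0.
have h1 (x y : R) : 0 < x -> 0 < powR x y by exact: powR_gt0.
have h2 : 0 < 2 * pi :> R by rewrite mulr_gt0.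
rewrite /wconst; repeat apply: mulr_gt0 => //;
  rewrite ?invr_gt0 ?exprn_gt0 ?divr_gt0 ?sqrtr_gt0 ?h1//;
  by move: G0; rewrite /cabs sqrtr_gt0.
Qed.

Lemma vnorm_gt0 (xi : tup R m) : (0 < vnorm xi) = (dotp xi xi != 0).
Proof. by rewrite sqrtr_gt0 lt_def dotp_ge0 andbT. Qed.

Lemma vnorm_scale a (xi : tup R m) : 0 < a -> vnorm (vaff (v0 R m) a xi) = a * vnorm xi.
Proof.
move=> a0; rewrite /vnorm dotp_scale dotpC dotp_scale mulrA -expr2.
by rewrite sqrtrM ?sqr_ge0// sqrtr_sqr gtr0_norm.
Qed.

Lemma wla_origin (xi : tup R m) : vnorm xi = 0 -> @wla R m.+1 alpha lam xi = 0.
Proof. by move=> x0; rewrite /wla x0 powR0 ?mul0r// mulf_neq0// ?gt_eqF. Qed.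

(** The power of a collects a^(2s + n) from the Poisson constant, a^(-4s) from rewriting
    (r/(2a))^(2s) through (a r)^(2s), and a^n from the dilation of the ball. *)
Lemma integral_slab_wla (g : tup R m -> R[i]) a xi : cmeas g ->
  0 < a -> 0 < vnorm xi ->
  (\int[mu]_y (slab lam a g alpha y xi)%:E =
   (wconst * powR a (- 2 * Re lam + 2 * m.+1%:R) *
    (cabs (g xi) ^+ 2 * @wla R m.+1 alpha lam (vscale a xi)))%:E)%E.
Proof.
move=> mg a0 r0; rewrite integral_slab// (vscale_vaff a xi) ballI_BesselI ?vnorm_scale ?mulr_gt0//.
rewrite -EFinM; congr EFin.
rewrite /spec -vnorm_sqr cabs_Qker// cabs_pconst// /wla vnorm_scale// /wconst.
set r := vnorm xi in r0 *.
have -> : powR (r / (2 * a)) (2 * Re lam) =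
    powR (a * r) (2 * Re lam) * powR 2 (- (2 * Re lam)) * powR a (- (4 * Re lam)).
  rewrite /powR !gt_eqF ?divr_gt0 ?mulr_gt0// -!expRD; congr expR.
  rewrite lnM ?posrE ?invr_gt0 ?mulr_gt0// lnV ?posrE ?mulr_gt0// !lnM ?posrE//.
  ring.
have -> : powR a (- 2 * Re lam + 2 * m.+1%:R) =
    powR a (2 * Re lam + m.+1%:R) * powR a (- (4 * Re lam)) * a ^+ m.+1.
  rewrite -powR_mulrn ?(ltW a0)// /powR gt_eqF// -!expRD; congr expR; ring.
rewrite (mulrA 2 a r) (mulrC 2 a) -(mulrA a 2 r) (mulrCA a 2 r); ring.
Qed.

End weight.

(** The transform of an L^2 function is determined only almost everywhere, so the identity is stated
    for every mean-square limit [g] of truncated Fourier integrals. It is an identity of extended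
    reals. *)
Theorem mainTheorem12 (R : realType) (n : nat) (alpha : R) (lam : R[i]) :
  (1 <= n)%N -> 0 < alpha -> 0 < complex.Re lam ->
  exists c : R, 0 < c /\
    forall (f g : Rn R n -> R[i]) (a : R),
      L2 f -> is_fourierL2 f g -> 0 < a ->
      lhs_int alpha lam f a =
      ((c * powR a (- 2 * complex.Re lam + 2 * n%:R))%:E *
       iint (fun xi : Rn R n =>
               ((cabs (g xi)) ^+ 2 * wla alpha lam (vscale a xi))%:E))%E.
Proof.
case: n => // m _ alpha0 lam0; exists (wconst m lam alpha); split.
  exact: wconst_gt0.
move=> f g a [mf f2] [mg fg] a0.
have f2' : (sqnorm (mu R m) f < +oo)%E.
  move: f2; rewrite ge0_iint//.
  - by apply: measurable_cabs2.
  - by move=> x; rewrite lee_fin sqr_ge0.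
have fg' : (fun k => sqnorm (mu R m) (fun xi => g xi - fourier1 (trunc f k) xi))
    @ \oo --> 0%E.
  apply: cvg_trans fg; apply: near_eq_cvg; apply: nearW => k.
  have E xi : @fourier_trunc R m.+1 k%:R f xi = fourier1 (trunc f k) xi.
    rewrite /fourier_trunc /fourier1 /fourier0; congr (_ * _).
    rewrite -(cint_CI (cintegrable_fourier0 xi (cintegrable_trunc mf f2' k))).
    congr cint; apply/funext => u; rewrite /trunc; case: ifP => _ //.
    by rewrite mul0r.
  under [X in iint X]eq_fun do rewrite E.
  rewrite ge0_iint//.
  - apply: measurable_cabs2; apply: cmeasB => //.
    apply: cmeasM; first exact: cmeas_cst.
    by apply: cmeas_fourier0; exact: cmeas_trunc.
  - by move=> x; rewrite lee_fin sqr_ge0.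
rewrite (lhs_intE lam0 a0 alpha0 mf f2' mg fg').
set L := fun xi => (\int[mu R m]_y (slab lam a g alpha y xi)%:E)%E.
have L0 xi : (0 <= L xi)%E.
  by apply: integral_ge0 => y _; rewrite lee_fin slab_ge0.
have mL : measurable_fun setT L.
  apply: (measurable_fun_fubini_tonelli_G (m1 := mu R m)
    (fun z : tup R m * tup R m => (slab lam a g alpha z.1 z.2)%:E)).
    exact: measurable_slab.
  by move=> z; rewrite lee_fin slab_ge0.
(* The closed formula for [L] holds away from the origin, while [wla] is 0 there because 0^(2s) = 0.
   Changing [L] on this null set makes the two sides proportional everywhere. *)
pose W xi := if dotp xi xi != 0 then L xi else 0%E.
have W0 xi : (0 <= W xi)%E by rewrite /W; case: ifP.
have mW : measurable_fun setT W.
  apply: measurable_fun_ifT => //; apply: measurable_neg.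
  by apply: measurable_fun_eqr => //; exact: (@measurable_dotp R _ (tup R m) m id id).
have LW : (\int[mu R m]_xi L xi = \int[mu R m]_xi W xi)%E.
  apply: ae_eq_integral => //.
  exists [set xi | dotp xi xi = 0]; split.
  - exact: measurable_origin.
  - exact: null_origin.
  - move=> xi /= h; apply: contrapT => x0; apply: h => _.
    by rewrite /W ifT//; apply/eqP.
set A := (_ * powR a _)%R.
have A0 : 0 < A by rewrite mulr_gt0 ?wconst_gt0 ?powR_gt0.
pose h (xi : tup R m) := (cabs (g xi) ^+ 2 * @wla R m.+1 alpha lam (vscale a xi))%:E.
(* Measurability of the right-hand integrand is read off from [W], so the Bessel functions are never
   examined for it. *)
have hE xi : h xi = ((A^-1)%:E * W xi)%E.
  rewrite /h /W -vnorm_gt0; case: ifPn => x0.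
    by rewrite /L integral_slab_wla// -EFinM mulKf ?gt_eqF.
  have v0 : vnorm xi = 0.
    by apply/eqP; rewrite eq_le vnorm_ge0 andbT leNgt.
  by rewrite wla_origin ?mulr0 ?mule0// (vscale_vaff a xi) vnorm_scale// v0 mulr0.
transitivity (A%:E * iint h)%E => //.
have -> : h = (fun xi => (A^-1)%:E * W xi)%E by apply/funext.
rewrite LW ge0_iint; last 2 first.
- exact: measurable_funeM.
- by move=> xi; rewrite mule_ge0// lee_fin invr_ge0 ltW.
rewrite ge0_integralZl_EFin//; last by rewrite invr_ge0 ltW.
by rewrite muleA -EFinM mulfV ?gt_eqF// mul1e.
Qed.
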